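(* Let $H$ be Kashina #13. Then $H$ acts inner-faithfully on the algebra $\frac{\mathbb{C}\langle X,Y\rangle}{(r)}$ with $r=XY+YX$ or $r=X^2-Y^2$, and $$a.X=\pm\mathrm{i}Y,\quad b.X=X,\qquad a.Y=\pm\mathrm{i}X,\quad b.Y=-Y.$$ The invariant rings are: - for $r=XY+YX$: $\mathbb{C}[(X^2-Y^2)^2,\ X^2Y^2(X^2+Y^2)^2,\ X^6-Y^6+5X^2Y^2(X^2-Y^2)]$; - for $r=X^2-Y^2$: $\mathbb{C}[2X^4+(XY)^2+(YX)^2,\ 14X^8+(XY)^4+(YX)^4,\ X^2((XY)^2-(YX)^2)]$. Neither of the invariant rings is AS regular.
   Context: The base field is $\mathbb{C}$ and $\mathrm{i}=\sqrt{-1}$. Kashina #13 is the cotwist $H=(\mathbb{C}\,SD_{16})^J$, where $SD_{16}=\langle a,b\mid a^8=b^2=1,\ ba=a^3b\rangle$ is the semidihedral group of order 16. As an algebra $H=\mathbb{C}\,SD_{16}$ and its counit is that of the group algebra; its comultiplication is $\Delta^J(h)=J^{-1}\Delta(h)J$, where $\Delta$ is the group algebra comultiplication. Here, with $c=a^4$ and $\delta_1=\frac14(1+c+b+cb)$, $\delta_c=\frac14(1+c-b-cb)$, $\delta_b=\frac14(1-c+b-cb)$, $\delta_{cb}=\frac14(1-c-b+cb)$, \begin{align*} J={}&\delta_1\otimes\delta_1+\delta_1\otimes\delta_c+\delta_1\otimes\delta_b+\delta_1\otimes\delta_{cb}+\delta_c\otimes\delta_1+\delta_c\otimes\delta_c+\mathrm{i}\,\delta_c\otimes\delta_b-\mathrm{i}\,\delta_c\otimes\delta_{cb}\\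 &+\delta_b\otimes\delta_1-\mathrm{i}\,\delta_b\otimes\delta_c+\delta_b\otimes\delta_b+\mathrm{i}\,\delta_b\otimes\delta_{cb}+\delta_{cb}\otimes\delta_1+\mathrm{i}\,\delta_{cb}\otimes\delta_c-\mathrm{i}\,\delta_{cb}\otimes\delta_b+\delta_{cb}\otimes\delta_{cb}. \end{align*} ''$H$ acts on $A$'' means $A$ is a left $H$-module algebra (with respect to $\Delta^J$) with homogeneous grading-preserving action, $X,Y$ in degree 1; the action is determined by its values on $X,Y$. Inner-faithful: no nonzero Hopf ideal annihilates $A$. $A^H=\{f: h.f=\epsilon(h)f\ \forall h\in H\}$; $\mathbb{C}[f_1,\dots]$ denotes the subalgebra generated by the listed elements. A connected graded algebra is AS regular if it has finite global dimension, finite Gelfand–Kirillov dimension, and is AS Gorenstein (finite injective dimension $d$ and $\mathrm{Ext}^j_A(\mathbb{C},A)=\delta_{j,d}\,\mathbb{C}(l)$ for some $l$).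
   Formalization: The printed values a.X=±iY, a.Y=±iX force a^4 to act trivially, so that action is not inner-faithful; the formal statement gives these values to a^2 instead (a^2.X=±iY, a^2.Y=±iX, both signs equal, as the relations force). *)

(* Defs.v *)
(* monalg must be imported before the mathcomp-analysis files:
   in the other order their notations at level 2 clash. *)
From HB Require Import structures.
From mathcomp Require Import all_boot all_order all_algebra all_fingroup.
From mathcomp Require Import all_solvable falgebra.
From mathcomp Require Import finmap multinomials.monalg.
From mathcomp Require Import boolp classical_sets reals ereal sequences exp.
From mathcomp Require Import complex.

Set Implicit Arguments.
Unset Strict Implicit.
Unset Printing Implicit Defensive.

Import Order.TTheory GRing.Theory Num.Theory.
Local Open Scope ring_scope.
Local Open Scope classical_set_scope.

(** * Group algebras *)

Definition group_algebra (K : fieldType) (gT : finGroupType) : Type :=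
  {ffun gT -> K^o}.

HB.lock Definition group_algebra_mul (K : fieldType) (gT : finGroupType)
    (u v : group_algebra K gT) : group_algebra K gT :=
  [ffun x => \sum_(y : gT) u y * v (y^-1 * x)%g].

Section GroupAlgebra.
Variables (K : fieldType) (gT : finGroupType).
Local Notation H := (group_algebra K gT).

HB.instance Definition _ := Vector.on H.

Implicit Types u v w : H.

Definition group_algebra_one : H := [ffun x => (x == 1%g)%:R].

Fact group_algebra_mulA : associative (@group_algebra_mul K gT).
Proof.
move=> u v w; rewrite group_algebra_mul.unlock; apply/ffunP => x; rewrite !ffunE.
under eq_bigr => y _ do rewrite ffunE big_distrr /=.
under [RHS]eq_bigr => y _ do rewrite ffunE big_distrl /=.
rewrite [RHS]exchange_big /=; apply: eq_bigr => y _.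
rewrite [RHS](reindex_inj (mulgI y)) /=; apply: eq_bigr => z _.
by rewrite mulrA mulKg invMg mulgA.
Qed.

Fact group_algebra_mul1 : left_id group_algebra_one (@group_algebra_mul K gT).
Proof.
move=> u; rewrite group_algebra_mul.unlock; apply/ffunP => x.
rewrite !ffunE (bigD1 1%g) //= ffunE eqxx mul1r.
rewrite invg1 mul1g big1 ?addr0 // => y /negPf y1.
by rewrite ffunE y1 mul0r.
Qed.

Fact group_algebra_1mul : right_id group_algebra_one (@group_algebra_mul K gT).
Proof.
move=> u; rewrite group_algebra_mul.unlock; apply/ffunP => x.
rewrite !ffunE (bigD1 x) //= ffunE mulVg eqxx mulr1.
rewrite big1 ?addr0 // => y yx; rewrite ffunE -eq_mulVg1 (negPf yx).
by rewrite mulr0.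
Qed.

Fact group_algebra_mulDl : left_distributive (@group_algebra_mul K gT) +%R.
Proof.
move=> u v w; rewrite group_algebra_mul.unlock; apply/ffunP => x.
rewrite !ffunE -big_split /=.
by apply: eq_bigr => y _; rewrite ffunE mulrDl.
Qed.

Fact group_algebra_mulDr : right_distributive (@group_algebra_mul K gT) +%R.
Proof.
move=> u v w; rewrite group_algebra_mul.unlock; apply/ffunP => x.
rewrite !ffunE -big_split /=.
by apply: eq_bigr => y _; rewrite ffunE mulrDr.
Qed.

Fact group_algebra_oner_neq0 : group_algebra_one != 0.
Proof.
by apply/eqP => /ffunP/(_ 1%g)/eqP; rewrite !ffunE eqxx oner_eq0.
Qed.

HB.instance Definition _ := GRing.Zmodule_isNzRing.Build H
  group_algebra_mulA group_algebra_mul1 group_algebra_1mul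
  group_algebra_mulDl group_algebra_mulDr group_algebra_oner_neq0.

Fact group_algebra_mulE u v x : (u * v) x = \sum_(y : gT) u y * v (y^-1 * x)%g.
Proof.
have -> : u * v = group_algebra_mul u v by [].
by rewrite group_algebra_mul.unlock ffunE.
Qed.

Fact group_algebra_scaleAl (c : K) u v : c *: (u * v) = (c *: u) * v.
Proof.
apply/ffunP => x; rewrite ffunE !group_algebra_mulE scaler_sumr.
by apply: eq_bigr => y _; rewrite ffunE scalerAl.
Qed.

HB.instance Definition _ := GRing.Lmodule_isLalgebra.Build K H
  group_algebra_scaleAl.

Fact group_algebra_scaleAr (c : K) u v : c *: (u * v) = u * (c *: v).
Proof.
apply/ffunP => x; rewrite ffunE !group_algebra_mulE scaler_sumr.
by apply: eq_bigr => y _; rewrite ffunE scalerAr.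
Qed.

HB.instance Definition _ := GRing.Lalgebra_isAlgebra.Build K H
  group_algebra_scaleAr.
HB.instance Definition _ := Algebra_isFalgebra.Build K H.

Definition gelt (x : gT) : H := [ffun y => (y == x)%:R].

Definition counit u : K := \sum_x u x.

End GroupAlgebra.

Section Counit.
Variable K : fieldType.

Fact counitM (hT : finGroupType) (u v : group_algebra K hT) :
  counit (u * v) = counit u * counit v.
Proof.
rewrite /counit big_distrl /=.
under eq_bigr => x _ do rewrite group_algebra_mulE.
rewrite exchange_big; apply: eq_bigr => y _ /=.
rewrite big_distrr /= (reindex_inj (mulgI y)) /=.
by apply: eq_bigr => x _; rewrite mulKg.
Qed.

Fact counit1 (hT : finGroupType) : counit (1 : group_algebra K hT) = 1.
Proof.
rewrite /counit (bigD1 1%g) //= ffunE eqxx big1 ?addr0 // => x /negPf x1.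
by rewrite ffunE x1.
Qed.

Fact counit_gelt (hT : finGroupType) (x : hT) : counit (gelt K x) = 1.
Proof.
rewrite /counit (bigD1 x) //= ffunE eqxx big1 ?addr0 // => y /negPf yx.
by rewrite ffunE yx.
Qed.

Fact counit_linear (hT : finGroupType) : scalar (@counit K hT).
Proof.
move=> c u v; rewrite /counit big_distrr -big_split /=.
by apply: eq_bigr => x _; rewrite !ffunE.
Qed.

HB.instance Definition _ (hT : finGroupType) :=
  GRing.isLinear.Build K (group_algebra K hT) K *%R (@counit K hT)
    (@counit_linear hT).

Fact counitZ (hT : finGroupType) c (u : group_algebra K hT) :
  counit (c *: u) = c * counit u.
Proof. exact: linearZ. Qed.

Fact counit_sum (hT : finGroupType) (I : Type) (s : seq I)
    (F : I -> group_algebra K hT) :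
  counit (\sum_(i <- s) F i) = \sum_(i <- s) counit (F i).
Proof. exact: linear_sum. Qed.

End Counit.

(** The tensor square of [group_algebra K gT] is represented by
    [group_algebra K (gT * gT)], the basis vector [gelt (x, y)] standing for
    [gelt x (x) gelt y]. *)

Section TensorSquare.
Variables (K : fieldType) (gT : finGroupType).
Local Notation H := (group_algebra K gT).
Local Notation HH := (group_algebra K (gT * gT)%type).

Definition tensor (u v : H) : HH := [ffun p => u p.1 * v p.2].

Definition group_comul (h : H) : HH := \sum_x h x *: gelt K (x, x).

Definition cotwist (J : HH) (h : H) : HH := J^-1 * group_comul h * J.

Fact counit_tensor (u v : H) : counit (tensor u v) = counit u * counit v.
Proof.
rewrite /counit big_distrl /=.
under [RHS]eq_bigr => x _ do rewrite big_distrr /=.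
by rewrite pair_big /=; apply: eq_bigr => p _; rewrite ffunE.
Qed.

Fact counit_cotwist (J : HH) (h : H) : counit J = 1 ->
  counit (cotwist J h) = counit h.
Proof.
move=> counitJ; rewrite /cotwist !counitM counitJ mulr1.
have -> : counit (J^-1) = 1.
  case: (boolP (J \is a GRing.unit)) => [uJ|uJ]; last by rewrite invr_out.
  by rewrite -[LHS]mulr1 -counitJ -counitM mulVr // counit1.
rewrite mul1r /group_comul linear_sum /counit /=.
by apply: eq_bigr => x _; rewrite -/(counit _) linearZ /= counit_gelt mulr1.
Qed.

End TensorSquare.

(** * Hopf ideals, for the algebra [K gT] with the group algebra counit and a
    comultiplication [D] *)

Section HopfIdeals.
Variables (K : fieldType) (gT : finGroupType).
Local Notation H := (group_algebra K gT).
Local Notation HH := (group_algebra K (gT * gT)%type).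
Variable D : H -> HH.

Definition is_antipode (S : H -> H) : Prop :=
  [/\ linear S,
      forall h, \sum_p D h p *: (S (gelt K p.1) * gelt K p.2)
                  = counit h *: (1 : H)
    & forall h, \sum_p D h p *: (gelt K p.1 * S (gelt K p.2))
                  = counit h *: (1 : H)].

(** [I (x) H + H (x) I] *)
Definition coideal_tensor (I : set H) : set HH :=
  [set t | exists n (u v : 'I_n -> H),
     (forall i, I (u i) \/ I (v i)) /\ t = \sum_(i < n) tensor (u i) (v i)].

Definition hopf_ideal (I : set H) : Prop :=
  [/\ I 0 /\ (forall (c : K) u v, I u -> I v -> I (c *: u + v)),
      forall h u, I u -> I (h * u) /\ I (u * h),
      forall u, I u -> coideal_tensor I (D u) /\ counit u = 0
    & forall S, is_antipode S -> forall u, I u -> I (S u)].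

End HopfIdeals.

(** * Module algebras *)

Record module_algebra (K : fieldType) (gT : finGroupType)
    (D : group_algebra K gT -> group_algebra K (gT * gT)%type)
    (A : algType K) := ModuleAlgebra {
  act :> group_algebra K gT -> A -> A;
  act_linearl : forall f, linear (act^~ f);
  act_linearr : forall h, linear (act h);
  act1l : forall f, act 1 f = f;
  actMl : forall h k f, act (h * k) f = act h (act k f);
  act1r : forall h, act h 1 = (counit h)%:A;
  actMr : forall h f g,
    act h (f * g) = \sum_p D h p *: (act (gelt K p.1) f * act (gelt K p.2) g)
}.

Section Action.
Variables (K : fieldType) (gT : finGroupType).
Variables (D : group_algebra K gT -> group_algebra K (gT * gT)%type).
Variables (A : algType K) (M : module_algebra D A).

Definition inner_faithful : Prop :=
  forall I : set (group_algebra K gT), hopf_ideal D I ->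
  (forall h, I h -> forall f, M h f = 0) -> forall h, I h -> h = 0.

Definition invariants : {pred A} :=
  fun f => `[< forall h, M h f = counit h *: f >].

Definition graded_action (gr : nat -> set A) : Prop :=
  forall h n f, gr n f -> gr n (M h f).

End Action.

(** The subalgebra of [A] generated by the elements of [s] *)
Definition gen_subalg (K : fieldType) (A : algType K) (s : seq A) : set A :=
  [set f | forall B : {pred A},
     GRing.subalg_closed B -> {subset s <= B} -> f \in B].

(** * Kashina's Hopf algebra #13 *)

(** [SD_16 = <a, b | a^8 = b^2 = 1, ba = a^3 b>] *)
Definition sd16_generators (a b : 'SD_16) : Prop :=
  [/\ <<[set a; b]%SET>> = [set: 'SD_16]%SET, a ^+ 8 = 1, b ^+ 2 = 1
    & b * a = a ^+ 3 * b]%g.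

Fact sd16_generators_exist : exists a b : 'SD_16, sd16_generators a b.
Proof.
have := homg_refl ('SD_(2 ^ 4))%g; rewrite (Grp_semidihedral (n := 4)) //.
case/existsP=> -[x y] /= /eqP[defG x8 y2 xy]; exists x, y; split=> //.
  by rewrite -defG joing_idl joing_idr.
have yV : (y^-1 = y)%g by apply/eqP; rewrite eq_invg_mul -[(y * y)%g]/(y ^+ 2)%g y2.
by rewrite -xy conjgE yV -!mulgA -[(y * y)%g]/(y ^+ 2)%g y2 mulg1.
Qed.

Section Kashina13.
Variables (C : numClosedFieldType) (gT : finGroupType) (a b : gT).
Local Notation H := (group_algebra C gT).
Local Notation HH := (group_algebra C (gT * gT)%type).

(** [delta_1], [delta_c], [delta_b], [delta_cb], where [c = a^4] *)
Definition kashina_delta : seq H :=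
  let c := gelt C (a ^+ 4)%g in let b' := gelt C b in
  let cb := gelt C (a ^+ 4 * b)%g in
  [:: 4^-1 *: (1 + c + b' + cb);
      4^-1 *: (1 + c - b' - cb);
      4^-1 *: (1 - c + b' - cb);
      4^-1 *: (1 - c - b' + cb)].

Definition kashina_coef : seq (seq C) :=
  [:: [:: 1;    1;    1;    1];
      [:: 1;    1;   'i;  -'i];
      [:: 1;  -'i;    1;   'i];
      [:: 1;   'i;  -'i;    1]].

Definition kashina_J : HH := \sum_(i < 4) \sum_(j < 4)
  (nth [::] kashina_coef i)`_j *: tensor kashina_delta`_i kashina_delta`_j.

Definition kashina_comul : H -> HH := cotwist kashina_J.

Fact counit_kashina_delta (i : 'I_4) :
  counit kashina_delta`_i = (i == 0 :> nat)%:R.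
Proof.
have u4 : 4 != 0 :> C by rewrite pnatr_eq0.
case: i => -[|[|[|[|//]]]] /= _; rewrite linearZ /= !(linearD, linearN) /=;
  rewrite counit1 !counit_gelt /=.
- by rewrite -!addrA; exact: (mulVf u4).
- by rewrite addrK subrr mulr0.
- by rewrite subrr add0r subrr mulr0.
- by rewrite subrr sub0r addNr mulr0.
Qed.

Fact counit_kashina_J : counit kashina_J = 1.
Proof.
transitivity (\sum_(i < 4) \sum_(j < 4)
    (nth [::] kashina_coef i)`_j * ((i == 0 :> nat)%:R * (j == 0 :> nat)%:R)).
  rewrite counit_sum; apply: eq_bigr => i _.
  rewrite counit_sum; apply: eq_bigr => j _.
  by rewrite counitZ counit_tensor !counit_kashina_delta.
by rewrite !big_ord_recl !big_ord0 /= !(mul0r, mulr0, mulr1, addr0).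
Qed.

Section Invariants.
Variables (A : algType C) (M : module_algebra kashina_comul A).

Fact invariants_subalg : GRing.subalg_closed (invariants M).
Proof.
split.
- by apply/asboolP => h; rewrite act1r.
- move=> c f g /asboolP Mf /asboolP Mg; apply/asboolP => h.
  by rewrite act_linearr Mf Mg scalerDr !scalerA mulrC.
- move=> f g /asboolP Mf /asboolP Mg; apply/asboolP => h.
  rewrite actMr -(counit_cotwist h counit_kashina_J) [in RHS]/counit scaler_suml.
  apply: eq_bigr => p _.
  by rewrite Mf Mg !counit_gelt !scale1r.
Qed.


HB.instance Definition _ := GRing.isSubalgClosed.Build C A (invariants M)
  invariants_subalg.

Definition invariant_algebra : Type := {f : A | f \in invariants M}.

HB.instance Definition _ := SubChoice.on invariant_algebra.
HB.instance Definition _ := [SubChoice_isSubAlgebra of invariant_algebra by <:].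

End Invariants.
End Kashina13.

Arguments kashina_comul C {gT} a b h.

(** * The free algebra C<X, Y> *)

(** The free monoid on two letters. monalg's own [{fmonom 'I_2}] is the same
    monoid, but makes unification in the algebra impractically slow; the locked
    operations below serve the same purpose. *)
Definition word : Type := seq 'I_2.
HB.instance Definition _ := Choice.on word.

Fact word_unitm (m1 m2 : word) : m1 ++ m2 = [::] -> m1 = [::] /\ m2 = [::].
Proof. by case: m1 m2 => [|? ?] [|? ?]. Qed.

HB.instance Definition _ := Choice_isMonomialDef.Build word
  (@catA 'I_2) (@cat0s 'I_2) (@cats0 'I_2) word_unitm.

Record free_algebra (C : fieldType) := FreeAlgebra { fa_val : {malg C[word]} }.

HB.lock Definition fa_add (C : fieldType) (u v : free_algebra C) :=
  FreeAlgebra (fa_val u + fa_val v).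
HB.lock Definition fa_opp (C : fieldType) (u : free_algebra C) :=
  FreeAlgebra (- fa_val u).
HB.lock Definition fa_mul (C : fieldType) (u v : free_algebra C) :=
  FreeAlgebra (fa_val u * fa_val v).
HB.lock Definition fa_scale (C : fieldType) (c : C) (u : free_algebra C) :=
  FreeAlgebra (c *: fa_val u).

Section FreeAlgebra.
Variable C : fieldType.
Local Notation F := (free_algebra C).

HB.instance Definition _ := [isNew for @fa_val C].
HB.instance Definition _ := [Choice of F by <:].

Implicit Types u v w : F.

Fact fa_addA : associative (@fa_add C).
Proof. by move=> u v w; rewrite !fa_add.unlock; congr FreeAlgebra; apply: addrA. Qed.
Fact fa_addC : commutative (@fa_add C).
Proof. by move=> u v; rewrite !fa_add.unlock; congr FreeAlgebra; apply: addrC. Qed.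
Fact fa_add0 : left_id (FreeAlgebra 0) (@fa_add C).
Proof. by move=> [u]; rewrite fa_add.unlock; congr FreeAlgebra; apply: add0r. Qed.
Fact fa_addN : left_inverse (FreeAlgebra 0) (@fa_opp C) (@fa_add C).
Proof.
by move=> u; rewrite fa_add.unlock fa_opp.unlock; congr FreeAlgebra; apply: addNr.
Qed.
HB.instance Definition _ := GRing.isZmodule.Build F
  fa_addA fa_addC fa_add0 fa_addN.

Fact fa_valD u v : fa_val (u + v) = fa_val u + fa_val v.
Proof. have -> : u + v = fa_add u v by []. by rewrite fa_add.unlock. Qed.
Fact fa_val0 : fa_val (0 : F) = 0.
Proof. by []. Qed.

Fact fa_valN u : fa_val (- u) = - fa_val u.
Proof. have -> : - u = fa_opp u by []. by rewrite fa_opp.unlock. Qed.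

Fact fa_mulA : associative (@fa_mul C).
Proof. by move=> u v w; rewrite !fa_mul.unlock; congr FreeAlgebra; apply: mulrA. Qed.
Fact fa_1mul : left_id (FreeAlgebra 1) (@fa_mul C).
Proof. by move=> [u]; rewrite fa_mul.unlock; congr FreeAlgebra; apply: mul1r. Qed.
Fact fa_mul1 : right_id (FreeAlgebra 1) (@fa_mul C).
Proof. by move=> [u]; rewrite fa_mul.unlock; congr FreeAlgebra; apply: mulr1. Qed.
Fact fa_mulDl : left_distributive (@fa_mul C) +%R.
Proof.
move=> u v w; apply: val_inj; rewrite /= fa_valD fa_mul.unlock /= fa_valD.
exact: mulrDl.
Qed.
Fact fa_mulDr : right_distributive (@fa_mul C) +%R.
Proof.
move=> u v w; apply: val_inj; rewrite /= fa_valD fa_mul.unlock /= fa_valD.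
exact: mulrDr.
Qed.
Fact fa_oner_neq0 : FreeAlgebra 1 != 0 :> F.
Proof. by rewrite -val_eqE; exact: oner_neq0. Qed.
HB.instance Definition _ := GRing.Zmodule_isNzRing.Build F
  fa_mulA fa_1mul fa_mul1 fa_mulDl fa_mulDr fa_oner_neq0.

Fact fa_valM u v : fa_val (u * v) = fa_val u * fa_val v.
Proof. have -> : u * v = fa_mul u v by []. by rewrite fa_mul.unlock. Qed.

Fact fa_scaleA a b v : fa_scale a (fa_scale b v) = fa_scale (a * b) v.
Proof. by rewrite fa_scale.unlock; congr FreeAlgebra; apply: scalerA. Qed.
Fact fa_scale1 : left_id 1 (@fa_scale C).
Proof. by move=> [v]; rewrite fa_scale.unlock; congr FreeAlgebra; apply: scale1r. Qed.
Fact fa_scaleDr : right_distributive (@fa_scale C) +%R.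
Proof.
move=> a u v; apply: val_inj; rewrite /= fa_valD fa_scale.unlock /= fa_valD.
exact: scalerDr.
Qed.
Fact fa_scaleDl v : {morph (@fa_scale C)^~ v : a b / a + b}.
Proof.
move=> a b; apply: val_inj; rewrite /= fa_valD fa_scale.unlock /=.
exact: scalerDl.
Qed.
HB.instance Definition _ := GRing.Zmodule_isLmodule.Build C F
  fa_scaleA fa_scale1 fa_scaleDr fa_scaleDl.

Fact fa_valZ (c : C) u : fa_val (c *: u) = c *: fa_val u.
Proof. have -> : c *: u = fa_scale c u by []. by rewrite fa_scale.unlock. Qed.

Fact fa_scaleAl (c : C) u v : c *: (u * v) = (c *: u) * v.
Proof. by apply: val_inj; rewrite /= fa_valZ !fa_valM fa_valZ; exact: scalerAl. Qed.
HB.instance Definition _ := GRing.Lmodule_isLalgebra.Build C F fa_scaleAl.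

Fact fa_scaleAr (c : C) u v : c *: (u * v) = u * (c *: v).
Proof.
apply: val_inj; rewrite /= fa_valZ !fa_valM fa_valZ.
case: u v => [u] [v] /=.
rewrite [u * (c *: v)](malgMEw (fsubset_refl (msupp u)) (msuppZ_le c v)).
rewrite malgME scaler_sumr; apply: eq_bigr => k _.
rewrite scaler_sumr; apply: eq_bigr => l _; apply/malgP => m.
by rewrite mcoeffZ !mcoeffU mcoeffZ mulrnAr mulrCA.
Qed.
HB.instance Definition _ := GRing.Lalgebra_isAlgebra.Build C F fa_scaleAr.

End FreeAlgebra.

(** * Quadratic algebras C<X, Y>/(r) *)

Section QuadraticAlgebra.
Variable C : fieldType.
Local Notation F := (free_algebra C).

Definition fvar (i : 'I_2) : F := FreeAlgebra << [:: i] : word >>.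

Definition fhomog (n : nat) : set F :=
  [set f | forall w, (fa_val f)@_w != 0 -> size w = n].

Record quadric := Quadric { qrel :> F; qrel_homog : fhomog 2 qrel }.

Variable r : quadric.

(** The two-sided ideal generated by [r] *)
Definition rel_ideal : {pred F} := fun f => `[< exists n (u v : 'I_n -> F),
  f = \sum_(i < n) u i * qrel r * v i >].

Fact rel_idealMl (u f : F) : f \in rel_ideal -> u * f \in rel_ideal.
Proof.
move=> /asboolP[n [v [w ->]]]; apply/asboolP; exists n, (fun i => u * v i), w.
by rewrite mulr_sumr; apply: eq_bigr => i _; rewrite !mulrA.
Qed.

Fact rel_idealMr (u f : F) : f \in rel_ideal -> f * u \in rel_ideal.
Proof.
move=> /asboolP[n [v [w ->]]]; apply/asboolP; exists n, v, (fun i => w i * u).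
by rewrite mulr_suml; apply: eq_bigr => i _; rewrite !mulrA.
Qed.

Fact rel_ideal_zmod : zmod_closed rel_ideal.
Proof.
split=> [|f g].
  by apply/asboolP; exists 0%N, (fun=> 0), (fun=> 0); rewrite big_ord0.
move=> /asboolP[n [u [v ->]]] /asboolP[m [u' [v' ->]]]; apply/asboolP.
exists (n + m)%N, (fun i => match split i with inl j => u j | inr j => - u' j end),
  (fun i => match split i with inl j => v j | inr j => v' j end).
rewrite big_split_ord /= -sumrN; congr (_ + _); apply: eq_bigr => i _.
  by rewrite (unsplitK (inl i)).
by rewrite (unsplitK (inr i)) !mulNr.
Qed.


HB.instance Definition _ := GRing.isZmodClosed.Build F rel_ideal rel_ideal_zmod.

Fact fa_val1_eq0 (n : nat) (u v : 'I_n -> F) :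
  (fa_val (\sum_(i < n) u i * qrel r * v i))@_(@mone word) = 0.
Proof.
elim: n u v => [|n IH] u v; first by rewrite big_ord0 mcoeff0.
rewrite big_ord_recr /= fa_valD mcoeffD IH add0r !fa_valM !rmorphM /=.
suff -> : (fa_val (qrel r))@_(@mone word) = 0 by rewrite mulr0 mul0r.
by apply/eqP; apply: contraTT isT => /(qrel_homog (q := r)).
Qed.

Fact rel_ideal1 : 1 \notin rel_ideal.
Proof.
apply/asboolP => -[n [u [v E]]].
have := fa_val1_eq0 u v; rewrite -E mcoeff1 eqxx; apply/eqP; exact: oner_neq0.
Qed.


Local Open Scope quotient_scope.

(** [C<X, Y>/(r)]; mathcomp only makes [{quot _}] a ring for commutative
    rings. *)
Definition quad_algebra : Type := {ideal_quot rel_ideal}.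
Local Notation A := quad_algebra.

HB.instance Definition _ := GRing.Zmodule.on A.

Definition qpi (f : F) : A := \pi_{ideal_quot rel_ideal} f.
Definition qrepr (x : A) : F := generic_quotient.repr x.

Fact qpi_eq (f g : F) : (qpi f == qpi g) = (f - g \in rel_ideal).
Proof. by rewrite Quotient.idealrBE. Qed.

Fact qreprK : cancel qrepr qpi. Proof. exact: reprK. Qed.

Fact qpiB : zmod_morphism qpi. Proof. exact: pi_is_zmod_morphism. Qed.

HB.instance Definition _ := GRing.isZmodMorphism.Build F A qpi qpiB.

Definition quad_mul (x y : A) : A := qpi (qrepr x * qrepr y).
Definition quad_scale (c : C) (x : A) : A := qpi (c *: qrepr x).

Fact quad_mulE (f g : F) : quad_mul (qpi f) (qpi g) = qpi (f * g).
Proof.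
have E h : qrepr (qpi h) - h \in rel_ideal by rewrite -qpi_eq qreprK.
apply/eqP; rewrite qpi_eq.
have -> : qrepr (qpi f) * qrepr (qpi g) - f * g =
    (qrepr (qpi f) - f) * qrepr (qpi g) + f * (qrepr (qpi g) - g).
  by rewrite mulrBl mulrBr addrA subrK.
by apply: rpredD; [apply: rel_idealMr|apply: rel_idealMl]; exact: E.
Qed.

Fact quad_scaleE (c : C) (f : F) : quad_scale c (qpi f) = qpi (c *: f).
Proof.
apply/eqP; rewrite qpi_eq -scalerBr -[X in c *: X]mul1r scalerAl.
by rewrite rel_idealMl // -qpi_eq qreprK.
Qed.

Fact quad_mulA : associative quad_mul.
Proof.
move=> x y z; rewrite -(qreprK x) -(qreprK y) -(qreprK z).
by rewrite !quad_mulE mulrA.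
Qed.

Fact quad_1mul : left_id (qpi 1) quad_mul.
Proof. by move=> x; rewrite -(qreprK x) quad_mulE mul1r. Qed.

Fact quad_mul1 : right_id (qpi 1) quad_mul.
Proof. by move=> x; rewrite -(qreprK x) quad_mulE mulr1. Qed.

Fact quad_mulDl : left_distributive quad_mul +%R.
Proof.
move=> x y z; rewrite -(qreprK x) -(qreprK y) -(qreprK z).
by rewrite -raddfD !quad_mulE -raddfD mulrDl.
Qed.

Fact quad_mulDr : right_distributive quad_mul +%R.
Proof.
move=> x y z; rewrite -(qreprK x) -(qreprK y) -(qreprK z).
by rewrite -raddfD !quad_mulE -raddfD mulrDr.
Qed.

Fact quad_oner_neq0 : qpi 1 != 0.
Proof. by rewrite -[0](raddf0 qpi) qpi_eq subr0 rel_ideal1. Qed.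

HB.instance Definition _ := GRing.Zmodule_isNzRing.Build A
  quad_mulA quad_1mul quad_mul1 quad_mulDl quad_mulDr quad_oner_neq0.

Fact quad_scaleA c d x : quad_scale c (quad_scale d x) = quad_scale (c * d) x.
Proof. by rewrite -(qreprK x) !quad_scaleE scalerA. Qed.

Fact quad_scale1 : left_id 1 quad_scale.
Proof. by move=> x; rewrite -(qreprK x) quad_scaleE scale1r. Qed.

Fact quad_scaleDr : right_distributive quad_scale +%R.
Proof.
move=> c x y; rewrite -(qreprK x) -(qreprK y).
by rewrite -raddfD !quad_scaleE -raddfD scalerDr.
Qed.

Fact quad_scaleDl x : {morph quad_scale^~ x : c d / c + d}.
Proof. by move=> c d; rewrite -(qreprK x) !quad_scaleE -raddfD scalerDl. Qed.

HB.instance Definition _ := GRing.Zmodule_isLmodule.Build C A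
  quad_scaleA quad_scale1 quad_scaleDr quad_scaleDl.

Fact qpiM (f g : F) : qpi (f * g) = qpi f * qpi g.
Proof. by rewrite -quad_mulE. Qed.

Fact qpiZ (c : C) (f : F) : qpi (c *: f) = c *: qpi f.
Proof. by rewrite -quad_scaleE. Qed.

Fact quad_scaleAl (c : C) (x y : A) : c *: (x * y) = (c *: x) * y.
Proof.
by rewrite -(qreprK x) -(qreprK y) -qpiM -!qpiZ -qpiM scalerAl.
Qed.

HB.instance Definition _ := GRing.Lmodule_isLalgebra.Build C A quad_scaleAl.

Fact quad_scaleAr (c : C) (x y : A) : c *: (x * y) = x * (c *: y).
Proof.
by rewrite -(qreprK x) -(qreprK y) -qpiM -!qpiZ -qpiM scalerAr.
Qed.

HB.instance Definition _ := GRing.Lalgebra_isAlgebra.Build C A quad_scaleAr.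

Definition qX : A := qpi (fvar ord0).
Definition qY : A := qpi (fvar ord_max).

Definition qgrade (n : nat) : set A := qpi @` fhomog n.

End QuadraticAlgebra.

Arguments qgrade {C} r n _.

Section Relations.
Variable C : fieldType.
Local Notation X := (fvar C ord0).
Local Notation Y := (fvar C ord_max).

Fact fvar_mul (i j : 'I_2) :
  fvar C i * fvar C j = FreeAlgebra << [:: i; j] : word >>.
Proof.
apply: val_inj; rewrite /= fa_valM malgME !msuppU oner_eq0 !big_seq_fset1.
by rewrite !mcoeffUU mulr1.
Qed.

Fact fhomogD n (f g : free_algebra C) :
  fhomog n f -> fhomog n g -> fhomog n (f + g).
Proof.
move=> hf hg w; rewrite fa_valD mcoeffD.
have [->|f0 _] := eqVneq ((fa_val f)@_w) 0; last exact: hf.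
by rewrite add0r; exact: hg.
Qed.

Fact fhomogN n (f : free_algebra C) : fhomog n f -> fhomog n (- f).
Proof. by move=> hf w; rewrite fa_valN mcoeffN oppr_eq0; exact: hf. Qed.

Fact fhomog_fvar_mul (i j : 'I_2) : fhomog 2 (fvar C i * fvar C j).
Proof.
move=> w; rewrite fvar_mul /= mcoeffU.
by have [<- //|_] := eqVneq ([:: i; j] : word) w; rewrite mulr0n eqxx.
Qed.

Arguments fhomog_fvar_mul : clear implicits.

(** [XY + YX] and [X^2 - Y^2] *)
Definition skew_rel : quadric C :=
  Quadric (fhomogD (fhomog_fvar_mul ord0 ord_max) (fhomog_fvar_mul ord_max ord0)).
Definition square_rel : quadric C :=
  Quadric (fhomogD (fhomog_fvar_mul ord0 ord0)
                   (fhomogN (fhomog_fvar_mul ord_max ord_max))).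

End Relations.

(** * Homological algebra over a ring (left modules) *)

Section Resolutions.
Variable B : nzRingType.

Definition projective_module (P : lmodType B) : Prop :=
  forall (M N : lmodType B) (g : {linear M -> N}) (f : {linear P -> N}),
  (forall y, exists x, g x = y) ->
  exists h : {linear P -> M}, forall p, g (h p) = f p.

Definition injective_module (E : lmodType B) : Prop :=
  forall (M N : lmodType B) (i : {linear M -> N}) (f : {linear M -> E}),
  injective i -> exists h : {linear N -> E}, forall x, h (i x) = f x.

Record proj_resolution (M : lmodType B) := ProjResolution {
  pr_term : nat -> lmodType B;
  pr_diff : forall n, {linear pr_term n.+1 -> pr_term n};
  pr_augm : {linear pr_term 0%N -> M};
  pr_proj : forall n, projective_module (pr_term n);
  pr_augm_surj : forall y, exists x, pr_augm x = y;
  pr_exact0 : forall x, pr_augm x = 0 <-> exists y, pr_diff 0 y = x;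
  pr_exact : forall n x, pr_diff n x = 0 <-> exists y, pr_diff n.+1 y = x
}.

Record inj_resolution (M : lmodType B) := InjResolution {
  ir_term : nat -> lmodType B;
  ir_diff : forall n, {linear ir_term n -> ir_term n.+1};
  ir_augm : {linear M -> ir_term 0%N};
  ir_inj : forall n, injective_module (ir_term n);
  ir_augm_inj : injective ir_augm;
  ir_exact0 : forall x, ir_diff 0 x = 0 <-> exists y, ir_augm y = x;
  ir_exact : forall n x, ir_diff n.+1 x = 0 <-> exists y, ir_diff n y = x
}.

Definition proj_dim_le (M : lmodType B) (d : nat) : Prop :=
  exists P : proj_resolution M,
    forall n, (d < n)%N -> forall x : pr_term P n, x = 0.

Definition inj_dim_le (M : lmodType B) (d : nat) : Prop :=
  exists E : inj_resolution M,
    forall n, (d < n)%N -> forall x : ir_term E n, x = 0.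

Definition inj_dim_eq (M : lmodType B) (d : nat) : Prop :=
  inj_dim_le M d /\ forall e, inj_dim_le M e -> (d <= e)%N.

Definition finite_global_dimension : Prop :=
  exists d, forall M : lmodType B, proj_dim_le M d.

End Resolutions.

(** * Gradings *)

Definition internal_direct_sum (I : eqType) (V : zmodType) (V_ : I -> set V)
    : Prop :=
  [/\ forall i, V_ i 0 /\ (forall x y, V_ i x -> V_ i y -> V_ i (x - y)),
      forall x, exists (s : seq I) (c : I -> V),
        (forall i, V_ i (c i)) /\ x = \sum_(i <- s) c i
    & forall (s : seq I) (c : I -> V), uniq s -> (forall i, V_ i (c i)) ->
        \sum_(i <- s) c i = 0 -> {in s, forall i, c i = 0}].

Section GradedAlgebra.
Variables (K : fieldType) (B : algType K) (gr : nat -> set B).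

Definition connected_graded : Prop :=
  [/\ internal_direct_sum gr,
      forall m n x y, gr m x -> gr n y -> gr (m + n)%N (x * y)
    & forall x, gr 0%N x <-> exists c : K, x = c%:A].

Definition graded_module (M : lmodType B) (M_ : int -> set M) : Prop :=
  internal_direct_sum M_ /\
  forall (n : nat) (m : int) b x, gr n b -> M_ m x -> M_ (n%:Z + m) (b *: x).

(** [M] is the trivial module [K = B / B_{>0}] in degree 0; as [M] is
    concentrated in one degree, [B_{>0}] necessarily acts on it by 0. *)
Definition trivial_graded_module (M : lmodType B) (M_ : int -> set M) : Prop :=
  [/\ graded_module M_,
      forall x, M_ 0 x
    & exists2 t : M, t != 0 & forall x, exists c : K, x = c%:A *: t].

(** [G] makes [P] a projective resolution in the category of graded modules
    and degree 0 maps. *)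
Definition graded_resolution (M : lmodType B) (M_ : int -> set M)
    (P : proj_resolution M) (G : forall n, int -> set (pr_term P n)) : Prop :=
  [/\ forall n, graded_module (G n),
      forall n m x, G n.+1 m x -> G n m (pr_diff P n x)
    & forall m x, G 0%N m x -> M_ m (pr_augm P x)].

(** The component of degree [m] of [B], for [m] in [int] *)
Definition int_grade (m : int) : set B :=
  match m with Posz n => gr n | Negz _ => [set 0] end.

Section Ext.
Variables (M : lmodType B) (P : proj_resolution M).
Variable G : forall n, int -> set (pr_term P n).

(** Graded maps of degree [m] from [P_j] to the left module [B] *)
Definition graded_hom (j : nat) (m : int)
    : set {linear pr_term P j -> B^o} :=
  [set f | forall i x, G i x -> int_grade (i + m) (f x)].

Definition ext_cocycle (j : nat) (m : int)
    : set {linear pr_term P j -> B^o} :=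
  [set f | graded_hom m f /\ forall x, f (pr_diff P j x) = 0].

Definition ext_coboundary (j : nat) (m : int)
    : set {linear pr_term P j -> B^o} :=
  match j with
  | 0%N => [set f | forall x, f x = 0]
  | i.+1 => [set f | exists2 g : {linear pr_term P i -> B^o},
      graded_hom m g & forall x, f x = g (pr_diff P i x)]
  end.

(** [Ext^j(M, B)_m], computed from [P], is isomorphic to the subspace [E] of
    [K]. *)
Definition ext_iso (j : nat) (m : int) (E : set K) : Prop :=
  exists phi : {linear pr_term P j -> B^o} -> K,
  [/\ forall (c : K) f g h,
        ext_cocycle m f -> ext_cocycle m g -> ext_cocycle m h ->
        (forall x, h x = c *: (f x : B) + g x) -> phi h = c * phi f + phi g,
      forall f, ext_cocycle m f -> (phi f = 0 <-> ext_coboundary m f)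
    & forall e, E e <-> exists2 f, ext_cocycle m f & phi f = e].

End Ext.

(** [Ext^j_B(K, B) = 0] for [j != d] and [Ext^d_B(K, B) = K(l)], where
    [K(l)_m = K_(l + m)]. The right [B]-module structure needs no mention: a
    one-dimensional graded module is determined by its degree. *)
Definition AS_Gorenstein : Prop :=
  exists d, inj_dim_eq (B^o : lmodType B) d /\
  exists (l : int) (M : lmodType B) (M_ : int -> set M)
         (P : proj_resolution M) (G : forall n, int -> set (pr_term P n)),
    [/\ trivial_graded_module M_, graded_resolution M_ G
      & forall (j : nat) (m : int),
          ext_iso G j m [set e | (j = d /\ l + m = 0) \/ e = 0]].

End GradedAlgebra.

(** * Gelfand-Kirillov dimension *)

Section GKdimension.
Variables (K : fieldType) (B : algType K).

Definition lin_indep (I : finType) (v : I -> B) (J : {set I}) : Prop :=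
  forall c : I -> K, \sum_(i in J) c i *: v i = 0 -> {in J, forall i, c i = 0}.

Definition span_dim (I : finType) (v : I -> B) : nat :=
  \max_(J : {set I} | `[< lin_indep v J >]) #|J|.

(** [dim (K + V + ... + V^n)] for [V] the span of [s] *)
Definition growth (s : seq B) (n : nat) : nat :=
  span_dim (fun t : {ffun 'I_n -> 'I_(size s).+1} =>
    \prod_(i < n) (1 :: s)`_(t i)).

Definition GKdim (R : realType) : \bar R :=
  ereal_sup [set limn_esup (fun n : nat =>
    (ln (growth s n)%:R / ln n%:R : R)%:E) | s in setT].

End GKdimension.

Definition AS_regular (R : realType) (K : fieldType) (B : algType K)
    (gr : nat -> set B) : Prop :=
  [/\ finite_global_dimension B, (GKdim B R < +oo)%E & AS_Gorenstein gr].

(** * The actions of Kashina #13 on C<X, Y>/(r) *)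

Section KashinaAction.
Variables (C : numClosedFieldType) (gT : finGroupType) (a b : gT).
Variables (r : quadric C).
Variable M : module_algebra (kashina_comul C a b) (quad_algebra r).

(** With [b] acting on [<X, Y>] as [diag(1, -1)], the relation [ba = a^3 b]
    prevents [a] itself from acting by [X |-> z Y], [Y |-> z X] in a faithful
    way: it would force [a^4] to act as the identity. It is [a^2] that acts
    antidiagonally, [a] being then [q (z X + Y)], [q (X + z Y)] on [X], [Y],
    with [2 q^2 = 1]. *)
Definition kashina_values (z : C) : Prop :=
  graded_action M (qgrade r) /\
  [/\ M (gelt C (a ^+ 2)%g) (qX r) = z *: qY r, M (gelt C b) (qX r) = qX r,
      M (gelt C (a ^+ 2)%g) (qY r) = z *: qX r & M (gelt C b) (qY r) = - qY r].

Definition invariant_grade (n : nat) : set (invariant_algebra M) :=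
  [set f | qgrade r n (val f)].

End KashinaAction.

Arguments invariant_grade {C gT a b r} M n _.

(* Main.v *)
(** Let [f o g = m (J^-1 (f (x) g))] be the product of [A = C<X, Y>/(r)] untwisted
    by [J]. For the product [o], [SD_16] acts by automorphisms. With [u = X + Y]
    and [v = X - Y], the algebra [A] becomes the polynomial ring [C[u, v]] for
    [r = XY + YX], and the skew polynomial ring with [v o u = - u o v] for
    [r = X^2 - Y^2]; [a] multiplies [u] by a primitive eighth root of unity
    [zeta] and [v] by [zeta^3], and [b] exchanges [u] and [v]. The monomials
    [u^n v^m] are eigenvectors of [a], so [A] is a faithful module, and the
    invariants are spanned by the [u^n v^m +- u^m v^n] with [8 | n + 3 m]. Both
    products agree on invariants. These are generated by [p = u^2 v^2],
    [w = u^5 v +- u v^5] and [u^8 + v^8], and satisfy one relation [w^2 = p q].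
    Hence the ideal [(p, w)] is its own syzygy, which gives it a minimal free
    resolution of period one, and the global dimension is infinite. *)
From HB Require Import structures.
Require Import Defs.
From mathcomp Require Import all_boot all_order all_algebra all_fingroup.
From mathcomp Require Import all_solvable.
From mathcomp Require Import finmap multinomials.monalg.
From mathcomp Require Import boolp classical_sets reals complex.
From mathcomp Require Import ring zify.

Set Implicit Arguments.
Unset Strict Implicit.
Unset Printing Implicit Defensive.

Import Order.TTheory GRing.Theory Num.Theory.
Local Open Scope ring_scope.

(** * Finitely supported families *)

(** Only the actions of a^2 and b are prescribed, so every such action must first be identified with
    a model built here: the relation ba = a^3 b forces a to be given by a square root [zeta] of [z].
    The algebra and the plane are compared by a linear map in each direction. [phi] evaluates words
    with the twisted product; [theta] sends u^i v^j to ordered monomials in two anticommuting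
    generators of the algebra. Both are onto, and [phi] after [theta] is a graded endomorphism of a
    space with finite-dimensional components, hence injective. This is where linear independence of
    the ordered monomials comes from. J is diagonal in the idempotents of the Klein four-group
    generated by c and b, and its coefficients form a 2-cocycle on the characters of that group. So
    twisting keeps associativity and merely rescales products of eigenvectors. Finite projective
    dimension provides some finite projective resolution, not a minimal one. It is compared with the
    periodic resolution by chain maps and a homotopy; where it stops, the homotopy would put p into
    the square of the ideal (p, w). *)

HB.lock Definition lext (C : fieldType) (T : choiceType) (V : lmodType C)
    (L : T -> V) (f : {malg C[T]}) : V := \sum_(k <- msupp f) f@_k *: L k.

Section LinearExtension.
Variables (C : fieldType) (T : choiceType) (V : lmodType C).
Implicit Types (L : T -> V) (f g : {malg C[T]}).

Lemma lextEw L (d : {fset T}) f : (msupp f `<=` d)%fset ->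
  lext L f = \sum_(k <- d) f@_k *: L k.
Proof.
move=> fd; rewrite lext.unlock; apply: big_fset_incl fd _ => k _ /mcoeff_outdom ->.
by rewrite scale0r.
Qed.

Lemma lext_linear L : linear (lext L).
Proof.
move=> c f g; set d := (msupp f `|` msupp g)%fset.
have fd : (msupp f `<=` d)%fset by exact: fsubsetUl.
have gd : (msupp g `<=` d)%fset by exact: fsubsetUr.
have cfd : (msupp (c *: f + g) `<=` d)%fset.
  apply: fsubset_trans (msuppD_le _ _) _.
  by rewrite fsubUset gd andbT; exact: fsubset_trans (msuppZ_le _ _) fd.
rewrite (lextEw L fd) (lextEw L gd) (lextEw L cfd) scaler_sumr -big_split /=.
by apply: eq_bigr => k _; rewrite mcoeffD mcoeffZ scalerDl scalerA.
Qed.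

HB.instance Definition _ L :=
  GRing.isLinear.Build C {malg C[T]} V *:%R (lext L) (lext_linear L).

Lemma lextP c L L' f :
  lext (fun k => c *: L k + L' k) f = c *: lext L f + lext L' f.
Proof.
rewrite !lext.unlock scaler_sumr -big_split /=; apply: eq_bigr => k _.
by rewrite scalerDr !scalerA mulrC.
Qed.

Lemma eq_lext L L' f : L =1 L' -> lext L f = lext L' f.
Proof. by move=> LL; rewrite !lext.unlock; apply: eq_bigr => k _; rewrite LL. Qed.

Lemma lextU L k : lext L << k >> = L k.
Proof. by rewrite lext.unlock msuppU oner_eq0 big_seq_fset1 mcoeffUU scale1r. Qed.

Lemma malg_expand f : f = \sum_(k <- msupp f) f@_k *: << k >>.
Proof.
rewrite {1}[f]monalgE; apply: eq_bigr => k _; apply/malgP => l.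
by rewrite mcoeffZ !mcoeffU mulr_natr.
Qed.

Lemma linear_malg_ext (F G : {linear {malg C[T]} -> V}) :
  (forall k, F << k >> = G << k >>) -> F =1 G.
Proof.
move=> FG f; rewrite (malg_expand f) !linear_sum; apply: eq_bigr => k _.
by rewrite !linearZ /= FG.
Qed.

End LinearExtension.

Arguments linear_malg_ext {C T V} F G _ x.

(** The polynomials in [u], [v], with [pe C n m] for [u^n v^m]. The operations
    are locked, as [{malg _[_]}] makes unification impractically slow. *)
Record plane (C : fieldType) := Plane { plane_val : {malg C[(nat * nat)%type]} }.

HB.lock Definition plane_add (C : fieldType) (f g : plane C) :=
  Plane (plane_val f + plane_val g).
HB.lock Definition plane_opp (C : fieldType) (f : plane C) :=
  Plane (- plane_val f).
HB.lock Definition plane_scale (C : fieldType) (c : C) (f : plane C) :=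
  Plane (c *: plane_val f).
HB.lock Definition pcoef (C : fieldType) (k : nat * nat) (f : plane C) : C :=
  (plane_val f)@_k.
HB.lock Definition pe (C : fieldType) (n m : nat) : plane C :=
  Plane << (n, m) >>.
HB.lock Definition pext (C : fieldType) (V : lmodType C)
    (L : nat -> nat -> V) (f : plane C) : V :=
  lext (fun k => L k.1 k.2) (plane_val f).
HB.lock Definition psupp (C : fieldType) (f : plane C) : seq (nat * nat) :=
  msupp (plane_val f).

Section PlaneModule.
Variable C : fieldType.
Local Notation P := (plane C).

HB.instance Definition _ := [isNew for @plane_val C].
HB.instance Definition _ := [Choice of P by <:].

Implicit Types f g h : P.

Fact plane_addA : associative (@plane_add C).
Proof. by move=> f g h; rewrite !plane_add.unlock /= addrA. Qed.
Fact plane_addC : commutative (@plane_add C).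
Proof. by move=> f g; rewrite !plane_add.unlock addrC. Qed.
Fact plane_add0 : left_id (Plane 0) (@plane_add C).
Proof. by move=> [f]; rewrite plane_add.unlock /= add0r. Qed.
Fact plane_addN : left_inverse (Plane 0) (@plane_opp C) (@plane_add C).
Proof. by move=> f; rewrite plane_add.unlock plane_opp.unlock /= addNr. Qed.
HB.instance Definition _ := GRing.isZmodule.Build P
  plane_addA plane_addC plane_add0 plane_addN.

Fact plane_valD f g : plane_val (f + g) = plane_val f + plane_val g.
Proof. have -> : f + g = plane_add f g by []. by rewrite plane_add.unlock. Qed.

Fact plane_scaleA a b f : plane_scale a (plane_scale b f) = plane_scale (a * b) f.
Proof. by rewrite plane_scale.unlock /= scalerA. Qed.
Fact plane_scale1 : left_id 1 (@plane_scale C).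
Proof. by move=> [f]; rewrite plane_scale.unlock /= scale1r. Qed.
Fact plane_scaleDr : right_distributive (@plane_scale C) +%R.
Proof.
move=> a f g; apply: val_inj; rewrite /= plane_valD plane_scale.unlock /=.
by rewrite plane_valD scalerDr.
Qed.
Fact plane_scaleDl f : {morph (@plane_scale C)^~ f : a b / a + b}.
Proof.
move=> a b; apply: val_inj; rewrite /= plane_valD plane_scale.unlock /=.
exact: scalerDl.
Qed.
HB.instance Definition _ := GRing.Zmodule_isLmodule.Build C P
  plane_scaleA plane_scale1 plane_scaleDr plane_scaleDl.

Fact plane_valZ (c : C) f : plane_val (c *: f) = c *: plane_val f.
Proof. have -> : c *: f = plane_scale c f by []. by rewrite plane_scale.unlock. Qed.

Fact pcoef_linear k : scalar (@pcoef C k).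
Proof.
by move=> c f g; rewrite pcoef.unlock plane_valD plane_valZ mcoeffD mcoeffZ.
Qed.
HB.instance Definition _ k := GRing.isLinear.Build C P C *%R (@pcoef C k)
  (pcoef_linear k).

Lemma pcoefZ c f k : pcoef k (c *: f) = c * pcoef k f. Proof. exact: linearZ. Qed.
Lemma pcoefD f g k : pcoef k (f + g) = pcoef k f + pcoef k g.
Proof. exact: linearD. Qed.
Lemma pcoefN f k : pcoef k (- f) = - pcoef k f. Proof. exact: linearN. Qed.
Lemma pcoef0 k : pcoef k (0 : P) = 0. Proof. exact: linear0. Qed.

Lemma pcoefe n m k : pcoef k (pe C n m) = (k == (n, m))%:R.
Proof. by rewrite pcoef.unlock pe.unlock mcoeffU eq_sym. Qed.

Lemma pcoefP f g : (forall n m, pcoef (n, m) f = pcoef (n, m) g) -> f = g.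
Proof.
move=> fg; apply: val_inj; apply/malgP => -[n m].
by have := fg n m; rewrite pcoef.unlock.
Qed.

Lemma pcoef_supp k f : (k \in psupp f) = (pcoef k f != 0).
Proof. by rewrite psupp.unlock pcoef.unlock mcoeff_neq0. Qed.

Lemma pexpand f : f = \sum_(k <- psupp f) pcoef k f *: pe C k.1 k.2.
Proof.
have valE : {morph @plane_val C : g h / g + h} by exact: plane_valD.
apply: val_inj; rewrite /= {1}(malg_expand (plane_val f)) psupp.unlock.
rewrite (big_morph _ valE (erefl _ : plane_val (0 : P) = 0)).
apply: eq_bigr => -[n m] _.
by rewrite plane_valZ pcoef.unlock pe.unlock.
Qed.

Section Extension.
Variable V : lmodType C.
Implicit Types L : nat -> nat -> V.

Fact pext_linear L : linear (pext L).
Proof. by move=> c f g; rewrite pext.unlock plane_valD plane_valZ linearP. Qed.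
HB.instance Definition _ L := GRing.isLinear.Build C P V *:%R (pext L)
  (pext_linear L).

Lemma pexte L n m : pext L (pe C n m) = L n m.
Proof. by rewrite pext.unlock pe.unlock lextU. Qed.

Lemma pextP c L L' f :
  pext (fun n m => c *: L n m + L' n m) f = c *: pext L f + pext L' f.
Proof. by rewrite !pext.unlock lextP. Qed.

Lemma eq_pext L L' f : (forall n m, L n m = L' n m) -> pext L f = pext L' f.
Proof. by move=> LL; rewrite !pext.unlock; apply: eq_lext. Qed.

Lemma plane_ext (F G : {linear P -> V}) :
  (forall n m, F (pe C n m) = G (pe C n m)) -> F =1 G.
Proof.
move=> FG f; rewrite (pexpand f) !linear_sum; apply: eq_bigr => k _.
by rewrite !linearZ /= FG.
Qed.

End Extension.

Lemma plane_ext_scalar (F G : {scalar P}) :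
  (forall n m, F (pe C n m) = G (pe C n m)) -> F =1 G.
Proof.
move=> FG f; rewrite (pexpand f) !linear_sum; apply: eq_bigr => k _.
by rewrite !linearZ /= FG.
Qed.

End PlaneModule.

Definition pcoefE := (pcoefD, pcoefZ, pcoefN, pcoef0).

Arguments plane_ext {C V} F G _ x.
Arguments plane_ext_scalar {C} F G _ x.
(** * The twisted products *)

Section Twist.
Variables (C : numClosedFieldType) (s : bool).

Local Notation P := (plane C).
Local Notation G := (bool * bool)%type.
Local Notation e := (pe C).
Implicit Types f g h : P.

(** The product [o] of the header, [s] being [true] when [v o u = - u o v]. *)
Definition pmul f g : P :=
  pext (fun n m => pext (fun n' m' =>
    (-1) ^+ (s * (m * n')) *: e (n + n') (m + m')) g) f.

Definition pmulr g f := pmul f g.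

Lemma pmul_linearl g : linear (pmulr g).
Proof. by move=> c f1 f2; rewrite /pmulr /pmul linearP. Qed.

Lemma pmul_linearr f : linear (pmul f).
Proof.
move=> c g1 g2; rewrite /pmul -pextP; apply: eq_pext => n m.
by rewrite linearP.
Qed.

HB.instance Definition _ g := GRing.isLinear.Build C P P *:%R (pmulr g)
  (pmul_linearl g).
HB.instance Definition _ f := GRing.isLinear.Build C P P *:%R (pmul f)
  (pmul_linearr f).

Lemma pmulZl c f g : pmul (c *: f) g = c *: pmul f g.
Proof. exact: (linearZZ (pmulr g)). Qed.
Lemma pmulZr c f g : pmul f (c *: g) = c *: pmul f g.
Proof. exact: (linearZZ (pmul f)). Qed.
Lemma pmulDl f1 f2 g : pmul (f1 + f2) g = pmul f1 g + pmul f2 g.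
Proof. exact: (linearD (pmulr g)). Qed.
Lemma pmulDr f g1 g2 : pmul f (g1 + g2) = pmul f g1 + pmul f g2.
Proof. exact: (linearD (pmul f)). Qed.
Lemma pmul0l g : pmul 0 g = 0. Proof. exact: (linear0 (pmulr g)). Qed.
Lemma pmul0r f : pmul f 0 = 0. Proof. exact: (linear0 (pmul f)). Qed.
Lemma pmulNl f g : pmul (- f) g = - pmul f g.
Proof. exact: (linearN (pmulr g)). Qed.
Lemma pmulNr f g : pmul f (- g) = - pmul f g.
Proof. exact: (linearN (pmul f)). Qed.
Lemma pmul_suml I (r : seq I) (Q : pred I) F g :
  pmul (\sum_(i <- r | Q i) F i) g = \sum_(i <- r | Q i) pmul (F i) g.
Proof. exact: (linear_sum (pmulr g)). Qed.
Lemma pmul_sumr I (r : seq I) (Q : pred I) F f :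
  pmul f (\sum_(i <- r | Q i) F i) = \sum_(i <- r | Q i) pmul f (F i).
Proof. exact: (linear_sum (pmul f)). Qed.

Lemma pmulee n m n' m' :
  pmul (e n m) (e n' m') = (-1) ^+ (s * (m * n')) *: e (n + n') (m + m').
Proof. by rewrite /pmul !pexte. Qed.

Definition pmulE := (pmulDl, pmulDr, pmulNl, pmulNr, pmulZl, pmulZr, pmulee,
  mul0n, mul1n, addn0, add0n).

(** On monomials both bracketings produce the sign of exponent
    [s * (m * n' + m * n'' + m' * n'')]. *)
Lemma pmulA : associative pmul.
Proof.
move=> f g h; apply: (plane_ext (pmulr (pmul g h))
  (pmulr h \o pmulr g)) => n m /=.
apply: (plane_ext (pmul (e n m) \o pmulr h)
  (pmulr h \o pmul (e n m))) => n' m' /=.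
apply: (plane_ext (pmul (e n m) \o pmul (e n' m'))
  (pmul (pmul (e n m) (e n' m')))) => n'' m'' /=.
rewrite /pmulr /= !pmulee !pmulZl !pmulZr !pmulee !scalerA -!exprD !addnA.
by congr (_ ^+ _ *: _); rewrite !mulnDl !mulnDr; lia.
Qed.

Lemma pmul1l : left_id (e 0 0) pmul.
Proof.
move=> f; apply: (plane_ext (pmul (e 0 0)) idfun) => n m.
by rewrite /= pmulee mul0n muln0 expr0 scale1r.
Qed.

Lemma pmul1r : right_id (e 0 0) pmul.
Proof.
move=> f; apply: (plane_ext (pmulr (e 0 0)) idfun) => n m.
by rewrite /= /pmulr pmulee !muln0 expr0 scale1r !addn0.
Qed.

(** [pc] and [pb] are the actions of [c = a^4] and [b]. *)
Definition pc f : P := pext (fun n m => (-1) ^+ (n + m) *: e n m) f.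
Definition pb f : P := pext (fun n m => (-1) ^+ (s * (n * m)) *: e m n) f.

HB.instance Definition _ :=
  GRing.isLinear.Build C P P *:%R pc (pext_linear _).
HB.instance Definition _ :=
  GRing.isLinear.Build C P P *:%R pb (pext_linear _).

Lemma pce n m : pc (e n m) = (-1) ^+ (n + m) *: e n m.
Proof. by rewrite /pc pexte. Qed.
Lemma pbe n m : pb (e n m) = (-1) ^+ (s * (n * m)) *: e m n.
Proof. by rewrite /pb pexte. Qed.

Lemma pcZ c f : pc (c *: f) = c *: pc f. Proof. exact: linearZZ. Qed.
Lemma pbZ c f : pb (c *: f) = c *: pb f. Proof. exact: linearZZ. Qed.

Lemma pcK : involutive pc.
Proof.
apply: (plane_ext (pc \o pc) idfun) => n m /=.
by rewrite pce linearZ /= pce scalerA -exprD -signr_odd oddD addbb scale1r.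
Qed.

Lemma pbK : involutive pb.
Proof.
apply: (plane_ext (pb \o pb) idfun) => n m /=.
rewrite pbe linearZ /= pbe scalerA -exprD [(m * n)%N]mulnC.
by rewrite -signr_odd oddD addbb scale1r.
Qed.

Lemma pbc f : pb (pc f) = pc (pb f).
Proof.
apply: (plane_ext (pb \o pc) (pc \o pb)) => n m /=.
by rewrite pce pbe !linearZ /= pce pbe !scalerA mulrC addnC.
Qed.

Lemma pcM f g : pc (pmul f g) = pmul (pc f) (pc g).
Proof.
apply: (plane_ext (pc \o pmulr g) (pmulr (pc g) \o pc)) => n m /=.
apply: (plane_ext (pc \o pmul (e n m)) (pmul (pc (e n m)) \o pc))
  => n' m' /=.
rewrite /pmulr !pce pmulee linearZ /= pce pmulZl pmulZr pmulee !scalerA -!exprD.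
by congr (_ ^+ _ *: _); lia.
Qed.

(** The sign in [pb] is that of reordering v^n u^m into u^m v^n, so [pb] is the automorphism
    exchanging u and v. Only parities matter, hence the case analysis. *)
Lemma pbM f g : pb (pmul f g) = pmul (pb f) (pb g).
Proof.
apply: (plane_ext (pb \o pmulr g) (pmulr (pb g) \o pb)) => n m /=.
apply: (plane_ext (pb \o pmul (e n m)) (pmul (pb (e n m)) \o pb))
  => n' m' /=.
rewrite /pmulr !pbe pmulee linearZ /= pbe pmulZl pmulZr pmulee !scalerA -!exprD.
congr (_ *: _); rewrite -signr_odd -[RHS]signr_odd !(oddD, oddM).
by case: (odd s) (odd n) (odd m) (odd n') (odd m') => [] [] [] [] [].
Qed.

(** The action of [delta_1], [delta_c], [delta_b], [delta_cb] for [i] equal to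
    [(false, false)], [(false, true)], [(true, false)], [(true, true)]. The
    definition is locked since rewriting would unify through it; likewise for
    [dot], [phi], [theta] and [pact] below. *)
Fact pproj_key : unit. Proof. exact: tt. Qed.
Definition pproj (i : G) f : P := locked_with pproj_key (4^-1 *:
  (f + (-1) ^+ i.1 *: pc f + (-1) ^+ i.2 *: pb f
     + (-1) ^+ (i.1 (+) i.2) *: pc (pb f))).

Fact pprojE (i : G) f : pproj i f = 4^-1 *:
  (f + (-1) ^+ i.1 *: pc f + (-1) ^+ i.2 *: pb f
     + (-1) ^+ (i.1 (+) i.2) *: pc (pb f)).
Proof. by rewrite /pproj unlock. Qed.

Fact pproj_linear i : linear (pproj i).
Proof.
move=> c f g; rewrite !pprojE !linearP /=; apply: pcoefP => k l.
by rewrite !pcoefE; ring.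
Qed.
HB.instance Definition _ i :=
  GRing.isLinear.Build C P P *:%R (pproj i) (pproj_linear i).

(** Eigenvectors of the Klein four-group generated by c and b, for the character with signs given by
    [i.1] and [i.2]. They grade the plane by the character group, whose law is [gadd]. *)
Definition phom (i : G) f := pc f = (-1) ^+ i.1 *: f /\ pb f = (-1) ^+ i.2 *: f.

Lemma pproj_hom i f : phom i (pproj i f).
Proof.
have s2 (x : bool) : (-1) ^+ x * (-1) ^+ x = 1 :> C by rewrite -expr2 sqrr_sign.
rewrite /phom pprojE; split; rewrite linearZ !linearD !linearZ /= ?pbc ?pcK ?pbK;
  apply: pcoefP => k l; rewrite !pcoefE signr_addb;
  by case: i => -[] [] /=; ring.
Qed.

Lemma phom_proj i j f : phom i f -> pproj j f = (i == j)%:R *: f.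
Proof.
have u4 : 4 != 0 :> C by rewrite pnatr_eq0.
move=> [fc fb]; rewrite pprojE fb pcZ fc !scalerA signr_addb.
apply: pcoefP => k l; rewrite !pcoefE.
by case: i j {fc fb} => -[] [] [[] []] /=; field.
Qed.

Lemma pproj_sum f : \sum_i pproj i f = f.
Proof.
have u4 : 4 != 0 :> C by rewrite pnatr_eq0.
rewrite -(pair_bigA _ (fun x y => pproj (x, y) f)) /=.
rewrite !big_bool !pprojE /=; apply: pcoefP => k l; rewrite !pcoefE.
by field.
Qed.

Definition gadd (i j : G) : G := (i.1 (+) j.1, i.2 (+) j.2).

Lemma phomD i f g : phom i f -> phom i g -> phom i (f + g).
Proof.
by move=> [fc fb] [gc gb]; split; rewrite linearD /= ?fc ?gc ?fb ?gb scalerDr.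
Qed.

Lemma phomZ i c f : phom i f -> phom i (c *: f).
Proof.
by move=> [fc fb]; split; rewrite ?pcZ ?pbZ ?fc ?fb !scalerA mulrC.
Qed.

Lemma phomM i j f g : phom i f -> phom j g -> phom (gadd i j) (pmul f g).
Proof.
move=> [fc fb] [gc gb]; split.
  by rewrite pcM fc gc pmulZl pmulZr scalerA signr_addb.
by rewrite pbM fb gb pmulZl pmulZr scalerA signr_addb.
Qed.

Definition gcoef (i j : G) : C :=
  (nth [::] (kashina_coef C) (i.1 * 2 + i.2))`_(j.1 * 2 + j.2).

(** The 2-cocycle identity on the character group: exactly what associativity of the twisted product
    requires. *)
Lemma gcoef_cocycle i j k :
  gcoef i j * gcoef (gadd i j) k = gcoef j k * gcoef i (gadd j k).
Proof.
have i2 := sqrCi C; rewrite expr2 in i2.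
by case: i j k => -[] [] [[] []] [[] []]; rewrite /gcoef /= ?mulr1 ?mul1r //;
   rewrite ?mulNr ?mulrN ?i2 ?opprK.
Qed.

(** The product of [C<X, Y>/(r)], see [phiM]. *)
Fact dot_key : unit. Proof. exact: tt. Qed.
Definition dot f g : P := locked_with dot_key
  (\sum_i \sum_j gcoef i j *: pmul (pproj i f) (pproj j g)).

Fact dotE f g :
  dot f g = \sum_i \sum_j gcoef i j *: pmul (pproj i f) (pproj j g).
Proof. by rewrite /dot unlock. Qed.

Definition dotr g f := dot f g.

Fact dot_linearl g : linear (dotr g).
Proof.
move=> c f1 f2; rewrite /dotr !dotE scaler_sumr -big_split /=; apply: eq_bigr => i _.
rewrite scaler_sumr -big_split /=; apply: eq_bigr => j _.
by rewrite linearP pmulDl pmulZl scalerDr !scalerA mulrC.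
Qed.

Fact dot_linearr f : linear (dot f).
Proof.
move=> c f1 f2; rewrite !dotE scaler_sumr -big_split /=; apply: eq_bigr => i _.
rewrite scaler_sumr -big_split /=; apply: eq_bigr => j _.
by rewrite linearP pmulDr pmulZr scalerDr !scalerA mulrC.
Qed.

HB.instance Definition _ g := GRing.isLinear.Build C P P *:%R (dotr g)
  (dot_linearl g).
HB.instance Definition _ f := GRing.isLinear.Build C P P *:%R (dot f)
  (dot_linearr f).

Lemma dot_hom i j f g : phom i f -> phom j g -> dot f g = gcoef i j *: pmul f g.
Proof.
move=> fi gj; rewrite dotE (bigD1 i) //= (bigD1 j) //= !big1 ?addr0.
- by rewrite (phom_proj _ fi) (phom_proj _ gj) !eqxx !scale1r.
- move=> k; rewrite eq_sym => /negPf ki; rewrite big1 // => l _.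
  by rewrite (phom_proj _ fi) ki scale0r pmul0l scaler0.
- move=> k; rewrite eq_sym => /negPf kj.
  by rewrite (phom_proj k gj) kj scale0r pmul0r scaler0.
Qed.

Lemma dotZl c f g : dot (c *: f) g = c *: dot f g.
Proof. exact: (linearZZ (dotr g)). Qed.
Lemma dotZr c f g : dot f (c *: g) = c *: dot f g.
Proof. exact: (linearZZ (dot f)). Qed.
Lemma dot_suml I (r : seq I) (Q : pred I) F g :
  dot (\sum_(i <- r | Q i) F i) g = \sum_(i <- r | Q i) dot (F i) g.
Proof. exact: (linear_sum (dotr g)). Qed.
Lemma dot_sumr I (r : seq I) (Q : pred I) F f :
  dot f (\sum_(i <- r | Q i) F i) = \sum_(i <- r | Q i) dot f (F i).
Proof. exact: (linear_sum (dot f)). Qed.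

(** Once the three factors are split into eigenvectors, the two sides differ by the two sides of the
    cocycle identity. *)
Lemma dotA : associative dot.
Proof.
move=> f g h.
rewrite -{1}(pproj_sum f) -{2}(pproj_sum f) dot_suml [dot (\sum_i _) g]dot_suml.
rewrite [RHS]dot_suml; apply: eq_bigr => i _.
rewrite -{1}(pproj_sum g) -{2}(pproj_sum g) dot_suml.
rewrite [LHS]dot_sumr [dot _ (\sum_i _)]dot_sumr [RHS]dot_suml.
apply: eq_bigr => j _.
rewrite -{1}(pproj_sum h) -{2}(pproj_sum h) dot_sumr [LHS]dot_sumr [RHS]dot_sumr.
apply: eq_bigr => k _.
have fi := pproj_hom i f; have gj := pproj_hom j g; have hk := pproj_hom k h.
rewrite (dot_hom fi gj) (dot_hom gj hk) dotZl dotZr.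
rewrite (dot_hom fi (phomM gj hk)) (dot_hom (phomM fi gj) hk).
by rewrite !scalerA pmulA gcoef_cocycle.
Qed.

Lemma phom1 : phom (false, false) (e 0 0).
Proof. by split; rewrite ?pce ?pbe ?muln0 expr0 scale1r. Qed.

Lemma gcoef0l i : gcoef (false, false) i = 1.
Proof. by case: i => -[] []. Qed.

Lemma gcoef0r i : gcoef i (false, false) = 1.
Proof. by case: i => -[] []. Qed.

(** The cocycle is normalized, so a factor with trivial character is multiplied without twist.
    Invariants are such factors. *)
Lemma dot_hom0l f g : phom (false, false) f -> dot f g = pmul f g.
Proof.
move=> f0; rewrite -(pproj_sum g) dot_sumr pmul_sumr; apply: eq_bigr => j _.
by rewrite (dot_hom f0 (pproj_hom j g)) gcoef0l scale1r.
Qed.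

Lemma dot_hom0r f g : phom (false, false) g -> dot f g = pmul f g.
Proof.
move=> g0; rewrite -(pproj_sum f) dot_suml pmul_suml; apply: eq_bigr => j _.
by rewrite (dot_hom (pproj_hom j f) g0) gcoef0r scale1r.
Qed.

Lemma dot1l : left_id (e 0 0) dot.
Proof. by move=> f; rewrite dot_hom0l ?pmul1l //; exact: phom1. Qed.

Lemma dot1r : right_id (e 0 0) dot.
Proof. by move=> f; rewrite dot_hom0r ?pmul1r //; exact: phom1. Qed.

End Twist.

(** * The grading of the plane *)

Section PlaneGrading.
Variables (C : numClosedFieldType) (s : bool).
Local Notation P := (plane C).
Local Notation e := (pe C).
Implicit Types f g h : P.

Definition pcomp n f : P := pext (fun i j => (i + j == n)%N%:R *: e i j) f.
HB.instance Definition _ n :=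
  GRing.isLinear.Build C P P *:%R (pcomp n) (pext_linear _).

Lemma pcompe n i j : pcomp n (e i j) = (i + j == n)%N%:R *: e i j.
Proof. by rewrite /pcomp pexte. Qed.

Lemma pcoef_comp n i j f :
  pcoef (i, j) (pcomp n f) = (i + j == n)%N%:R * pcoef (i, j) f.
Proof.
rewrite -pcoefZ; apply: (plane_ext_scalar (pcoef (i, j) \o pcomp n)
  (pcoef (i, j) \o ((i + j == n)%N%:R \*: idfun))) => a b /=.
rewrite pcompe !pcoefZ pcoefe /=.
by case: ((i, j) =P (a, b)) => [[-> ->]|_] //; rewrite !mulr0.
Qed.

(** As a fixed-point equation, homogeneity is preserved by any linear map commuting with [pcomp]. *)
Definition pdeg n f := pcomp n f = f.

Lemma pcompK n f : pdeg n (pcomp n f).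
Proof.
apply: pcoefP => i j; rewrite !pcoef_comp.
by case: eqP; rewrite ?mul0r ?mul1r.
Qed.

Lemma pdegP n f : (forall i j, pcoef (i, j) f != 0 -> (i + j)%N = n) <-> pdeg n f.
Proof.
split=> [H|H i j]; last first.
  rewrite -H pcoef_comp.
  by case: (i + j =P n)%N => // _; rewrite mul0r eqxx.
apply: pcoefP => i j; rewrite pcoef_comp; have := H i j.
by have [->|_ ->] := eqVneq (pcoef (i, j) f) 0; rewrite ?mulr0 ?eqxx ?mul1r.
Qed.

Lemma pdege n m : pdeg (n + m) (e n m).
Proof. by rewrite /pdeg pcompe eqxx scale1r. Qed.

Lemma pdegD n f g : pdeg n f -> pdeg n g -> pdeg n (f + g).
Proof. by rewrite /pdeg linearD /= => -> ->. Qed.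

Lemma pdegZ n c f : pdeg n f -> pdeg n (c *: f).
Proof. by rewrite /pdeg linearZ /= => ->. Qed.

Lemma pdeg_sum n I (r : seq I) (Q : pred I) F :
  (forall i, Q i -> pdeg n (F i)) -> pdeg n (\sum_(i <- r | Q i) F i).
Proof.
by move=> H; rewrite /pdeg linear_sum /=; apply: eq_bigr => i /H.
Qed.

Lemma pdegM n m f g : pdeg n f -> pdeg m g -> pdeg (n + m) (pmul s f g).
Proof.
(* Replacing the factors by their components turns the claim into an equality of bilinear maps,
   which is checked on monomials. *)
move=> <- <-; rewrite /pdeg.
apply: (plane_ext (pcomp (n + m) \o pmulr s (pcomp m g) \o pcomp n)
  (pmulr s (pcomp m g) \o pcomp n)) => i j /=; rewrite /pmulr.
apply: (plane_ext (pcomp (n + m) \o pmul s (pcomp n (e i j)) \o pcomp m)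
  (pmul s (pcomp n (e i j)) \o pcomp m)) => i' j' /=.
rewrite !pcompe.
case: (i + j =P n)%N => [<-|_]; last by rewrite scale0r !pmul0l linear0.
case: (i' + j' =P m)%N => [<-|_]; last by rewrite scale0r !pmul0r linear0.
by rewrite !scale1r pmulee linearZ /= pcompe addnACA eqxx scale1r.
Qed.

Lemma pcomp_pc n f : pcomp n (pc f) = pc (pcomp n f).
Proof.
apply: (plane_ext (pcomp n \o @pc C) (@pc C \o pcomp n)) => i j /=.
by rewrite pce !pcompe pcZ linearZ /= pce pcompe !scalerA mulrC.
Qed.

Lemma pcomp_pb n f : pcomp n (pb s f) = pb s (pcomp n f).
Proof.
apply: (plane_ext (pcomp n \o pb s) (pb s \o pcomp n)) => i j /=.
by rewrite pbe !pcompe pbZ linearZ /= pbe pcompe !scalerA mulrC addnC.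
Qed.

Lemma pdeg_proj n i f : pdeg n f -> pdeg n (pproj s i f).
Proof.
move=> fn; rewrite pprojE; apply: pdegZ; rewrite /pdeg !linearD !linearZ /=.
by rewrite !pcomp_pc !pcomp_pb fn.
Qed.

Lemma pdeg_dot n m f g : pdeg n f -> pdeg m g -> pdeg (n + m) (dot s f g).
Proof.
move=> fn gm; rewrite dotE; apply: pdeg_sum => i _; apply: pdeg_sum => j _.
by apply: pdegZ; apply: pdegM; exact: pdeg_proj.
Qed.

Section GradedEndomorphism.
Variable L : {linear P -> P}.
Hypothesis L_deg : forall i j, pdeg (i + j) (L (e i j)).

Lemma pcomp_graded n f : pcomp n (L f) = L (pcomp n f).
Proof.
apply: (plane_ext (pcomp n \o L) (L \o pcomp n)) => i j /=.
rewrite pcompe linearZ /=; case: eqP => [<-|ne]; first by rewrite scale1r L_deg.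
rewrite scale0r -(L_deg i j); apply: pcoefP => k l; rewrite !pcoef_comp pcoef0.
case: eqP => [->|_]; last by rewrite mul0r.
by case: eqP => [/esym //|_]; rewrite mul0r mulr0.
Qed.

(** The matrix of [L] on the component of degree [n], in the basis u^i v^(n-i). *)
Lemma graded_coef n (j : 'I_n.+1) f :
  pcoef (nat_of_ord j, n - j)%N (L f) =
  \sum_(i < n.+1) pcoef (nat_of_ord i, n - i)%N f
     * pcoef (nat_of_ord j, n - j)%N (L (e i (n - i))).
Proof.
pose rhs := fun f => \sum_(i < n.+1) pcoef (nat_of_ord i, n - i)%N f
     * pcoef (nat_of_ord j, n - j)%N (L (e i (n - i))).
have rhsl : scalar rhs.
  move=> c f1 f2; rewrite /rhs mulr_sumr -big_split /=; apply: eq_bigr => i _.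
  by rewrite pcoefD pcoefZ mulrDl mulrA.
pose rhsL : {scalar P} := HB.pack rhs (GRing.isLinear.Build C P C *%R rhs rhsl).
apply: (plane_ext_scalar (pcoef (nat_of_ord j, n - j)%N \o L) rhsL) => a b /=.
rewrite /rhs; have [abn|abn] := eqVneq (a + b)%N n.
  have an : (a < n.+1)%N by rewrite ltnS -abn leq_addr.
  rewrite (bigD1 (Ordinal an)) //= pcoefe big1 ?addr0 => [|i /eqP ia].
    have -> : (n - a = b)%N by lia.
    by rewrite eqxx mul1r.
  rewrite pcoefe; case: eqP => [[ai _]|]; last by rewrite mul0r.
  by case: ia; apply: val_inj.
rewrite big1 => [|i _].
  have /pdegP H := L_deg a b; apply/eqP; apply: contraT => /H.
  by have := ltn_ord j; move/eqP: abn; lia.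
rewrite pcoefe; case: eqP => [[ia ib]|]; last by rewrite mul0r.
by have := ltn_ord i; move/eqP: abn; lia.
Qed.

(** Each component is finite-dimensional, so a one-sided inverse of the matrix of [L] on it is
    two-sided. *)
Lemma graded_surj_inj : (forall g, exists f, L f = g) ->
  forall f, L f = 0 -> f = 0.
Proof.
move=> L_surj f Lf0; apply: pcoefP => a b; set n := (a + b)%N.
pose T : 'M[C]_n.+1 := \matrix_(i, j)
  pcoef (nat_of_ord j, n - j)%N (L (e i (n - i))).
(* The preimages may be inhomogeneous; only their coefficients in degree [n] enter the matrix
   [S]. *)
have /choice[F FE] : forall k : 'I_n.+1, exists f, L f = e k (n - k).
  by move=> k; exact: L_surj.
pose S : 'M[C]_n.+1 := \matrix_(k, i) pcoef (nat_of_ord i, n - i)%N (F k).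
have ST : S *m T = 1%:M.
  apply/matrixP => k j; rewrite !mxE; under eq_bigr do rewrite !mxE.
  rewrite -graded_coef FE pcoefe xpair_eqE eq_sym -(inj_eq val_inj) /=.
  by case: eqP => [->|]; rewrite ?eqxx.
pose v : 'rV[C]_n.+1 := \row_i pcoef (nat_of_ord i, n - i)%N f.
have vT : v *m T = 0.
  apply/matrixP => k j; rewrite !mxE; under eq_bigr do rewrite !mxE.
  by rewrite -graded_coef Lf0 pcoef0.
have v0 : v = 0 by rewrite -[v]mulmx1 -(mulmx1C ST) mulmxA vT mul0mx.
have an : (a < n.+1)%N by rewrite ltnS leq_addr.
have := congr1 (fun u : 'rV_n.+1 => u ord0 (Ordinal an)) v0.
by rewrite !mxE /= addKn pcoef0.
Qed.

End GradedEndomorphism.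
End PlaneGrading.

(** * Quadratic algebras and the plane *)

Lemma ord2_cases (i : 'I_2) : i = ord0 \/ i = ord_max.
Proof. by case: i => -[|[|//]] ?; [left|right]; exact: val_inj. Qed.

Section FreeWords.
Variable C : fieldType.
Local Notation F := (free_algebra C).

Definition fword (w : word) : F := FreeAlgebra << w >>.

Lemma fword_nil : fword [::] = 1. Proof. by []. Qed.

Lemma fword_rcons w i : fword (rcons w i) = fword w * fvar C i.
Proof.
apply: val_inj; rewrite /= fa_valM malgME !msuppU oner_eq0 !big_seq_fset1.
by rewrite !mcoeffUU mulr1 -cats1.
Qed.

Lemma fa_expand (f : F) :
  f = \sum_(w <- msupp (fa_val f)) (fa_val f)@_w *: fword w.
Proof.
apply: val_inj; rewrite /= {1}(malg_expand (fa_val f)).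
rewrite (big_morph _ (@fa_valD C) (fa_val0 C)).
by apply: eq_bigr => w _; rewrite fa_valZ.
Qed.

Lemma fhomog_word w : fhomog (size w) (fword w).
Proof. by move=> v /=; rewrite mcoeffU; have [->|_] := eqVneq w v; rewrite ?eqxx. Qed.

Lemma fhomogZ n (c : C) (f : F) : fhomog n f -> fhomog n (c *: f).
Proof.
move=> hf w; rewrite fa_valZ mcoeffZ => H; apply: hf.
by apply: contraNneq H => ->; rewrite mulr0.
Qed.

Lemma fhomog0 n : fhomog n (0 : F).
Proof. by move=> w; rewrite fa_val0 mcoeff0 eqxx. Qed.

Lemma fhomogM n m (f g : F) : fhomog n f -> fhomog m g -> fhomog (n + m) (f * g).
Proof.
move=> fn gm w; rewrite fa_valM malgME raddf_sum.
move=> H; apply/eqP; apply: contraNT H => H; apply/eqP; apply: big1 => u _.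
rewrite raddf_sum big1 // => v _ /=; rewrite mcoeffU.
have [wE|_] := eqVneq (u ++ v : word) w; last by rewrite mulr0n.
apply/eqP; rewrite mulr1n; apply: contraNT H.
by rewrite mulf_eq0 negb_or -wE => /andP[/fn <- /gm <-]; rewrite size_cat.
Qed.

End FreeWords.

(** * The grading of a quadratic algebra *)

Section QuadraticGrading.
Variables (C : fieldType) (r : quadric C).
Local Notation A := (quad_algebra r).

Lemma quad_ind (Q : A -> Prop) :
  (forall c f g, Q f -> Q g -> Q (c *: f + g)) -> Q 1 ->
  (forall f, Q f -> Q (f * qX r) /\ Q (f * qY r)) -> forall f, Q f.
Proof.
move=> Qlin Q1 Qmul f; rewrite -(qreprK f) (fa_expand (qrepr f)).
have Q0 : Q 0 by have := Qlin (-1) 1 1 Q1 Q1; rewrite scaleN1r addNr.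
rewrite raddf_sum; elim/big_rec: _ => // w g _ Qg.
rewrite /= qpiZ; apply: Qlin => //.
elim/last_ind: w => [|w i]; first by rewrite fword_nil.
rewrite fword_rcons qpiM => /Qmul [QX QY].
have [->|->] := ord2_cases i.
  by [].
by [].
Qed.

Lemma qgradeD n (f g : A) : qgrade r n f -> qgrade r n g -> qgrade r n (f + g).
Proof.
by move=> [f' hf <-] [g' hg <-]; exists (f' + g'); rewrite ?raddfD //; exact: fhomogD.
Qed.

Lemma qgradeZ n c (f : A) : qgrade r n f -> qgrade r n (c *: f).
Proof.
by move=> [f' hf <-]; exists (c *: f'); [exact: fhomogZ|exact: qpiZ].
Qed.

Lemma qgradeN n (f : A) : qgrade r n f -> qgrade r n (- f).
Proof. by rewrite -scaleN1r; exact: qgradeZ. Qed.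

Lemma qgrade0 n : qgrade r n 0.
Proof. by exists 0; [exact: fhomog0|rewrite raddf0]. Qed.

Lemma qgradeM n m (f g : A) :
  qgrade r n f -> qgrade r m g -> qgrade r (n + m) (f * g).
Proof.
by move=> [f' hf <-] [g' hg <-]; exists (f' * g'); [exact: fhomogM|exact: qpiM].
Qed.

Lemma qgrade1 : qgrade r 0 1.
Proof. by exists 1 => //; rewrite -fword_nil; exact: (@fhomog_word _ [::]). Qed.

Lemma qgradeX : qgrade r 1 (qX r).
Proof. by exists (fvar C ord0) => //; exact: (@fhomog_word _ [:: ord0]). Qed.

Lemma qgradeY : qgrade r 1 (qY r).
Proof. by exists (fvar C ord_max) => //; exact: (@fhomog_word _ [:: ord_max]). Qed.

Lemma qgrade1E (f : A) : qgrade r 1 f -> exists x y, f = x *: qX r + y *: qY r.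
Proof.
move=> [g g1 <-]; rewrite (fa_expand g) raddf_sum big_seq.
elim/big_rec: _ => [|w h]; first by exists 0, 0; rewrite !scale0r addr0.
rewrite -mcoeff_neq0 => /g1 /=; case: w => [|i []] //= _ [x [y ->]].
rewrite qpiZ.
have [->|->] := ord2_cases i.
  by exists ((fa_val g)@_[:: ord0] + x), y; rewrite addrA scalerDl.
exists x, ((fa_val g)@_[:: ord_max] + y).
by rewrite addrCA scalerDl.
Qed.

End QuadraticGrading.

(** * Evaluation of words with the twisted product *)

Section Evaluation.
Variables (C : numClosedFieldType) (s : bool).
Local Notation P := (plane C).
Local Notation e := (pe C).
Local Notation F := (free_algebra C).

(** The images [(u + v) / 2] and [(u - v) / 2] of [X] and [Y] *)
Definition pgen (i : 'I_2) : P := 2^-1 *: (e 1 0 + (-1) ^+ i *: e 0 1).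

Lemma pgen_deg i : pdeg 1 (pgen i).
Proof.
apply: pdegZ; apply: pdegD; first exact: (@pdege C 1 0).
by apply: pdegZ; exact: (@pdege C 0 1).
Qed.

Lemma pgen_hom (i : 'I_2) : phom s (true, i == ord_max) (pgen i).
Proof.
have [->|->] := ord2_cases i; rewrite /phom /pgen pcZ pbZ !linearD !linearZ /=;
  rewrite !pce !pbe !muln0;
  by split; apply: pcoefP => k l; rewrite !pcoefE; ring.
Qed.

Definition wev (w : word) : P := foldr (fun i => dot s (pgen i)) (e 0 0) w.

Lemma wev_cat v w : wev (v ++ w) = dot s (wev v) (wev w).
Proof.
by elim: v => [|i v IH] /=; rewrite ?dot1l // -/(wev _) IH dotA.
Qed.

Lemma wev_deg w : pdeg (size w) (wev w).
Proof.
elim: w => [|i w IH] /=; first exact: (@pdege C 0 0).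
by apply: (@pdeg_dot C s 1 (size w)) => //; exact: pgen_deg.
Qed.

Definition fev (f : F) : P := lext wev (fa_val f).

Lemma fev_linear : linear fev.
Proof. by move=> c f g; rewrite /fev fa_valD fa_valZ linearP. Qed.
HB.instance Definition _ := GRing.isLinear.Build C F P *:%R fev fev_linear.

Lemma fev_word w : fev (fword C w) = wev w.
Proof. by rewrite /fev lextU. Qed.

Lemma fevM f g : fev (f * g) = dot s (fev f) (fev g).
Proof.
have lextZU (c : C) (w : word) : lext wev << c *g w >> = c *: wev w.
  rewrite -(lextU wev w) -linearZ /=; congr lext.
  by apply/malgP => v; rewrite mcoeffZ !mcoeffU mulr_natr.
rewrite /fev fa_valM malgME linear_sum /=.
rewrite [in RHS]lext.unlock dot_suml; apply: eq_bigr => v _.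
rewrite linear_sum dot_sumr /=.
apply: eq_bigr => w _; rewrite lextZU dotZl dotZr scalerA.
by rewrite -wev_cat.
Qed.

Lemma fev1 : fev 1 = e 0 0.
Proof. by rewrite -fword_nil fev_word. Qed.

Lemma fev_var i : fev (fvar C i) = pgen i.
Proof. by rewrite -[fvar C i]/(fword C [:: i]) fev_word /= dot1r. Qed.

End Evaluation.

Lemma qpi_rel (C : fieldType) (r : quadric C) : qpi r r = 0.
Proof.
apply/eqP; rewrite -[0](raddf0 (qpi r)) qpi_eq subr0; apply/asboolP.
by exists 1%N, (fun=> 1), (fun=> 1); rewrite big_ord1 mul1r mulr1.
Qed.

(** * The isomorphism between the quadratic algebra and the twisted plane *)

Section Isomorphism.
Variables (C : numClosedFieldType) (s : bool).
Local Notation P := (plane C).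
Local Notation e := (pe C).
Local Notation F := (free_algebra C).

Definition prel : quadric C := if s then square_rel C else skew_rel C.
Local Notation A := (quad_algebra prel).
Local Notation X := (qX prel).
Local Notation Y := (qY prel).

(** For [s] false, XY and YX pick up the factors ['i] and [-'i], so commuting factors become
    anticommuting. For [s] true, squares are untwisted and X^2, Y^2 both become (u^2 + v^2)/4, since
    uv + vu = 0. *)
Lemma fev_rel : fev s prel = 0.
Proof.
have homX := @pgen_hom C s ord0; have homY := @pgen_hom C s ord_max.
rewrite /prel; move: homX homY; case: (s) => homX homY;
  rewrite /= linearD ?linearN /= !fevM !fev_var.
  rewrite (dot_hom homX homX) (dot_hom homY homY) /gcoef /= !scale1r /pgen.
  rewrite !(pmulZl, pmulZr, pmulDl, pmulDr, pmulee) !(addn0, add0n).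
  by apply: pcoefP => k l; rewrite !pcoefE /=; ring.
rewrite (dot_hom homX homY) (dot_hom homY homX) /gcoef /= /pgen.
rewrite !(pmulZl, pmulZr, pmulDl, pmulDr, pmulee) !(addn0, add0n).
by apply: pcoefP => k l; rewrite !pcoefE /=; ring.
Qed.

Fact phi_key : unit. Proof. exact: tt. Qed.
Definition phi (f : A) : P := locked_with phi_key (fev s (qrepr f)).

Lemma phi_qpi f : phi (qpi prel f) = fev s f.
Proof.
rewrite /phi unlock; apply/eqP; rewrite -subr_eq0 -linearB /=.
have : qrepr (qpi prel f) - f \in rel_ideal prel by rewrite -qpi_eq qreprK.
move=> /asboolP[n [u [v ->]]].
rewrite linear_sum big1 //= => i _.
by rewrite !fevM fev_rel (linear0 (dot s _)) -/(dotr s _ _) linear0.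
Qed.

Lemma phi_linear : linear phi.
Proof.
move=> c f g; rewrite -(qreprK f) -(qreprK g) -qpiZ -raddfD !phi_qpi.
by rewrite linearP.
Qed.
HB.instance Definition _ := GRing.isLinear.Build C A P *:%R phi phi_linear.

Lemma phiM f g : phi (f * g) = dot s (phi f) (phi g).
Proof. by rewrite -(qreprK f) -(qreprK g) -qpiM !phi_qpi fevM. Qed.

Lemma phi1 : phi 1 = e 0 0.
Proof. by rewrite -[1]/(qpi prel 1) phi_qpi fev1. Qed.

Lemma phiX : phi X = pgen C ord0.
Proof. by rewrite phi_qpi fev_var. Qed.

Lemma phiY : phi Y = pgen C ord_max.
Proof. by rewrite phi_qpi fev_var. Qed.

Lemma phi_deg n f : qgrade prel n f -> pdeg n (phi f).
Proof.
move=> [g gn <-]; rewrite phi_qpi (fa_expand g) linear_sum big_seq.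
apply: pdeg_sum => w; rewrite -mcoeff_neq0 => /gn <-.
by rewrite linearZ /= fev_word; apply: pdegZ; exact: wev_deg.
Qed.

Lemma gcoef_neq0 i j : gcoef C i j != 0.
Proof.
have i0 : 'i != 0 :> C by exact: neq0Ci.
by case: i j => -[] [] [[] []]; rewrite /gcoef /= ?oppr_eq0 ?oner_eq0.
Qed.

(** On eigenvectors the twist is division by a nonzero scalar. So the untwisted product lies in the
    image of [phi] as soon as the components of the left factor do. *)
Lemma phi_pmul_gen f (x : A) i : phom s i (phi x) ->
  (forall i, exists g, phi g = pproj s i (phi f)) ->
  exists g, phi g = pmul s (phi f) (phi x).
Proof.
move=> xi /choice[g gE]; exists (\sum_j (gcoef C j i)^-1 *: (g j * x)).
rewrite linear_sum /= -{1}[phi f](pproj_sum s) pmul_suml; apply: eq_bigr => j _.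
rewrite linearZ /= phiM gE (dot_hom (pproj_hom s j _) xi) scalerA.
by rewrite mulVf ?scale1r ?gcoef_neq0.
Qed.

(** The generators are eigenvectors, so right multiplication by one of them only permutes the
    components. *)
Lemma phi_proj f i : exists g, phi g = pproj s i (phi f).
Proof.
move: f i; apply: quad_ind.
- move=> c f g Hf Hg i; have [f' f'E] := Hf i; have [g' g'E] := Hg i.
  by exists (c *: f' + g'); rewrite !linearP /= f'E g'E.
- move=> i; rewrite phi1 (phom_proj _ (phom1 _ _)).
  by exists (((false, false) == i)%:R *: 1); rewrite linearZ /= phi1.
move=> f Hf.
suff H (x : A) i : phom s i (phi x) ->
    forall j, exists g, phi g = pproj s j (phi (f * x)).
  split; [apply: (H _ (true, false))|apply: (H _ (true, true))].
    by rewrite phiX; exact: pgen_hom.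
  by rewrite phiY; exact: pgen_hom.
move=> xi j; have /choice[g gE] := Hf.
exists (\sum_k ((gadd k i == j)%:R *: (g k * x))).
rewrite phiM linear_sum /= -{1}[phi f](pproj_sum s) dot_suml linear_sum /=.
apply: eq_bigr => k _; rewrite linearZ /= phiM gE.
rewrite (dot_hom (pproj_hom s k _) xi) [pproj s j _]linearZ /=.
by rewrite (phom_proj j (phomM (pproj_hom s k _) xi)) !scalerA mulrC.
Qed.

(** The image contains 1 and is stable under untwisted right multiplication by u and v. Adding all u
    before all v avoids signs. *)
Lemma phi_surj g : exists f, phi f = g.
Proof.
have phiu : phi (X + Y) = e 1 0.
  rewrite linearD /= phiX phiY; apply: pcoefP => k l; rewrite !pcoefE /=.
  by field.
have phiv : phi (X - Y) = e 0 1.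
  rewrite linearB /= phiX phiY; apply: pcoefP => k l; rewrite !pcoefE /=.
  by field.
have stepX f : exists g, phi g = pmul s (phi f) (phi X).
  by apply: phi_pmul_gen (phi_proj f); rewrite phiX; exact: pgen_hom.
have stepY f : exists g, phi g = pmul s (phi f) (phi Y).
  by apply: phi_pmul_gen (phi_proj f); rewrite phiY; exact: pgen_hom.
have stepu f : exists g, phi g = pmul s (phi f) (e 1 0).
  have [[x xE] [y yE]] := (stepX f, stepY f).
  by exists (x + y); rewrite -phiu !linearD /= xE yE.
have stepv f : exists g, phi g = pmul s (phi f) (e 0 1).
  have [[x xE] [y yE]] := (stepX f, stepY f).
  by exists (x - y); rewrite -phiv !linearB /= xE yE.
have basis n m : exists f, phi f = e n m.
  elim: m => [|m [f fE]]; last first.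
    have [g' g'E] := stepv f; exists g'.
    by rewrite g'E fE pmulee muln0 muln0 scale1r addn0 addn1.
  elim: n => [|n [f fE]]; first by exists 1; rewrite phi1.
  have [g' g'E] := stepu f; exists g'.
  by rewrite g'E fE pmulee mul0n muln0 scale1r addn0 addn1.
rewrite (pexpand g); elim/big_rec: _ => [|k h _ [f fE]].
  by exists 0; rewrite linear0.
have [f' f'E] := basis k.1 k.2.
by exists (pcoef k g *: f' + f); rewrite linearP /= fE f'E.
Qed.

Local Notation x1 := (if s then X + Y else X).
Local Notation x2 := (if s then X - Y else Y).

(** Both algebras are skew polynomial rings in suitable generators: if X^2 = Y^2, then (X + Y)(X -
    Y) = YX - XY and (X - Y)(X + Y) = XY - YX. *)
Lemma skew_commute : x2 * x1 = - (x1 * x2).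
Proof.
rewrite /prel; case: s.
  have /eqP := qpi_rel (square_rel C).
  rewrite /= raddfB /= !qpiM -/(qX _) -/(qY _) subr_eq0 => /eqP XX.
  move: (qX _) (qY _) XX => x y xx.
  rewrite mulrBl mulrDl !mulrDr !mulrN xx.
  by rewrite [_ + y * y]addrC opprD addrA [y * y + _]addrC addrK
             [in RHS]addrC addrA subrK opprB.
have /eqP := qpi_rel (skew_rel C).
by rewrite /= raddfD /= !qpiM -/(qX _) -/(qY _) addrC addr_eq0 => /eqP.
Qed.

Lemma qXE : exists c d, X = c *: x1 + d *: x2.
Proof.
rewrite /prel; case: s; last by exists 1, 0; rewrite scale1r scale0r addr0.
exists 2^-1, 2^-1; rewrite -scalerDr addrACA addrN addr0 -mulr2n.
by rewrite -scaler_nat scalerA mulVf ?scale1r // pnatr_eq0.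
Qed.

Lemma qYE : exists c d, Y = c *: x1 + d *: x2.
Proof.
rewrite /prel; case: s; last by exists 0, 1; rewrite scale1r scale0r add0r.
exists 2^-1, (- 2^-1); rewrite scaleNr -scalerBr opprB addrC addrA subrK -mulr2n.
by rewrite -scaler_nat scalerA mulVf ?scale1r // pnatr_eq0.
Qed.

Lemma qgrade_x12 : qgrade prel 1 x1 /\ qgrade prel 1 x2.
Proof.
have hX := qgradeX prel; have hY := qgradeY prel.
by case: ifP => _; split=> //; apply: qgradeD => //; exact: qgradeN.
Qed.

Fact theta_key : unit. Proof. exact: tt. Qed.
(** A linear map only, in general not the inverse of [phi]. It records that ordered monomials in
    [x1], [x2] span the algebra. *)
Definition theta (f : P) : A :=
  locked_with theta_key (pext (fun i j => x1 ^+ i * x2 ^+ j) f).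

Fact thetaE f : theta f = pext (fun i j => x1 ^+ i * x2 ^+ j) f.
Proof. by rewrite /theta locked_withE. Qed.

Fact theta_linear : linear theta.
Proof. by move=> c f g; rewrite !thetaE; exact: pext_linear. Qed.
HB.instance Definition _ := GRing.isLinear.Build C P A *:%R theta theta_linear.

Lemma thetaZ c f : theta (c *: f) = c *: theta f. Proof. exact: linearZZ. Qed.

Lemma thetae i j : theta (e i j) = x1 ^+ i * x2 ^+ j.
Proof. by rewrite thetaE pexte. Qed.

Lemma theta_surj f : exists g, theta g = f.
Proof.
move: f; apply: quad_ind => [c f g [f' <-] [g' <-]||f [f' <-]].
- by exists (c *: f' + g'); rewrite linearP.
- by exists (e 0 0); rewrite thetae !expr0 mulr1.
have mulx2 : exists g, theta g = theta f' * x2.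
  exists (\sum_(k <- psupp f') pcoef k f' *: e k.1 k.2.+1).
  rewrite {3}(pexpand f') !linear_sum mulr_suml /=; apply: eq_bigr => k _.
  by rewrite !thetaZ !thetae -scalerAl -mulrA -exprSr.
have mulx1 : exists g, theta g = theta f' * x1.
  (* Moving [x1] to the left past [k.2] factors [x2] costs the sign. *)
  exists (\sum_(k <- psupp f') pcoef k f' *: ((-1) ^+ k.2 *: e k.1.+1 k.2)).
  rewrite {3}(pexpand f') !linear_sum mulr_suml /=; apply: eq_bigr => k _.
  rewrite !thetaZ !thetae -scalerAl; congr (_ *: _).
  rewrite exprSr -!mulrA scalerAr; congr (_ * _).
  elim: k.2 => [|m IH]; first by rewrite !expr0 mulr1 mul1r scale1r.
  rewrite !exprS -[RHS]mulrA -IH -scalerAr !mulrA skew_commute.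
  by rewrite mulN1r scaleNr mulNr scalerN.
have [[g1 g1E] [g2 g2E]] := (mulx1, mulx2).
have comb u : (exists c d, u = c *: x1 + d *: x2) -> exists g, theta g = theta f' * u.
  move=> [c [d ->]]; exists (c *: g1 + d *: g2).
  by rewrite linearP /= linearZ /= g1E g2E mulrDr -!scalerAr.
by split; apply: comb; [exact: qXE|exact: qYE].
Qed.

Lemma theta_deg n f : pdeg n f -> qgrade prel n (theta f).
Proof.
have [h1 h2] := qgrade_x12.
have hpow x : qgrade prel 1 x -> forall i, qgrade prel i (x ^+ i).
  move=> hx; elim=> [|i IH]; first exact: qgrade1.
  by rewrite exprS; exact: (@qgradeM _ _ 1 i).
move=> /pdegP fn; rewrite (pexpand f) linear_sum big_seq.
elim/big_rec: _ => [|k g]; first exact: qgrade0.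
rewrite pcoef_supp => kf gn.
have kn : (k.1 + k.2)%N = n by apply: fn; case: (k) kf.
apply: qgradeD gn; rewrite -kn /= thetaZ thetae; apply: qgradeZ.
by apply: qgradeM; exact: hpow.
Qed.

Lemma phi_theta_deg i j : pdeg (i + j) (phi (theta (e i j))).
Proof. by apply: phi_deg; apply: theta_deg; exact: pdege. Qed.

Lemma phi_theta_inj f : phi (theta f) = 0 -> f = 0.
Proof.
apply: (graded_surj_inj (L := phi \o theta) phi_theta_deg) => g.
have [f' <-] := phi_surj g; have [f'' <-] := theta_surj f'.
by exists f''.
Qed.

Lemma phi_inj : injective phi.
Proof.
move=> f g fg; apply/eqP; rewrite -subr_eq0.
have [h hE] := theta_surj (f - g).
have /phi_theta_inj h0 : phi (theta h) = 0 by rewrite hE linearB /= fg subrr.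
by rewrite -hE h0 linear0.
Qed.

(** For the converse, write the element as [theta g]. The composite of [theta] and [phi] commutes
    with taking components and is injective, so [g] is homogeneous too. *)
Lemma phi_degE n f : qgrade prel n f <-> pdeg n (phi f).
Proof.
split; first exact: phi_deg.
have [g <-] := theta_surj f => gn; apply: theta_deg.
apply/eqP; rewrite -subr_eq0; apply/eqP; apply: phi_theta_inj.
have := pcomp_graded (L := phi \o theta) phi_theta_deg n g.
by rewrite /= gn !linearB /= => <-; rewrite subrr.
Qed.

Definition phi_inv (g : P) : A := projT1 (cid (phi_surj g)).
Lemma phi_invK : cancel phi_inv phi.
Proof. by move=> g; rewrite /phi_inv; case: cid. Qed.
Lemma phiK : cancel phi phi_inv.
Proof. by move=> f; apply: phi_inj; rewrite phi_invK. Qed.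

End Isomorphism.

(** * The action of the cotwisted group algebra *)

Section SemidihedralAction.
Variables (gT : finGroupType) (a b : gT).
Hypotheses (gen_ab : <<[set a; b]>>%g = [set: gT]%SET) (a8 : (a ^+ 8 = 1)%g)
  (b2 : (b ^+ 2 = 1)%g) (ba : (b * a = a ^+ 3 * b)%g) (card_gT : #|gT| = 16%N).

Lemma gen_ind (Q : gT -> Prop) :
  Q 1%g -> (forall x, Q x -> Q (a * x)%g /\ Q (b * x)%g) -> forall x, Q x.
Proof.
move=> Q1 Qab x.
have : x \in <<[set a; b]>>%g by rewrite gen_ab inE.
case/gen_prodgP => n [c cab ->]; elim: n c cab => [|n IH] c cab.
  by rewrite big_ord0.
rewrite big_ord_recl.
have /Qab[Qa Qb] := IH (fun i => c (lift ord0 i)) (fun i => cab _).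
by have := cab ord0; rewrite !inE => /orP[] /eqP ->.
Qed.

Lemma b_expa i : (b * a ^+ i = a ^+ (3 * i) * b)%g.
Proof.
elim: i => [|i IH]; first by rewrite muln0 !expg0 mulg1 mul1g.
by rewrite expgSr mulgA IH -mulgA ba mulgA -expgD mulnS addnC.
Qed.

Definition sd (p : 'I_8 * bool) : gT := (a ^+ p.1 * b ^+ p.2)%g.

Lemma expa_mod i : (a ^+ i = a ^+ (i %% 8))%g.
Proof. by rewrite {1}(divn_eq i 8) expgD mulnC expgM a8 expg1n mul1g. Qed.

Definition ordmod i : 'I_8 := Ordinal (ltn_pmod i (isT : 0 < 8)%N).

Lemma sd_mod i (j : bool) : (a ^+ i * b ^+ j)%g = sd (ordmod i, j).
Proof. by rewrite /sd /= -expa_mod. Qed.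

Lemma sd_mula p : (a * sd p)%g = sd (ordmod p.1.+1, p.2).
Proof. by rewrite -sd_mod expgS mulgA. Qed.

Lemma sd_mulb p : (b * sd p)%g = sd (ordmod (3 * p.1), ~~ p.2).
Proof.
rewrite -sd_mod /sd mulgA b_expa -mulgA; congr (_ * _)%g.
by case: p.2; rewrite ?mulg1 // -b2.
Qed.

Lemma sd_surj x : exists p, sd p = x.
Proof.
apply: (@gen_ind (fun x => exists p, sd p = x)) => [|y [p <-]].
  by exists (ord0, false); rewrite /sd !expg0 mulg1.
by split; [exists (ordmod p.1.+1, p.2)|exists (ordmod (3 * p.1), ~~ p.2)];
  rewrite ?sd_mula ?sd_mulb.
Qed.

(** Sixteen normal forms a^i b^j cover a group of order sixteen. *)
Lemma sd_inj : injective sd.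
Proof.
have H : #|codom sd| = #|{: 'I_8 * bool}|.
  rewrite card_prod card_ord card_bool -[(8 * 2)%N]card_gT.
  by apply: eq_card => x; rewrite inE; have [p <-] := sd_surj x; exact: codom_f.
by move/eqP/image_injP: H => H p q pq; exact: H.
Qed.

Lemma big_sd (R : zmodType) (F : gT -> R) :
  \sum_x F x = \sum_(i < 8) F (sd (i, false)) + \sum_(i < 8) F (sd (i, true)).
Proof.
rewrite (reindex sd) /=; last first.
  apply: onW_bij; apply: inj_card_bij sd_inj _.
  by rewrite card_prod card_ord card_bool card_gT.
rewrite -(pair_bigA _ (fun i j => F (sd (i, j)))) /= -big_split /=.
by apply: eq_bigr => i _; rewrite big_bool /= addrC.
Qed.

Section Representation.
Variables (V : Type) (fa fb : V -> V).
Hypotheses (fa8 : forall v, iter 8 fa v = v) (fb2 : involutive fb)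
  (fba : forall v, fb (fa v) = iter 3 fa (fb v)).

(** The action extending [fa] and [fb], read off the normal form; uniqueness of that form makes it
    computable, and the relations make it multiplicative. *)
Definition grep (x : gT) (v : V) : V :=
  let p := projT1 (cid (sd_surj x)) in iter p.1 fa (if p.2 then fb v else v).

Lemma grep_sd p v : grep (sd p) v = iter p.1 fa (if p.2 then fb v else v).
Proof. by rewrite /grep; case: cid => q /= /sd_inj ->. Qed.

Lemma iter_fa_mod i v : iter (ordmod i) fa v = iter i fa v.
Proof.
rewrite /= [in RHS](divn_eq i 8) addnC iterD; congr (iter _ _ _).
elim: (i %/ 8)%N => // n IH.
by rewrite mulSn iterD -IH fa8.
Qed.

Lemma fb_iter i v : fb (iter i fa v) = iter (3 * i) fa (fb v).
Proof. by elim: i => // i IH; rewrite iterS fba IH mulnS iterD. Qed.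

Lemma grep_mula x v : grep (a * x)%g v = fa (grep x v).
Proof.
have [p <-] := sd_surj x.
by rewrite sd_mula !grep_sd; rewrite [LHS]iter_fa_mod.
Qed.

Lemma grep_mulb x v : grep (b * x)%g v = fb (grep x v).
Proof.
have [p <-] := sd_surj x; rewrite sd_mulb !grep_sd fb_iter.
rewrite [LHS]iter_fa_mod; congr (iter _ _ _).
by case: p.2 => //=; rewrite fb2.
Qed.

Lemma grep1 v : grep 1%g v = v.
Proof.
have <- : sd (ord0, false) = 1%g by rewrite /sd !expg0 mulg1.
by rewrite grep_sd.
Qed.

Lemma grepa v : grep a v = fa v.
Proof. by rewrite -[a in LHS]mulg1 grep_mula grep1. Qed.

Lemma grepb v : grep b v = fb v.
Proof. by rewrite -[b in LHS]mulg1 grep_mulb grep1. Qed.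

Lemma grepM x y v : grep (x * y)%g v = grep x (grep y v).
Proof.
move: x; apply: gen_ind => [|x IH]; first by rewrite mul1g grep1.
by split; rewrite -mulgA ?grep_mula ?grep_mulb IH.
Qed.

End Representation.
End SemidihedralAction.

(** * Group algebras and their tensor squares *)

Section GroupAlgebra.
Variables (K : fieldType) (gT : finGroupType).
Local Notation H := (group_algebra K gT).
Local Notation HH := (group_algebra K (gT * gT)%type).

Lemma gelt_mul (hT : finGroupType) (x y : hT) :
  gelt K x * gelt K y = gelt K (x * y)%g.
Proof.
apply/ffunP => t; rewrite group_algebra_mulE (bigD1 x) //= big1 ?addr0.
  by rewrite !ffunE eqxx mul1r -(inj_eq (mulgI x)) mulKVg.
by move=> y' /negPf xy; rewrite !ffunE xy mul0r.
Qed.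

Lemma group_algebraZ (hT : finGroupType) c (u : group_algebra K hT) x :
  (c *: u) x = c * u x.
Proof. by rewrite ffunE. Qed.

Lemma group_algebraD (hT : finGroupType) (u v : group_algebra K hT) x :
  (u + v) x = u x + v x.
Proof. by rewrite ffunE. Qed.

Lemma gelt1 (hT : finGroupType) : gelt K (1%g : hT) = 1.
Proof. by apply/ffunP => t; rewrite !ffunE. Qed.

Lemma tensorM (u v u' v' : H) :
  tensor u v * tensor u' v' = tensor (u * u') (v * v').
Proof.
apply/ffunP => -[x y]; rewrite group_algebra_mulE [RHS]ffunE /=.
rewrite !group_algebra_mulE big_distrl /=.
under [RHS]eq_bigr => x' _ do rewrite big_distrr /=.
rewrite pair_big /=; apply: eq_bigr => -[x' y'] _; rewrite !ffunE /=.
by rewrite mulrACA.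
Qed.

Lemma tensor0l v : tensor (0 : H) v = 0.
Proof. by apply/ffunP => p; rewrite !ffunE mul0r. Qed.

Lemma tensor0r u : tensor (u : H) 0 = 0.
Proof. by apply/ffunP => p; rewrite !ffunE mulr0. Qed.

Lemma tensor_suml I (r : seq I) F v :
  tensor (\sum_(i <- r) F i : H) v = \sum_(i <- r) tensor (F i) v.
Proof.
apply/ffunP => p; rewrite ffunE !sum_ffunE mulr_suml.
by apply: eq_bigr => i _; rewrite ffunE.
Qed.

Lemma tensor_sumr I (r : seq I) F u :
  tensor (u : H) (\sum_(i <- r) F i) = \sum_(i <- r) tensor u (F i).
Proof.
apply/ffunP => p; rewrite ffunE !sum_ffunE mulr_sumr.
by apply: eq_bigr => i _; rewrite ffunE.
Qed.

Lemma tensor1 : tensor (1 : H) 1 = 1.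
Proof.
apply/ffunP => -[x y]; rewrite !ffunE /= xpair_eqE.
by case: eqP => _; case: eqP => _; rewrite ?mulr1 ?mulr0 ?mul0r.
Qed.

End GroupAlgebra.

(** * The twist J in terms of orthogonal idempotents *)

Section KashinaTwist.
Variables (C : numClosedFieldType) (gT : finGroupType) (a b : gT).
Hypotheses (c2 : (a ^+ 4 * a ^+ 4 = 1)%g) (b2 : (b * b = 1)%g)
  (bc : (b * a ^+ 4 = a ^+ 4 * b)%g).
Local Notation H := (group_algebra C gT).
Local Notation G := (bool * bool)%type.

Definition kdelta (i : G) : H := (kashina_delta C a b)`_(i.1 * 2 + i.2).

(** These are the primitive idempotents of the group algebra of {1, c, b, cb}, here indexed by their
    characters. *)
Lemma kdeltaE i : kdelta i = 4^-1 *: (1 + (-1) ^+ i.1 *: gelt C (a ^+ 4)%g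
  + (-1) ^+ i.2 *: gelt C b + (-1) ^+ (i.1 (+) i.2) *: gelt C (a ^+ 4 * b)%g).
Proof.
by case: i => -[] []; rewrite /kdelta /= ?expr0 ?expr1 ?scale1r ?scaleN1r.
Qed.

Lemma kdelta_sum : \sum_i kdelta i = 1.
Proof.
rewrite -(pair_bigA _ (fun i j => kdelta (i, j))) /= !big_bool /= !kdeltaE.
by apply/ffunP => x; rewrite !(group_algebraD, group_algebraZ); field.
Qed.

Lemma gelt_c_kdelta i : gelt C (a ^+ 4)%g * kdelta i = (-1) ^+ i.1 *: kdelta i.
Proof.
rewrite kdeltaE -scalerAr !mulrDr mulr1 -!scalerAr !gelt_mul c2 mulgA c2 mul1g.
rewrite gelt1; apply/ffunP => x; rewrite !(group_algebraD, group_algebraZ).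
by case: i => -[] [] /=; ring.
Qed.

Lemma gelt_b_kdelta i : gelt C b * kdelta i = (-1) ^+ i.2 *: kdelta i.
Proof.
rewrite kdeltaE -scalerAr !mulrDr mulr1 -!scalerAr !gelt_mul b2 bc.
rewrite [(b * (a ^+ 4 * b))%g]mulgA bc -[(_ * b * b)%g]mulgA b2 mulg1 gelt1.
apply/ffunP => x; rewrite !(group_algebraD, group_algebraZ).
by case: i => -[] [] /=; ring.
Qed.

Lemma kdeltaM i j : kdelta i * kdelta j = (i == j)%:R *: kdelta j.
Proof.
rewrite {1}kdeltaE -scalerAl !mulrDl mul1r -!scalerAl -(gelt_mul _ (a ^+ 4)%g b) -mulrA.
rewrite gelt_b_kdelta -scalerAr gelt_c_kdelta !scalerA -{1}[kdelta j]scale1r.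
rewrite -!scalerDl scalerA; congr (_ *: _).
by case: i j => -[] [] [[] []] /=; field.
Qed.

Lemma big_ord4 (V : zmodType) (F : nat -> V) :
  \sum_(i < 4) F i = \sum_(i : G) F (i.1 * 2 + i.2)%N.
Proof.
rewrite -(pair_bigA _ (fun x y : bool => F (x * 2 + y)%N)) /= !big_bool /=.
rewrite !big_ord_recr big_ord0 /= add0r.
by rewrite [RHS]addrC [F 1%N + _]addrC [F 3%N + _]addrC !addrA.
Qed.

Lemma kashina_JE :
  kashina_J C a b = \sum_i \sum_j gcoef C i j *: tensor (kdelta i) (kdelta j).
Proof.
rewrite /kashina_J.
rewrite (big_ord4 (fun i => \sum_(j < 4) (nth [::] (kashina_coef C) i)`_j
  *: tensor (kashina_delta C a b)`_i (kashina_delta C a b)`_j)).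
apply: eq_bigr => i _.
by rewrite (big_ord4 (fun j => (nth [::] (kashina_coef C) _)`_j
  *: tensor (kashina_delta C a b)`__ (kashina_delta C a b)`_j)).
Qed.

(** Combinations of tensors of orthogonal idempotents multiply coefficientwise, so inverting the
    coefficients inverts J. For a non-unit, [J^-1] in [cotwist] would stand for J itself. *)
Lemma kashina_J_unit : kashina_J C a b \is a GRing.unit.
Proof.
pose twist (g : G -> G -> C) := \sum_i \sum_j g i j *: tensor (kdelta i) (kdelta j).
have twistM g g' : (forall i j, g i j * g' i j = 1) -> twist g * twist g' = 1.
  move=> gg; rewrite /twist mulr_suml -tensor1 -kdelta_sum tensor_suml.
  apply: eq_bigr => i _; rewrite mulr_suml tensor_sumr; apply: eq_bigr => j _.
  rewrite mulr_sumr (bigD1 i) //= [X in _ + X = _]big1 ?addr0 => [|i' /negPf ii'].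
    rewrite mulr_sumr (bigD1 j) //= [X in _ + X = _]big1 ?addr0 => [|j' /negPf jj'].
      by rewrite -scalerAl -scalerAr tensorM !kdeltaM !eqxx !scale1r scalerA gg scale1r.
    rewrite -scalerAl -scalerAr tensorM !kdeltaM [j == _]eq_sym jj'.
    by rewrite scale0r tensor0r !scaler0.
  rewrite mulr_sumr big1 // => j' _.
  rewrite -scalerAl -scalerAr tensorM !kdeltaM [i == _]eq_sym ii'.
  by rewrite scale0r tensor0l !scaler0.
apply/unitrP; exists (twist (fun i j => (gcoef C i j)^-1)).
rewrite kashina_JE -/(twist (gcoef C)); split; apply: twistM => i j.
  by rewrite mulVf ?gcoef_neq0.
by rewrite mulfV ?gcoef_neq0.
Qed.

End KashinaTwist.

(** * The diagonal operator by which a acts on the plane *)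

Section RotationOperator.
Variables (C : numClosedFieldType) (s : bool) (zeta : C).
Hypothesis zeta4 : zeta ^+ 4 = -1.
Local Notation P := (plane C).
Local Notation e := (pe C).

Definition pa (f : P) : P := pext (fun n m => zeta ^+ (n + 3 * m) *: e n m) f.
HB.instance Definition _ := GRing.isLinear.Build C P P *:%R pa (pext_linear _).

Lemma pae n m : pa (e n m) = zeta ^+ (n + 3 * m) *: e n m.
Proof. by rewrite /pa pexte. Qed.

Lemma paZ c f : pa (c *: f) = c *: pa f. Proof. exact: linearZZ. Qed.

Lemma iter_pae i n m : iter i pa (e n m) = zeta ^+ (i * (n + 3 * m)) *: e n m.
Proof.
elim: i => [|i IH]; first by rewrite mul0n expr0 scale1r.
by rewrite iterS IH paZ pae scalerA -exprD mulSn addnC.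
Qed.

Lemma iter_pa_linear i : linear (iter i pa).
Proof.
elim: i => [|i IH] c f g; first by [].
by rewrite !iterS IH linearP.
Qed.
HB.instance Definition _ i :=
  GRing.isLinear.Build C P P *:%R (iter i pa) (iter_pa_linear i).

Lemma zeta8 : zeta ^+ 8 = 1.
Proof. by rewrite (exprM zeta 4 2) zeta4 sqrrN expr1n. Qed.

Lemma pa4 f : iter 4 pa f = pc f.
Proof.
apply: (plane_ext (iter 4 pa) (@pc C)) => n m.
rewrite [LHS](iter_pae 4) [RHS]pce exprM zeta4.
have -> : (n + 3 * m = n + m + 2 * m)%N by lia.
by rewrite [_ ^+ (_ + 2 * m)]exprD [_ ^+ (2 * m)]exprM sqrrN expr1n expr1n mulr1.
Qed.

Lemma pa8 f : iter 8 pa f = f.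
Proof. by rewrite (iterD 4 4) !pa4 pcK. Qed.

(** Since [zeta ^+ 9 = zeta], the cube of [pa] multiplies u by [zeta ^+ 3] and v by [zeta]: it is
    [pa] with u and v exchanged. *)
Lemma pba f : pb s (pa f) = iter 3 pa (pb s f).
Proof.
apply: (plane_ext (pb s \o pa) (iter 3 pa \o pb s)) => n m /=.
rewrite pae pbe pbZ pbe 3!paZ !pae !paZ pae !paZ pae !scalerA.
rewrite mulrC -!mulrA -!exprD; congr (_ * _ *: _).
have -> : (m + 3 * n + (m + 3 * n + (m + 3 * n)) = n + 3 * m + 8 * n)%N by lia.
by rewrite [RHS]exprD [zeta ^+ (8 * n)]exprM zeta8 expr1n mulr1.
Qed.

Lemma paM f g : pa (pmul s f g) = pmul s (pa f) (pa g).
Proof.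
apply: (plane_ext (pa \o pmulr s g) (pmulr s (pa g) \o pa)) => n m /=.
apply: (plane_ext (pa \o pmul s (e n m)) (pmul s (pa (e n m)) \o pa)) => n' m' /=.
rewrite !pae pmulee paZ pae pmulZl pmulZr pmulee !scalerA -!exprD mulrC.
by congr (_ ^+ _ * _ *: _); lia.
Qed.

Lemma pa_pdeg n f : pdeg n f -> pdeg n (pa f).
Proof.
move=> <-; rewrite /pdeg; apply: (plane_ext (pcomp n \o pa \o pcomp n) (pa \o pcomp n)).
move=> i j /=; rewrite pcompe paZ pae !linearZ /= pcompe.
by case: eqP => _; rewrite ?scale1r // !scale0r ?scaler0.
Qed.

End RotationOperator.

(** * The module algebra structure transported from the plane *)

Section KashinaModule.
Variables (C : numClosedFieldType) (s : bool) (zeta : C).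
Hypothesis zeta4 : zeta ^+ 4 = -1.
Variables (gT : finGroupType) (a b : gT).
Hypotheses (gen_ab : <<[set a; b]>>%g = [set: gT]%SET) (a8 : (a ^+ 8 = 1)%g)
  (b2 : (b ^+ 2 = 1)%g) (ba : (b * a = a ^+ 3 * b)%g) (card_gT : #|gT| = 16%N).
Local Notation P := (plane C).
Local Notation e := (pe C).
Local Notation H := (group_algebra C gT).
Local Notation HH := (group_algebra C (gT * gT)%type).
Local Notation A := (quad_algebra (prel C s)).

Definition prho (x : gT) : P -> P := grep gen_ab a8 b2 ba (pa zeta) (pb s) x.

Let pa_order v : iter 8 (pa zeta) v = v. Proof. exact: pa8. Qed.
Let pb_pa v : pb s (pa zeta v) = iter 3 (pa zeta) (pb s v). Proof. exact: pba. Qed.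

Lemma prhoa f : prho a f = pa zeta f.
Proof. by apply: grepa => //; first [exact: pa_order|exact: pbK|exact: pb_pa]. Qed.
Lemma prhob f : prho b f = pb s f.
Proof. by apply: grepb => //; first [exact: pa_order|exact: pbK|exact: pb_pa]. Qed.
Lemma prhoM x y f : prho (x * y)%g f = prho x (prho y f).
Proof. by apply: grepM => //; first [exact: pa_order|exact: pbK|exact: pb_pa]. Qed.
Lemma prho1 f : prho 1%g f = f.
Proof. exact: grep1. Qed.
Lemma prho_sd p f :
  prho (sd a b p) f = iter p.1 (pa zeta) (if p.2 then pb s f else f).
Proof. exact: grep_sd. Qed.

Lemma prho_linear x : linear (prho x).
Proof.
have [p <-] := sd_surj gen_ab a8 b2 ba x.
by move=> c f g; rewrite !prho_sd; case: p.2; rewrite !linearP.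
Qed.
HB.instance Definition _ x :=
  GRing.isLinear.Build C P P *:%R (prho x) (prho_linear x).

Lemma prho_pmul x f g : prho x (pmul s f g) = pmul s (prho x f) (prho x g).
Proof.
move: x; apply: (gen_ind gen_ab) => [|x IH]; first by rewrite !prho1.
by rewrite !prhoM IH; split; rewrite ?prhoa ?prhob ?paM ?pbM.
Qed.

Lemma prho_e00 x : prho x (e 0 0) = e 0 0.
Proof.
move: x; apply: (gen_ind gen_ab) => [|x IH]; first by rewrite !prho1.
by rewrite !prhoM IH; split; rewrite ?prhoa ?prhob ?pae ?pbe ?muln0 scale1r.
Qed.

Lemma prho_pdeg n x f : pdeg n f -> pdeg n (prho x f).
Proof.
move=> fn; move: x; apply: (gen_ind gen_ab) => [|x IH]; first by rewrite !prho1.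
rewrite !prhoM prhoa prhob; split; first exact: pa_pdeg.
by rewrite /pdeg pcomp_pb IH.
Qed.

Fact pact_key : unit. Proof. exact: tt. Qed.
Definition pact (h : H) (f : P) : P :=
  locked_with pact_key (\sum_x h x *: prho x f).

Lemma pactE h f : pact h f = \sum_x h x *: prho x f.
Proof. by rewrite /pact locked_withE. Qed.

Lemma pact_linearl f : linear (pact^~ f).
Proof.
move=> c h k; rewrite !pactE scaler_sumr -big_split /=; apply: eq_bigr => x _.
by rewrite group_algebraD group_algebraZ scalerDl scalerA.
Qed.

Lemma pact_linearr h : linear (pact h).
Proof.
move=> c f g; rewrite !pactE scaler_sumr -big_split /=; apply: eq_bigr => x _.
by rewrite linearP scalerDr !scalerA mulrC.
Qed.

HB.instance Definition _ h :=
  GRing.isLinear.Build C P P *:%R (pact h) (pact_linearr h).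

Lemma pact_gelt x f : pact (gelt C x) f = prho x f.
Proof.
rewrite pactE (bigD1 x) //= big1 ?addr0 => [|y /negPf yx].
  by rewrite ffunE eqxx scale1r.
by rewrite ffunE yx scale0r.
Qed.

Lemma pact1 f : pact 1 f = f.
Proof.
have <- : gelt C (1%g : gT) = 1 by exact: gelt1.
by rewrite pact_gelt prho1.
Qed.

Lemma pactM h k f : pact (h * k) f = pact h (pact k f).
Proof.
rewrite [RHS]pactE [pact k f]pactE.
under [RHS]eq_bigr => x _ do rewrite linear_sum scaler_sumr.
rewrite pactE; under [LHS]eq_bigr => x _ do rewrite group_algebra_mulE scaler_suml.
rewrite exchange_big; apply: eq_bigr => x _ /=.
rewrite (reindex_inj (mulgI x)) /=; apply: eq_bigr => y _.
by rewrite mulKg linearZ /= prhoM scalerA.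
Qed.

Lemma pact_kdelta i f : pact (kdelta C a b i) f = pproj s i f.
Proof.
have lin c h k : pact (c *: h + k) f = c *: pact h f + pact k f by exact: pact_linearl.
have add h k : pact (h + k) f = pact h f + pact k f.
  by rewrite -[h in LHS]scale1r lin scale1r.
have zero : pact 0 f = 0.
  by have := lin (-1) 0 0; rewrite scaleN1r addNr => ->; rewrite scaleN1r addNr.
have scal c h : pact (c *: h) f = c *: pact h f.
  by rewrite -[c *: h]addr0 lin zero addr0.
have a4 g : prho (a ^+ 4)%g g = pc g.
  by rewrite !expgS expg0 mulg1 !prhoM !prhoa -(pa4 zeta4).
rewrite kdeltaE pprojE !(add, scal) !pact_gelt (prhoM (a ^+ 4)%g b) !a4 prhob.
by rewrite prho1.
Qed.

(** [pmul] after the action of a tensor; [tact_J] says that it yields [dot] for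
    the action of [J], whence [pact_dot] by [J * cotwist J h = group_comul h * J]. *)
Definition tact (t : HH) (f g : P) : P :=
  \sum_q t q *: pmul s (prho q.1 f) (prho q.2 g).

Lemma tact_linear f g : linear (fun t => tact t f g).
Proof.
move=> c t u; rewrite /tact scaler_sumr -big_split /=; apply: eq_bigr => q _.
by rewrite group_algebraD group_algebraZ scalerDl scalerA.
Qed.

Lemma tact_tensor u v f g :
  tact (tensor u v) f g = pmul s (pact u f) (pact v g).
Proof.
rewrite !pactE pmul_suml.
under [RHS]eq_bigr => x _ do rewrite pmul_sumr.
rewrite pair_big /=; apply: eq_bigr => -[x y] _ /=.
by rewrite ffunE pmulZl pmulZr scalerA.
Qed.

Lemma tactM t u f g :
  tact (t * u) f g = \sum_p u p *: tact t (prho p.1 f) (prho p.2 g).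
Proof.
rewrite /tact; under eq_bigr => q _ do rewrite group_algebra_mulE scaler_suml.
under [RHS]eq_bigr => p _ do rewrite scaler_sumr.
rewrite exchange_big [RHS]exchange_big /=; apply: eq_bigr => q _.
rewrite (reindex_inj (mulgI q)) /=; apply: eq_bigr => p _.
by rewrite mulKg !prhoM !scalerA mulrC.
Qed.

(** Group elements act by automorphisms of [pmul], so a diagonal factor on the left can be applied
    after multiplying. *)
Lemma tact_comul h t f g : tact (group_comul h * t) f g = pact h (tact t f g).
Proof.
rewrite /tact; under eq_bigr => q _ do rewrite group_algebra_mulE scaler_suml.
rewrite exchange_big /=.
under eq_bigr => p _ do rewrite (reindex_inj (mulgI p)) /=.
rewrite pactE.
transitivity (\sum_(p : gT * gT) group_comul h p *:
    \sum_q t q *: pmul s (prho p.1 (prho q.1 f)) (prho p.2 (prho q.2 g))).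
  apply: eq_bigr => p _; rewrite scaler_sumr; apply: eq_bigr => q _.
  by rewrite mulKg !prhoM !scalerA.
have comulE p : group_comul h p = \sum_x h x * (p == (x, x))%:R.
  by rewrite sum_ffunE; apply: eq_bigr => x _; rewrite group_algebraZ ffunE.
under [LHS]eq_bigr => p _ do rewrite comulE scaler_suml.
rewrite exchange_big /=; apply: eq_bigr => x _.
rewrite (bigD1 (x, x)) //= [X in _ + X]big1 ?addr0 => [|p /negPf ->]; last first.
  by rewrite mulr0 scale0r.
rewrite eqxx mulr1 [prho x (\sum_q _)]linear_sum /=; congr (_ *: _).
apply: eq_bigr => q _.
by rewrite linearZ /= prho_pmul.
Qed.

Lemma tact_J f g : tact (kashina_J C a b) f g = dot s f g.
Proof.
rewrite kashina_JE dotE.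
pose F t := tact t f g; rewrite -/(F _).
pose FL : {linear HH -> P} :=
  HB.pack F (GRing.isLinear.Build C HH P *:%R F (tact_linear f g)).
rewrite -[F]/(FL : HH -> P) linear_sum; apply: eq_bigr => i _.
rewrite linear_sum; apply: eq_bigr => j _.
by rewrite linearZ /= /F tact_tensor !pact_kdelta.
Qed.

Lemma pact_dot h f g : pact h (dot s f g) =
  \sum_p kashina_comul C a b h p *: dot s (prho p.1 f) (prho p.2 g).
Proof.
have a4b : (b * a ^+ 4 = a ^+ 4 * b)%g.
  by rewrite b_expa // (expa_mod a8).
have JU : kashina_J C a b \is a GRing.unit.
  by apply: kashina_J_unit => //; rewrite -?expgD // -?b2.
under eq_bigr => p _ do rewrite -tact_J.
rewrite -tactM /kashina_comul /cotwist !mulrA mulrV // mul1r.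
by rewrite tact_comul tact_J.
Qed.

Definition kact (h : H) (f : A) : A := phi_inv s (pact h (phi f)).

Lemma phi_kact h f : phi (kact h f) = pact h (phi f).
Proof. by rewrite /kact phi_invK. Qed.

Lemma kact_linearl f : linear (kact^~ f).
Proof. by move=> c h k; apply: phi_inj; rewrite linearP /= !phi_kact pact_linearl. Qed.

Lemma kact_linearr h : linear (kact h).
Proof. by move=> c f g; apply: phi_inj; rewrite linearP /= !phi_kact !linearP. Qed.

Lemma kact1l f : kact 1 f = f.
Proof. by apply: phi_inj; rewrite phi_kact pact1. Qed.

Lemma kactMl h k f : kact (h * k) f = kact h (kact k f).
Proof. by apply: phi_inj; rewrite !phi_kact pactM. Qed.

Lemma kact1r h : kact h 1 = (counit h)%:A.
Proof.
apply: phi_inj; rewrite phi_kact linearZ /= phi1 pactE.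
by rewrite /counit scaler_suml; apply: eq_bigr => x _; rewrite prho_e00.
Qed.

Lemma kactMr h f g : kact h (f * g) =
  \sum_p kashina_comul C a b h p *: (kact (gelt C p.1) f * kact (gelt C p.2) g).
Proof.
apply: phi_inj; rewrite phi_kact phiM pact_dot linear_sum; apply: eq_bigr => p _.
by rewrite linearZ /= phiM !phi_kact !pact_gelt.
Qed.

Definition kashina_module : module_algebra (kashina_comul C a b) A :=
  ModuleAlgebra kact_linearl kact_linearr kact1l kactMl kact1r kactMr.

End KashinaModule.

(** * Classification of the actions *)

Section ModuleAgreement.
Variables (C : numClosedFieldType) (gT : finGroupType) (a b : gT) (r : quadric C).
Hypothesis gen_ab : <<[set a; b]>>%g = [set: gT]%SET.
Variable D : group_algebra C gT -> group_algebra C (gT * gT)%type.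
Local Notation A := (quad_algebra r).
Variables M M' : module_algebra D A.
Hypothesis M'_graded : graded_action M' (qgrade r).
Hypotheses (agree_aX : M (gelt C a) (qX r) = M' (gelt C a) (qX r))
  (agree_aY : M (gelt C a) (qY r) = M' (gelt C a) (qY r))
  (agree_bX : M (gelt C b) (qX r) = M' (gelt C b) (qX r))
  (agree_bY : M (gelt C b) (qY r) = M' (gelt C b) (qY r)).

Lemma act0r (N : module_algebra D A) h : N h 0 = 0.
Proof.
have := act_linearr N h (-1) 0 0; rewrite scaleN1r addNr => ->.
by rewrite scaleN1r addNr.
Qed.

Lemma actZr (N : module_algebra D A) h c f : N h (c *: f) = c *: N h f.
Proof. by have := act_linearr N h c f 0; rewrite act0r !addr0. Qed.

Lemma actDr (N : module_algebra D A) h f g : N h (f + g) = N h f + N h g.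
Proof. by have := act_linearr N h 1 f g; rewrite !scale1r. Qed.

(** Gradedness keeps the images of X and Y in their span, so agreement of a and b on X, Y spreads to
    all group elements in degree 1, and then to products by [actMr]. *)
Lemma act_agree h f : M h f = M' h f.
Proof.
have agree1 x g : qgrade r 1 g -> M (gelt C x) g = M' (gelt C x) g.
  move=> g1; move: x; apply: (gen_ind gen_ab) => [|x IH].
    have -> : gelt C (1%g : gT) = 1 by exact: gelt1.
    by rewrite !act1l.
  have [u [v uv]] := qgrade1E (M'_graded (gelt C x) g1).
  rewrite -!gelt_mul !actMl IH uv !act_linearr.
  by rewrite !actZr agree_aX agree_aY agree_bX agree_bY.
move: h; move: f; apply: quad_ind => [c f g Hf Hg h||f Hf].
- by rewrite !act_linearr Hf Hg.
- by move=> h; rewrite !act1r.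
have HX g : qgrade r 1 g -> forall h, M h (f * g) = M' h (f * g).
  move=> g1 h; rewrite !actMr; apply: eq_bigr => p _.
  by rewrite Hf agree1.
by split; apply: HX; [exact: qgradeX|exact: qgradeY].
Qed.

End ModuleAgreement.

(** * Models for a square root of z, and their exhaustiveness *)

Section Classification.
Variables (C : numClosedFieldType) (s : bool).
Variables (gT : finGroupType) (a b : gT).
Hypotheses (gen_ab : <<[set a; b]>>%g = [set: gT]%SET) (a8 : (a ^+ 8 = 1)%g)
  (b2 : (b ^+ 2 = 1)%g) (ba : (b * a = a ^+ 3 * b)%g) (card_gT : #|gT| = 16%N).
Local Notation P := (plane C).
Local Notation e := (pe C).
Local Notation r := (prel C s).
Local Notation X := (qX r).
Local Notation Y := (qY r).
Variable z : C.
Hypothesis z2 : z ^+ 2 = -1.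

Lemma qXY_free c d : c *: X + d *: Y = 0 -> c = 0 /\ d = 0.
Proof.
move/(congr1 (@phi C s)); rewrite linear0 linearP linearZ /= phiX phiY => E.
have := congr1 (pcoef (1, 0)%N) E; have := congr1 (pcoef (0, 1)%N) E.
rewrite /pgen !pcoefE !pcoefe /= !mulr0 !mulr1 expr0 expr1 => E1 E2.
have E3 : c / 2 = d / 2 by apply/eqP; rewrite -subr_eq0 -E1; apply/eqP; ring.
have E4 : c = 0 by transitivity (c / 2 + c / 2); [field|rewrite {2}E3 -[RHS]E2; ring].
by split=> //; transitivity (d / 2 + d / 2); [field|rewrite -{1}E3 -[RHS]E2; ring].
Qed.

Section Model.
Variable zeta : C.
Hypothesis zeta2 : zeta ^+ 2 = z.

Fact zeta4_of_z : zeta ^+ 4 = -1.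
Proof. by rewrite (exprM zeta 2 2) zeta2 z2. Qed.

Definition kmod := kashina_module s zeta4_of_z gen_ab a8 b2 ba card_gT.

Lemma phi_kmod x f : phi (kmod (gelt C x) f) = prho s zeta gen_ab a8 b2 ba x (phi f).
Proof. by rewrite [kmod _ _]/(kact _ _ _ _ _ _ _) phi_kact pact_gelt. Qed.

Lemma kmod_graded : graded_action kmod (qgrade r).
Proof.
move=> h n f /phi_degE fn; apply/phi_degE.
rewrite [kmod _ _]/(kact _ _ _ _ _ _ _) phi_kact pactE.
by apply: pdeg_sum => x _; apply: pdegZ; apply: prho_pdeg => //; exact: zeta4_of_z.
Qed.

(** In the model a multiplies X + Y by [zeta] and X - Y by [zeta ^+ 3 = z * zeta], so [x] and [y]
    are half the sum and half the difference of these eigenvalues. *)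
Lemma kmod_aX x y : zeta = x + y -> z * zeta = x - y ->
  kmod (gelt C a) X = x *: X + y *: Y /\ kmod (gelt C a) Y = y *: X + x *: Y.
Proof.
have zeta4 := zeta4_of_z.
move=> E1 E2; have E3 : zeta ^+ 3 = x - y by rewrite -E2 -zeta2 -exprSr.
split; apply: phi_inj; rewrite phi_kmod prhoa // !linearD !linearZ /= phiX phiY;
  rewrite /pgen paZ linearD /= paZ !pae addn0 add0n muln1 expr1 E3 E1;
  by apply: pcoefP => k l; rewrite !pcoefE /=; ring.
Qed.

Lemma kmod_b : kmod (gelt C b) X = X /\ kmod (gelt C b) Y = - Y.
Proof.
have zeta4 := zeta4_of_z.
split; apply: phi_inj; rewrite phi_kmod prhob // ?linearN /= ?phiX ?phiY.
  by have [_ ->] := @pgen_hom C s ord0; rewrite scale1r.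
by have [_ ->] := @pgen_hom C s ord_max; rewrite scaleN1r.
Qed.

Lemma kmod_values : kashina_values kmod z.
Proof.
have [bX bY] := kmod_b.
split; first exact: kmod_graded.
pose x := (zeta + z * zeta) / 2; pose y := (zeta - z * zeta) / 2.
have e1 : zeta = x + y by rewrite /x /y; field.
have e2 : z * zeta = x - y by rewrite /x /y; field.
have [aX aY] := kmod_aX e1 e2.
have zz : z * z = -1 by rewrite -expr2.
have zzeta : zeta * zeta = z by rewrite -expr2.
(* The square of a multiplies X + Y by z and X - Y by z^3 = -z, so it exchanges X and Y up to z. In
   coordinates: x^2 + y^2 = 0 and 2xy = z. *)
have xx : x * x + y * y = 0.
  transitivity ((zeta * zeta) * (1 + z * z) / 2); first by rewrite /x /y; field.
  by rewrite zz subrr mulr0 mul0r.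
have xy : x * y + y * x = z.
  transitivity ((zeta * zeta) * (1 - z * z) / 2); first by rewrite /x /y; field.
  by rewrite zz zzeta; field.
split=> //; rewrite expgS expg1 -gelt_mul actMl (aX, aY) actDr !actZr aX aY.
  rewrite !scalerDr !scalerA addrACA -!scalerDl xx xy scale0r add0r //.
rewrite !scalerDr !scalerA addrACA -!scalerDl [y * y + _]addrC xx.
by rewrite addrC [y * x + _]addrC xy scale0r add0r.
Qed.

End Model.

(** Write aX = xX + yY. The square root of z to take is x + y, the eigenvalue of a on X + Y. *)
Lemma kashina_values_kmod (M : module_algebra (kashina_comul C a b) (quad_algebra r)) :
  kashina_values M z ->
  exists (zeta : C) (hz : zeta ^+ 2 = z), forall h f, M h f = kmod hz h f.
Proof.
move=> [Mgr [a2X bX a2Y bY]].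
have z0 : z != 0.
  apply/eqP => zE; move: z2; rewrite zE expr0n /= => /esym/eqP.
  by rewrite oppr_eq0 oner_eq0.
have zz : z * z = -1 by rewrite -expr2.
have [x [y aX]] := qgrade1E (Mgr (gelt C a) 1%N X (qgradeX r)).
have free x1 y1 x2 y2 : x1 *: X + y1 *: Y = x2 *: X + y2 *: Y -> x1 = x2 /\ y1 = y2.
  move=> /eqP; rewrite -subr_eq0 opprD addrACA -!scalerBl.
  move=> /eqP /qXY_free [/eqP + /eqP].
  by rewrite !subr_eq0 => /eqP -> /eqP ->.
have a2E f : M (gelt C (a ^+ 2)%g) f = M (gelt C a) (M (gelt C a) f).
  by rewrite expgS expg1 -gelt_mul actMl.
(* a commutes with a^2, which sends X to zY. *)
have aY : M (gelt C a) Y = y *: X + x *: Y.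
  have : M (gelt C a) (M (gelt C (a ^+ 2)%g) X)
      = M (gelt C (a ^+ 2)%g) (M (gelt C a) X).
    by rewrite !a2E.
  rewrite a2X actZr aX actDr !actZr a2X a2Y => /(congr1 (fun f => z^-1 *: f)).
  rewrite scalerA mulVf // scale1r => ->; rewrite scalerDr !scalerA.
  by rewrite addrC; congr (_ *: _ + _ *: _); field.
have [xx xy] : x * x + y * y = 0 /\ x * y + y * x = z.
  apply: free; rewrite scale0r add0r -a2X a2E aX actDr !actZr aX aY.
  by rewrite !scalerDr !scalerA addrACA -!scalerDl.
(* These are the coordinates of the relation ba = a^3 b applied to X; they say that x - y equals z(x
   + y). *)
have [xz yz] : x = z * y /\ - y = z * x.
  apply: free; transitivity (M (gelt C b) (M (gelt C a) X)).
    by rewrite aX actDr !actZr bX bY scalerN scaleNr.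
  rewrite -actMl gelt_mul ba expgSr -[(_ * a * b)%g]mulgA.
  rewrite -(gelt_mul _ (a ^+ 2)%g (a * b)%g) -(gelt_mul _ a b) !actMl bX aX.
  rewrite actDr !actZr a2X a2Y.
  by rewrite !scalerA addrC ![_ * z]mulrC.
have hz : (x + y) ^+ 2 = z.
  by rewrite -xy -[RHS]add0r -xx; ring.
exists (x + y), hz => h f.
have e2 : z * (x + y) = x - y by rewrite mulrDr -xz -yz addrC.
have [aX' aY'] := kmod_aX hz erefl e2.
have [bX' bY'] := kmod_b hz.
apply: (act_agree gen_ab (@kmod_graded _ hz)).
- by rewrite aX aX'.
- by rewrite aY aY'.
- by rewrite bX bX'.
- by rewrite bY bY'.
Qed.

End Classification.

(** * Invariants *)

Section PrimitiveRoot.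
Variables (C : numClosedFieldType) (zeta : C).
Hypothesis zeta4 : zeta ^+ 4 = -1.

Lemma zeta_primitive : 8.-primitive_root zeta.
Proof.
have [m mz m8] := prim_order_exists (isT : 0 < 8)%N (zeta8 zeta4).
suff <- : m = 8%N by [].
have m4 : ~~ (m %| 4)%N.
  apply/negP => /dvdnP[k E]; move: zeta4; rewrite E mulnC exprM (prim_expr_order mz).
  rewrite expr1n => /eqP; rewrite -subr_eq0 opprK.
  by rewrite (_ : 1 + 1 = 2%:R) // pnatr_eq0.
have := dvdn_leq (isT : 0 < 8)%N m8; move: m m8 m4 {mz}.
by do 9?[case=> //].
Qed.

(** A polynomial of degree less than 8 vanishing at the eight distinct powers of [zeta] is zero. *)
Lemma fourier_injective (h : 'I_8 -> C) :
  (forall k, \sum_(i < 8) h i * zeta ^+ (i * k) = 0) -> forall i, h i = 0.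
Proof.
move=> H i; pose p := \poly_(j < 8) h (inord j).
have p0 : p = 0.
  apply: contraTeq isT => p0.
  have := max_poly_roots p0 (rs := [seq zeta ^+ k | k <- iota 0 8]).
  rewrite size_map size_iota ltnNge size_poly; apply; last first.
    rewrite map_inj_in_uniq ?iota_uniq // => k l; rewrite !mem_iota !add0n /= => k8 l8.
    by move/eqP; rewrite (eq_prim_root_expr zeta_primitive) !modn_small // => /eqP.
  apply/allP => _ /mapP[k _ ->]; apply/rootP; rewrite horner_poly -[RHS](H k).
  by apply: eq_bigr => j _; rewrite inord_val -exprM mulnC.
have := congr1 (fun q : {poly C} => q`_i) p0.
by rewrite coef_poly ltn_ord inord_val coef0.
Qed.

End PrimitiveRoot.

Section KashinaInvariants.
Variables (C : numClosedFieldType) (s : bool).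
Variables (gT : finGroupType) (a b : gT).
Hypotheses (gen_ab : <<[set a; b]>>%g = [set: gT]%SET) (a8 : (a ^+ 8 = 1)%g)
  (b2 : (b ^+ 2 = 1)%g) (ba : (b * a = a ^+ 3 * b)%g) (card_gT : #|gT| = 16%N).
Local Notation P := (plane C).
Local Notation e := (pe C).
Local Notation r := (prel C s).
Variables (z zeta : C).
Hypotheses (z2 : z ^+ 2 = -1) (zeta2 : zeta ^+ 2 = z).
Variable M : module_algebra (kashina_comul C a b) (quad_algebra r).
Hypothesis ME : forall h f, M h f = kmod s gen_ab a8 b2 ba card_gT z2 zeta2 h f.

Let zeta4 : zeta ^+ 4 = -1. Proof. exact: zeta4_of_z zeta2. Qed.

Lemma phi_act h f : phi (M h f) = pact s zeta gen_ab a8 b2 ba h (phi f).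
Proof. by rewrite ME [kmod _ _ _ _ _ _ _ _ _ _]/(kact _ _ _ _ _ _ _) phi_kact. Qed.

Lemma act_faithful h : (forall f, M h f = 0) -> h = 0.
Proof.
move=> h0.
have E n m : \sum_(i < 8) (h (sd a b (i, false)) * zeta ^+ (i * (n + 3 * m))) *: e n m
    + \sum_(i < 8) (h (sd a b (i, true)) * (-1) ^+ (s * (n * m))
         * zeta ^+ (i * (m + 3 * n))) *: e m n = 0.
  have : phi (M h (phi_inv s (e n m))) = 0 by rewrite h0 linear0.
  rewrite phi_act phi_invK pactE (big_sd gen_ab a8 b2 ba card_gT) => E0.
  rewrite -[RHS]E0.
  congr (_ + _); apply: eq_bigr => i _.
    by rewrite prho_sd //= iter_pae scalerA.
  by rewrite prho_sd //= pbe [iter i _ _]linearZ /= iter_pae !scalerA.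
(* Elements of the group algebra are tested on u^(k+8) and v^(k+8). The shift changes no power of
   [zeta] but separates the two monomials, which coincide at exponent 0. *)
have shift8 i k : zeta ^+ (i * (k + 8)) = zeta ^+ (i * k).
  by rewrite mulnDr exprD (mulnC i 8) [zeta ^+ (8 * i)]exprM (zeta8 zeta4) expr1n mulr1.
have Ea : forall i, h (sd a b (i, false)) = 0.
  apply: (fourier_injective zeta4) => k.
  have := congr1 (pcoef (k + 8, 0)%N) (E (k + 8) 0)%N.
  rewrite pcoef0 pcoefD !linear_sum /= [X in _ + X]big1 ?addr0 => [E1|i _]; last first.
    by rewrite pcoefZ pcoefe xpair_eqE (addnC k) mulr0.
  rewrite -[RHS]E1; apply: eq_bigr => i _.
  by rewrite pcoefZ pcoefe eqxx mulr1 muln0 addn0 shift8.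
have Eb : forall i, h (sd a b (i, true)) = 0.
  apply: (fourier_injective zeta4) => k.
  have := congr1 (pcoef (k + 8, 0)%N) (E 0 (k + 8))%N.
  rewrite pcoef0 pcoefD !linear_sum /= [X in X + _]big1 ?add0r => [E1|i _]; last first.
    by rewrite pcoefZ pcoefe xpair_eqE (addnC k) mulr0.
  rewrite -[RHS]E1; apply: eq_bigr => i _.
  rewrite pcoefZ pcoefe eqxx mulr1 muln0 addn0 mul0n muln0 expr0 mulr1.
  by rewrite shift8.
apply/ffunP => x; rewrite [RHS]ffunE.
by have [[i []] <-] := sd_surj gen_ab a8 b2 ba x.
Qed.

Definition pinv (g : P) := pa zeta g = g /\ pb s g = g.

Lemma invariantsP f : f \in invariants M <-> pinv (phi f).
Proof.
split=> [/asboolP Mf|[fa fb]]; last first.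
  apply/asboolP => h; apply: phi_inj; rewrite phi_act linearZ /= pactE.
  rewrite /counit scaler_suml; apply: eq_bigr => x _; congr (_ *: _).
  move: x; apply: (gen_ind gen_ab) => [|x IH]; first by rewrite prho1.
  by rewrite !prhoM ?zeta4 // IH prhoa ?prhob ?zeta4.
have H x : prho s zeta gen_ab a8 b2 ba x (phi f) = phi f.
  by rewrite -pact_gelt -phi_act Mf counit_gelt scale1r.
split; first by rewrite -[RHS](H a) prhoa // zeta4.
by rewrite -[RHS](H b) prhob // zeta4.
Qed.

Lemma pcomp_pa n g : pcomp n (pa zeta g) = pa zeta (pcomp n g).
Proof.
apply: (pcomp_graded (L := pa zeta)) => i j.
by rewrite /= pae; apply: pdegZ; exact: pdege.
Qed.

Lemma pinv_comp n g : pinv g -> pinv (pcomp n g).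
Proof. by move=> [ga gb]; rewrite /pinv -pcomp_pa -pcomp_pb ga gb. Qed.

Lemma inv_comp n (x : invariant_algebra M) :
  phi_inv s (pcomp n (phi (val x))) \in invariants M.
Proof.
apply/invariantsP; rewrite phi_invK; apply: pinv_comp.
exact/invariantsP/(valP x).
Qed.

Lemma invariants_connected : connected_graded (invariant_grade M).
Proof.
split.
- split.
  + move=> n; split; first exact: qgrade0.
    by move=> x y xn yn; apply: qgradeD => //; exact: qgradeN.
  + move=> x; pose g := phi (val x).
    pose c n : invariant_algebra M :=
      exist (fun f => f \in invariants M) _ (inv_comp n x).
    (* Distinct monomials of the support may share a total degree, which must be listed once. *)
    exists (undup [seq (k.1 + k.2)%N | k <- psupp g]), c; split.
      move=> n; apply/phi_degE; rewrite [\val _]/= phi_invK; exact: pcompK.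
    apply: val_inj; rewrite raddf_sum /=; apply: phi_inj; rewrite linear_sum /=.
    under eq_bigr => n _ do rewrite phi_invK.
    apply: pcoefP => i j; rewrite -/g linear_sum /=.
    under eq_bigr => n _ do rewrite pcoef_comp.
    have [->|gij] := eqVneq (pcoef (i, j) g) 0.
      by rewrite big1 // => n _; rewrite mulr0.
    rewrite (bigD1_seq (i + j)%N) ?undup_uniq //=; last first.
      by rewrite mem_undup; apply/mapP; exists (i, j); rewrite ?pcoef_supp.
    rewrite eqxx mul1r big1 ?addr0 // => n /negPf nij.
    by rewrite eq_sym nij mul0r.
  + move=> t c t_uniq cgr sum0 i it.
    have c_deg j : pdeg j (phi (val (c j))) by apply/phi_degE; exact: cgr.
    apply: val_inj; apply: phi_inj; rewrite (linear0 (@phi C s)) /= -(c_deg i).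
    have := congr1 (fun x => pcomp i (phi (val x))) sum0.
    rewrite raddf_sum !linear_sum /= !linear0 (bigD1_seq i) //=.
    rewrite [X in _ + X]big1 ?addr0 // => j ji.
    rewrite -(c_deg j); apply: pcoefP => k l; rewrite !pcoef_comp pcoef0.
    have [ij|] := eqVneq (k + l)%N i; last by rewrite mul0r.
    by rewrite ij eq_sym (negPf ji) mul0r mulr0.
- by move=> m n x y xm yn; exact: qgradeM.
- move=> x; split=> [/phi_degE/pdegP x0|[c ->]].
    exists (pcoef (0, 0)%N (phi (val x))); apply: val_inj; apply: phi_inj.
    transitivity (pcoef (0, 0)%N (phi (val x)) *: e 0 0); last first.
      by rewrite -(phi1 C s) -linearZZ.
    apply: pcoefP => i j; rewrite pcoefZ pcoefe.
    case: eqP => [[-> ->]|ij]; first by rewrite mulr1.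
    apply/eqP; rewrite mulr0; apply: contraT => /x0.
    by move: ij; case: (i) => [|//]; case: (j).
  by apply: qgradeZ; exact: qgrade1.
Qed.

End KashinaInvariants.

(** * Generators, relation and syzygies of the invariants in the plane *)

Section InvariantPlane.
Variables (C : numClosedFieldType) (s : bool) (zeta : C).
Hypothesis zeta4 : zeta ^+ 4 = -1.
Local Notation P := (plane C).
Local Notation e := (pe C).
Local Notation pinv := (pinv s zeta).
Local Notation "f ** g" := (pmul s f g) (at level 40, left associativity).
Implicit Types f g h x y : P.

Lemma pcoef_pa n m g : pcoef (n, m) (pa zeta g) = zeta ^+ (n + 3 * m) * pcoef (n, m) g.
Proof.
rewrite -pcoefZ; apply: (plane_ext_scalar (pcoef (n, m) \o pa zeta)
  (pcoef (n, m) \o (zeta ^+ (n + 3 * m) \*: idfun))) => i j /=.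
rewrite pae !pcoefZ pcoefe.
by case: ((n, m) =P (i, j)) => [[-> ->]|_] //; rewrite !mulr0.
Qed.

Lemma pcoef_pb n m g : pcoef (n, m) (pb s g) = (-1) ^+ (s * (n * m)) * pcoef (m, n) g.
Proof.
rewrite -pcoefZ; apply: (plane_ext_scalar (pcoef (n, m) \o pb s)
  (pcoef (m, n) \o ((-1) ^+ (s * (n * m)) \*: idfun))) => i j /=.
rewrite pbe !pcoefZ !pcoefe !xpair_eqE.
case: (n =P j) => [->|_]; last by rewrite andbF !mulr0.
by case: (m =P i) => [->|_]; rewrite ?andbF ?andbT ?[(i * j)%N]mulnC ?mulr0.
Qed.

Let sgnD k : (-1) ^+ (k + k) = 1 :> C.
Proof. by rewrite exprD -expr2 sqrr_sign. Qed.

(** The orbit sum of u^n v^m under b. On the diagonal it is twice the monomial, or zero when the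
    sign is -1. *)
Definition pE n m : P := e n m + (-1) ^+ (s * (n * m)) *: e m n.

Lemma pE_sym n m : pE m n = (-1) ^+ (s * (n * m)) *: pE n m.
Proof.
rewrite /pE scalerDr scalerA -exprD [(m * n)%N]mulnC.
by rewrite sgnD scale1r addrC.
Qed.

Lemma pinvE n m : (8 %| n + 3 * m)%N -> pinv (pE n m).
Proof.
(* Modulo 8, m + 3n is three times n + 3m. *)
move=> d8; have d8' : (8 %| m + 3 * n)%N by lia.
have z8 k : (8 %| k)%N -> zeta ^+ k = 1.
  by move=> /dvdnP[l ->]; rewrite mulnC exprM (zeta8 zeta4) expr1n.
split; first by rewrite /pE linearD /= paZ !pae !z8 // !scale1r.
rewrite /pE linearD /= pbZ !pbe scalerA -exprD [(m * n)%N]mulnC.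
by rewrite sgnD scale1r addrC.
Qed.

Lemma pinv_dvd g n m : pinv g -> pcoef (n, m) g != 0 -> (8 %| n + 3 * m)%N.
Proof.
move=> [ga _] g0; rewrite (prim_order_dvd (zeta_primitive zeta4)).
apply/eqP; apply: (mulIf g0); rewrite mul1r -pcoef_pa.
by rewrite ga.
Qed.

(** Averaging over b replaces each monomial by half its orbit sum. *)
Lemma pinv_expand g : pinv g ->
  g = \sum_(k <- psupp g) (2^-1 * pcoef k g) *: pE k.1 k.2.
Proof.
move=> [ga gb]; have E : g = 2^-1 *: (g + pb s g).
  by rewrite gb; apply: pcoefP => i j; rewrite !pcoefE; field.
rewrite {1}E {1 2}(pexpand g) linear_sum -big_split scaler_sumr /=.
apply: eq_bigr => k _; rewrite /pE linearZ /= pbe -scalerDr.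
by rewrite scalerA.
Qed.

Lemma pinv_ind (S : P -> Prop) g : pinv g ->
  S 0 -> (forall c x y, S x -> S y -> S (c *: x + y)) ->
  (forall n m, pcoef (n, m) g != 0 -> S (pE n m)) -> S g.
Proof.
move=> ginv S0 Slin SE; rewrite (pinv_expand ginv) big_seq.
elim/big_rec: _ => // -[n m] f; rewrite pcoef_supp => gnm Sf.
by apply: Slin => //; exact: SE.
Qed.

Lemma pinv0 : pinv 0. Proof. by split; rewrite linear0. Qed.
Lemma pinvP c x y : pinv x -> pinv y -> pinv (c *: x + y).
Proof. by move=> [xa xb] [ya yb]; split; rewrite linearP /= ?xa ?xb ?ya ?yb. Qed.
Lemma pinvZ c x : pinv x -> pinv (c *: x).
Proof. by move=> hx; rewrite -[_ *: _]addr0; apply: pinvP => //; exact: pinv0. Qed.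
Lemma pinvN x : pinv x -> pinv (- x).
Proof. by rewrite -scaleN1r; exact: pinvZ. Qed.
Lemma pinv_mul x y : pinv x -> pinv y -> pinv (x ** y).
Proof. by move=> [xa xb] [ya yb]; split; rewrite ?paM ?pbM ?xa ?xb ?ya ?yb. Qed.
Lemma pinv_hom x : pinv x -> phom s (false, false) x.
Proof.
move=> [xa xb]; split; last by rewrite scale1r.
by rewrite -(pa4 zeta4) !iterS xa xa xa xa scale1r.
Qed.

Lemma pinv_dot x y : pinv x -> dot s x y = x ** y.
Proof. by move=> /pinv_hom; exact: dot_hom0l. Qed.

Definition pp := e 2 2.
Definition pw := e 5 1 + (-1) ^+ s *: e 1 5.
Definition ps := e 8 0 + e 0 8.
(** The quotient of the square of [pw] by [pp], see [pw_sqr]. *)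
Definition pq := (-1) ^+ s *: ps + 2 *: e 4 4.

Let sgn2 k : (-1) ^+ (s * (2 * k)) = 1 :> C.
Proof. by rewrite mulnCA exprM sqrrN expr1n expr1n. Qed.

Let sgn1 j : (-1) ^+ (s * (2 * j + 1)) = (-1) ^+ s :> C.
Proof. by rewrite mulnDr exprD sgn2 mul1r muln1. Qed.

Lemma pwE : pw = pE 5 1.
Proof. by rewrite /pE /pw -(sgn1 2). Qed.

Lemma pE_mulp n m : pE n m ** pp = pE n.+2 m.+2.
Proof.
rewrite /pE /pp pmulDl pmulZl !pmulee ![(_ * 2)%N]mulnC !sgn2 !scale1r !addn2.
congr (_ + _ *: _); have -> : (n.+2 * m.+2 = n * m + 2 * (n + m + 2))%N by lia.
by rewrite mulnDr exprD sgn2 mulr1.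
Qed.

Lemma pE_mulw k : pE (8 * k) 0 ** pw = pE (8 * k + 5) 1 + (-1) ^+ s *: pE (8 * k + 1) 5.
Proof.
have -> : pE (8 * k) 0 = e (8 * k) 0 + e 0 (8 * k).
  by rewrite /pE !muln0 scale1r.
rewrite /pw /pE !(pmulDl, pmulDr, pmulZl, pmulZr, pmulee) !mul0n !muln0 !add0n.
have -> : (8 * k * 5 = 2 * (20 * k))%N by lia.
have -> : (8 * k * 1 = 2 * (4 * k))%N by lia.
have -> : ((8 * k + 5) * 1 = 2 * (4 * k + 2) + 1)%N by lia.
have -> : ((8 * k + 1) * 5 = 2 * (20 * k + 2) + 1)%N by lia.
rewrite !sgn2 !sgn1.
by apply: pcoefP => i j; rewrite !pcoefE; case: (s); rewrite /=; ring.
Qed.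

Lemma pE_muls k : pE (8 * k) 0 ** ps = pE (8 * k.+1) 0 + pE (8 * k) 8.
Proof.
have -> : pE (8 * k) 0 = e (8 * k) 0 + e 0 (8 * k).
  by rewrite /pE !muln0 scale1r.
rewrite /ps /pE !(pmulDl, pmulDr, pmulZl, pmulZr, pmulee) !mul0n !muln0 !add0n.
have -> : (8 * k * 8 = 2 * (32 * k))%N by lia.
rewrite !sgn2 !scale1r !addn0 mulnS [(8 + _)%N]addnC.
by apply: pcoefP => i j; rewrite !pcoefE; ring.
Qed.

(** Invariants divisible by [u v] lie in the ideal generated by [pp] and [pw]. *)
Lemma pE_decomp n m : (0 < n)%N -> (0 < m)%N -> (8 %| n + 3 * m)%N ->
  exists (c d : C) (n1 m1 n2 m2 : nat),
  [/\ (n1 + m1 < n + m)%N /\ (n2 + m2 < n + m)%N,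
      (8 %| n1 + 3 * m1)%N, (8 %| n2 + 3 * m2)%N
    & pE n m = c *: (pE n1 m1 ** pp) + d *: (pE n2 m2 ** pw)].
Proof.
have pE00 : pE 0 0 = 2 *: e 0 0.
  by rewrite /pE !muln0; apply: pcoefP => i j; rewrite !pcoefE; ring.
have sub1 k : exists (c d : C) (n1 m1 n2 m2 : nat),
    [/\ (n1 + m1 < 8 * k + 5 + 1)%N /\ (n2 + m2 < 8 * k + 5 + 1)%N,
        (8 %| n1 + 3 * m1)%N, (8 %| n2 + 3 * m2)%N
      & pE (8 * k + 5) 1 = c *: (pE n1 m1 ** pp) + d *: (pE n2 m2 ** pw)].
  case: k => [|k].
    (* The factor 1/2 is there because [pE 0 0] is twice the unit. *)
    exists 0, 2^-1, 0%N, 0%N, 0%N, 0%N; split=> //.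
    rewrite scale0r add0r pE00 pmulZl pmul1l scalerA mulVf ?pnatr_eq0 // scale1r.
    by rewrite pwE.
  (* The product of [pw] with u^(8k+8) + v^(8k+8) is the wanted orbit sum plus, up to sign, that of
     u^(8k+9) v^5, which [pp] divides. *)
  exists (- (-1) ^+ s), 1, (8 * k + 7)%N, 3%N, (8 * k.+1)%N, 0%N; split; [lia|lia|lia|].
  rewrite pE_mulp pE_mulw scale1r.
  have -> : (8 * k + 7).+2 = (8 * k.+1 + 1)%N by lia.
  by rewrite scaleNr addrC addrK.
move=> n0 m0 d8.
have [n1|n2] := leqP n 1%N; last first.
  have [m1|m2] := leqP m 1%N; last first.
    exists 1, 0, (n - 2)%N, (m - 2)%N, 0%N, 0%N; split=> //; [lia|lia|].
    rewrite scale0r addr0 scale1r pE_mulp.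
    by have [-> ->] : (n - 2).+2 = n /\ (m - 2).+2 = m by lia.
  have m1E : m = 1%N by lia.
  have [k nE] : exists k, n = (8 * k + 5)%N by exists (n %/ 8)%N; lia.
  by rewrite nE m1E; exact: sub1.
have n1E : n = 1%N by lia.
have [k mE] : exists k, m = (8 * k + 5)%N by exists (m %/ 8)%N; lia.
have [c [d [a1 [b1 [a2 [b2 [[l1 l2] d1 d2 E]]]]]]] := sub1 k.
rewrite n1E mE pE_sym E; set u := (-1) ^+ _.
exists (u * c), (u * d), a1, b1, a2, b2; split=> //; first by split; lia.
by rewrite scalerDr !scalerA.
Qed.

Lemma pinv_pp : pinv pp.
Proof.
have -> : pp = 2^-1 *: pE 2 2.
  by rewrite /pE /pp (sgn2 2) scale1r; apply: pcoefP => i j; rewrite !pcoefE; field.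
by apply: pinvZ; exact: pinvE.
Qed.

Lemma pinv_pw : pinv pw.
Proof.
by rewrite pwE; exact: pinvE.
Qed.

Lemma pinv_ps : pinv ps.
Proof.
have -> : ps = pE 8 0 by rewrite /pE /ps !muln0 scale1r.
exact: pinvE.
Qed.

(** Induction on the degree of orbit sums: [pE_decomp] treats those divisible by uv, and the
    recurrence [pE_muls] the sums of pure powers. Stability under products is asked on invariants
    only, where the two products agree. *)
Lemma pinv_gen (S : P -> Prop) :
  S (e 0 0) -> S pp -> S pw -> S ps ->
  (forall c x y, S x -> S y -> S (c *: x + y)) ->
  (forall x y, pinv x -> pinv y -> S x -> S y -> S (x ** y)) ->
  forall g, pinv g -> S g.
Proof.
move=> S1 Sp Sw Ss Slin Smul.
have S0 : S 0 by have := Slin (-1) _ _ S1 S1; rewrite scaleN1r addNr.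
have SZ c x : S x -> S (c *: x) by move=> Sx; rewrite -[_ *: _]addr0; exact: Slin.
suff SE N n m : (n + m < N)%N -> (8 %| n + 3 * m)%N -> S (pE n m).
  move=> g ginv; apply: (pinv_ind ginv) => // n m gnm.
  by apply: (SE (n + m).+1) => //; exact: pinv_dvd ginv gnm.
elim: N n m => // N IH n m nmN d8.
have Spos n' m' : (0 < n')%N -> (0 < m')%N -> (n' + m' < N.+1)%N ->
    (8 %| n' + 3 * m')%N -> S (pE n' m').
  move=> n0 m0 nm' d8'.
  have [c [d [a1 [b1 [a2 [b2 [[l1 l2] d1 d2 ->]]]]]]] := pE_decomp n0 m0 d8'.
  apply: Slin; last apply: SZ; apply: Smul => //.
  - exact: pinvE.
  - exact: pinv_pp.
  - by apply: IH => //; lia.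
  - exact: pinvE.
  - exact: pinv_pw.
  - by apply: IH => //; lia.
have S8 k : (8 * k < N.+1)%N -> S (pE (8 * k) 0).
  case: k => [|k] kN.
    have -> : pE (8 * 0) 0 = 2 *: e 0 0.
      by rewrite /pE !muln0; apply: pcoefP => i j; rewrite !pcoefE; ring.
    exact: SZ.
  have E : pE (8 * k.+1) 0 = (-1) *: pE (8 * k) 8 + pE (8 * k) 0 ** ps.
    by rewrite pE_muls scaleN1r addrC addrK.
  case: k kN E => [|k] kN E.
    have -> : pE 8 0 = ps by rewrite /pE /ps !muln0 scale1r.
    exact: Ss.
  rewrite E; apply: Slin; first by apply: Spos => //; lia.
  apply: Smul => //; [apply: pinvE; lia|exact: pinv_ps|].
  by apply: IH; lia.
case: m nmN d8 => [|m] nmN d8.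
  have [k nE] : exists k, n = (8 * k)%N by exists (n %/ 8)%N; lia.
  by rewrite nE; apply: S8; lia.
case: n nmN d8 => [|n] nmN d8; last by apply: Spos.
have [k mE] : exists k, m.+1 = (8 * k)%N by exists (m.+1 %/ 8)%N; lia.
by rewrite mE pE_sym; apply: SZ; apply: S8; lia.
Qed.

Lemma pcoef_mulp n m x : pcoef (n.+2, m.+2) (x ** pp) = pcoef (n, m) x.
Proof.
apply: (plane_ext_scalar (pcoef (n.+2, m.+2) \o pmulr s pp) (pcoef (n, m))) => i j /=.
rewrite /pmulr pmulee [(j * 2)%N]mulnC sgn2 scale1r !pcoefe !addn2.
by rewrite !xpair_eqE !eqSS.
Qed.

Lemma pcoef_mulp0 n m x : (n < 2)%N || (m < 2)%N -> pcoef (n, m) (x ** pp) = 0.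
Proof.
move=> nm; apply: (plane_ext_scalar (pcoef (n, m) \o pmulr s pp)
  (\0 : {scalar P})) => i j /=.
rewrite /pmulr pmulee pcoefZ pcoefe xpair_eqE !addn2.
by case: eqP => [nE|]; case: eqP => [mE|]; rewrite ?mulr0 //; move: nm; rewrite nE mE.
Qed.

Lemma pcoef_pmulp n m x : pcoef (n.+2, m.+2) (pp ** x) = pcoef (n, m) x.
Proof.
apply: (plane_ext_scalar (pcoef (n.+2, m.+2) \o pmul s pp) (pcoef (n, m))) => i j /=.
rewrite pmulee sgn2 scale1r !pcoefe !add2n.
by rewrite !xpair_eqE !eqSS.
Qed.

Lemma pcoef_mulw n x : pcoef (n + 5, 1)%N (x ** pw) = pcoef (n, 0)%N x.
Proof.
apply: (plane_ext_scalar (pcoef (n + 5, 1)%N \o pmulr s pw) (pcoef (n, 0)%N)) => i j /=.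
rewrite /pmulr /pw pmulDr pmulZr !pmulee !pcoefE !pcoefe !xpair_eqE eqn_add2r.
case: j => [|j]; last first.
  have -> : (1 == j.+1 + 1)%N = false by lia.
  have -> : (1 == j.+1 + 5)%N = false by lia.
  by rewrite !andbF !mulr0 addr0.
by rewrite mul0n muln0 mul1r andbF !mulr0 addr0 andbT.
Qed.

Lemma pcoef_wmul0 x : pcoef (2, 2)%N (pw ** x) = 0.
Proof.
apply: (plane_ext_scalar (pcoef (2, 2)%N \o pmul s pw) (\0 : {scalar P})) => i j /=.
rewrite /pw pmulDl pmulZl !pmulee !pcoefE !pcoefe !xpair_eqE.
have -> : (2 == 5 + i)%N = false by lia.
have -> : (2 == 5 + j)%N = false by lia.
by rewrite andbF !mulr0 addr0.
Qed.

Lemma pcoef_mulw0 x : pcoef (0, 0)%N (x ** pw) = 0.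
Proof.
apply: (plane_ext_scalar (pcoef (0, 0)%N \o pmulr s pw) (\0 : {scalar P})) => i j /=.
rewrite /pmulr /pw pmulDr pmulZr !pmulee !pcoefE !pcoefe !xpair_eqE.
have -> : (0 == i + 5)%N = false by lia.
have -> : (0 == i + 1)%N = false by lia.
by rewrite !mulr0 addr0.
Qed.

Lemma pp_inj x : x ** pp = 0 -> x = 0.
Proof.
by move=> xp; apply: pcoefP => n m; rewrite -pcoef_mulp xp !pcoef0.
Qed.

Lemma pw_sqr : pw ** pw = pq ** pp.
Proof.
rewrite /pw /pq /pp /ps !(pmulDl, pmulDr, pmulZl, pmulZr, pmulee).
apply: pcoefP => i j; rewrite !pcoefE.
by case: (s); rewrite ?(mul1n, mul0n); ring.
Qed.

Lemma pq_pp : pq ** pp = pp ** pq.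
Proof.
rewrite /pq /pp /ps !(pmulDl, pmulDr, pmulZl, pmulZr, pmulee).
apply: pcoefP => i j; rewrite !pcoefE.
by case: (s); rewrite ?(mul1n, mul0n); ring.
Qed.

Lemma pw_pp : pw ** pp = pp ** pw.
Proof.
rewrite /pw /pp !(pmulDl, pmulDr, pmulZl, pmulZr, pmulee).
apply: pcoefP => i j; rewrite !pcoefE.
by case: (s); rewrite ?(mul1n, mul0n); ring.
Qed.

Lemma pq_pw : pq ** pw = pw ** pq.
Proof.
rewrite /pq /pw /ps !(pmulDl, pmulDr, pmulZl, pmulZr, pmulee).
apply: pcoefP => i j; rewrite !pcoefE.
by case: (s); rewrite ?(mul1n, mul0n); ring.
Qed.

Lemma pinv_pq : pinv pq.
Proof.
apply: pinvP; first exact: pinv_ps.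
have -> : e 4 4 = pp ** pp by rewrite /pp pmulee sgn2 scale1r.
by apply: pinvZ; apply: pinv_mul; exact: pinv_pp.
Qed.

(** If y has no pure powers of u or v, it lies in the ideal generated by [pp] and [pw]. Substituting
    such an expression for y and cancelling [pp] determines x. *)
Lemma pinv_syzygy x y : pinv x -> pinv y -> x ** pp + y ** pw = 0 ->
  exists t u, [/\ pinv t, pinv u, x = t ** pw + u ** pq & y = - (t ** pp + u ** pw)].
Proof.
move=> xinv yinv xy.
(* At u^(n+5) v the product with [pp] has coefficient 0, and the product with [pw] sees only the
   coefficient of u^n in y. *)
have y0 n : pcoef (n, 0)%N y = 0.
  have xp0 : pcoef (n + 5, 1)%N (x ** pp) = 0 by rewrite pcoef_mulp0 ?orbT.
  by rewrite -pcoef_mulw -[LHS]add0r -[X in X + _]xp0 -pcoefD xy pcoef0.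
have y0' m : pcoef (0, m)%N y = 0.
  by have [_ yb] := yinv; rewrite -yb pcoef_pb y0 mulr0.
have [t [u [tinv uinv yE]]] : exists t u, [/\ pinv t, pinv u & y = t ** pp + u ** pw].
  apply: (pinv_ind (S := fun y => exists t u,
    [/\ pinv t, pinv u & y = t ** pp + u ** pw]) yinv).
  - by exists 0, 0; split; try exact: pinv0; rewrite !pmul0l addr0.
  - move=> c f g [t1 [u1 [h1 h2 ->]]] [t2 [u2 [h3 h4 ->]]].
    exists (c *: t1 + t2), (c *: u1 + u2); split; try exact: pinvP.
    by rewrite !pmulDl !pmulZl scalerDr addrACA.
  move=> n m ynm.
  have n0 : (0 < n)%N by rewrite lt0n; apply: contraNneq ynm => ->; rewrite y0'.
  have m0 : (0 < m)%N by rewrite lt0n; apply: contraNneq ynm => ->; rewrite y0.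
  have [c [d [a1 [b1 [a2 [b2 [_ d1 d2 ->]]]]]]] := pE_decomp n0 m0 (pinv_dvd yinv ynm).
  exists (c *: pE a1 b1), (d *: pE a2 b2); rewrite !pmulZl; split=> //.
    by apply: pinvZ; exact: pinvE.
  by apply: pinvZ; exact: pinvE.
exists (- t), (- u); split; try exact: pinvN; last first.
  by rewrite !pmulNl -opprD opprK.
rewrite !pmulNl -opprD; apply/eqP; rewrite -subr_eq0 opprK; apply/eqP/pp_inj.
by rewrite -[RHS]xy yE !pmulDl -!pmulA pw_pp pw_sqr.
Qed.

End InvariantPlane.

(** * A module of infinite projective dimension *)

Section PeriodicResolution.
Variables (B : nzRingType) (p q w : B).
Hypotheses (ww : w * w = q * p) (qp : q * p = p * q) (wp : w * p = p * w)
  (qw : q * w = w * q) (p_reg : forall x, x * p = 0 -> x = 0)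
  (syzygy : forall x y, x * p + y * w = 0 ->
     exists t u, x = t * w + u * q /\ y = - (t * p + u * w)).

Let scale_regE (c : B) (v : B^o) : c *: v = c * (v : B). Proof. by []. Qed.

Definition pw_ideal : {pred B^o} := fun x => `[< exists t u, x = t * p + u * w >].

Fact pw_ideal_closed : GRing.submod_closed pw_ideal.
Proof.
split=> [|c x y /asboolP[t [u ->]] /asboolP[t' [u' ->]]].
  by apply/asboolP; exists 0, 0; rewrite !mul0r addr0.
apply/asboolP; exists (c * t + t'), (c * u + u').
by rewrite scalerDr addrACA !mulrDl -!mulrA.
Qed.
HB.instance Definition _ :=
  GRing.isSubmodClosed.Build B B^o pw_ideal pw_ideal_closed.

Definition pw_module : Type := {x : B^o | x \in pw_ideal}.
HB.instance Definition _ := SubChoice.on pw_module.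
HB.instance Definition _ := [SubChoice_isSubLmodule of pw_module by <:].

Local Notation I := pw_module.
Local Notation F := (B^o * B^o)%type.

Definition lin2 (V : lmodType B) (u v : V) (x : F) : V := x.1 *: u + x.2 *: v.

Fact lin2_linear (V : lmodType B) (u v : V) : linear (lin2 u v).
Proof.
by move=> c x y; rewrite /lin2 /= !scalerDl scalerDr addrACA !scalerA.
Qed.
HB.instance Definition _ (V : lmodType B) (u v : V) :=
  GRing.isLinear.Build B F V *:%R (lin2 u v) (lin2_linear u v).

Fact lin2_ext (V : lmodType B) (f g : {linear F -> V}) :
  f (1, 0) = g (1, 0) -> f (0, 1) = g (0, 1) -> f =1 g.
Proof.
move=> f1 f2 [x y]; have -> : (x, y) = x *: (1, 0) + y *: (0, 1) :> F.
  by congr (_, _); rewrite /= !scale_regE ?mulr1 ?mulr0 ?addr0 ?add0r.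
by rewrite !linearP /= !linearZ /= f1 f2.
Qed.

Fact p_in : (p : B^o) \in pw_ideal.
Proof. by apply/asboolP; exists 1, 0; rewrite mul1r mul0r addr0. Qed.
Fact w_in : (w : B^o) \in pw_ideal.
Proof. by apply/asboolP; exists 0, 1; rewrite mul1r mul0r add0r. Qed.

Definition gen_p : I := exist (fun x => x \in pw_ideal) _ p_in.
Definition gen_w : I := exist (fun x => x \in pw_ideal) _ w_in.

(** [... -> F -> F -> I], with differentials [D] and augmentation [eps], is a
    free resolution of the ideal [I] generated by [p] and [w]. *)
Local Notation eps := (lin2 gen_p gen_w).
Local Notation D := (lin2 ((w, - p) : F) ((q, - w) : F)).

Lemma val_eps (x : F) : val (eps x) = x.1 * p + x.2 * w.
Proof. by []. Qed.

(** The matrix with rows (w, -p) and (q, -w) squares to zero because w^2 = qp. Its second coordinate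
    is minus [eps], and on the kernel of [eps] that coordinate determines the first, as p is
    regular. This identifies the syzygies of I with I. *)
Lemma D_E (x : F) : D x = (x.1 * w + x.2 * q, - val (eps x)) :> F.
Proof.
rewrite val_eps /lin2; congr (_, _) => /=.
by rewrite !scale_regE !mulrN -opprD.
Qed.

Lemma eps_surj (y : I) : exists x, eps x = y.
Proof.
case: y => y yI; have /asboolP[t [u yE]] := yI.
by exists (t, u); apply: val_inj; rewrite val_eps /= yE.
Qed.

Lemma eps_ker (x : F) : eps x = 0 -> exists y, D y = x.
Proof.
case: x => x1 x2 /(congr1 val); rewrite val_eps /= => /syzygy[t [u [-> ->]]].
by exists (t, u); rewrite D_E.
Qed.

Lemma D_eps (x : F) : D x = 0 -> eps x = 0.
Proof.
rewrite D_E => /(congr1 snd) /= /eqP; rewrite oppr_eq0 => /eqP E.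
exact: val_inj.
Qed.

Lemma eps_D (x : F) : eps (D x) = 0.
Proof.
apply: val_inj; rewrite val_eps D_E val_eps /=.
by rewrite mulNr !mulrDl -!mulrA ww wp subrr.
Qed.

Lemma D_D (x : F) : D (D x) = 0.
Proof.
rewrite [LHS]D_E eps_D oppr0 D_E val_eps /=; congr (_, _).
by rewrite mulNr !mulrDl -!mulrA ww qp qw subrr.
Qed.

Lemma ker_eps_snd (x y : F) : eps x = 0 -> eps y = 0 -> x.2 = y.2 -> x = y.
Proof.
case: x y => [x1 x2] [y1 y2] /(congr1 val) + /(congr1 val).
rewrite !val_eps /= => ex ey x2y; congr (_, _) => //.
apply/eqP; rewrite -subr_eq0; apply/eqP; apply: p_reg; rewrite mulrBl.
by apply/eqP; rewrite subr_eq0; apply/eqP; apply: (addIr (x2 * w)); rewrite ex x2y.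
Qed.

(** Minimality: [p] is not in the product of the ideal [I] by itself. *)
Hypothesis p_min : forall x y : B,
  x \in pw_ideal -> y \in pw_ideal -> p <> w * x - p * y.

Section Comparison.
Variable P : proj_resolution I.

(** The comparison maps [f : F -> P_n] and [g : P_n -> F] with the periodic
    resolution [... -> F -> F -> I], and the homotopy [h] from [g f] to the
    identity in the preceding degree. *)
Lemma comparison n : exists (g : {linear pr_term P n -> F})
    (f : {linear F -> pr_term P n}) (h : {linear F -> F}),
  [/\ forall x, eps (g (pr_diff P n x)) = 0,
      forall x, exists y, pr_diff P n y = f (D x)
    & forall x, eps (x - g (f x) - h (D x)) = 0].
Proof.
elim: n => [|n [g [f [h [gd fD hD]]]]].
  have [g gE] := @pr_proj _ _ P 0 F I eps (pr_augm P) eps_surj.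
  have [u uE] := pr_augm_surj P (eps (1, 0)).
  have [v vE] := pr_augm_surj P (eps (0, 1)).
  have fE x : pr_augm P (lin2 u v x) = eps x.
    apply: (lin2_ext (f := pr_augm P \o lin2 u v) (g := eps)).
      by rewrite /= /lin2 /= scale1r scale0r addr0 uE.
    by rewrite /= /lin2 /= scale1r scale0r add0r vE.
  exists g, (lin2 u v), (lin2 (0 : F) 0); split=> x.
  - by rewrite gE; apply/pr_exact0; exists x.
  - by apply/pr_exact0; rewrite fE eps_D.
  - have h0 : lin2 (0 : F) 0 (D x) = 0 by rewrite [LHS]/lin2 !scaler0 addr0.
    transitivity (eps (x - g (lin2 u v x) - 0)).
      by congr (eps (_ - _)); exact: h0.
    by rewrite subr0 linearB /= gE fE subrr.
have [u uE] := fD (1, 0); have [v vE] := fD (0, 1).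
have f'E x : pr_diff P n (lin2 u v x) = f (D x).
  apply: (lin2_ext (f := pr_diff P n \o lin2 u v) (g := f \o D)).
    by rewrite /= {1}/lin2 /= scale1r scale0r addr0 uE.
  by rewrite /= {1}/lin2 /= scale1r scale0r add0r vE.
(* The image lies in the kernel of [eps], which is the image of [D], so its second coordinate lies
   in I. Projectivity can thus be applied to [eps] to find a lift through [D]. *)
have k_in x : (- (g (pr_diff P n x)).2 : B^o) \in pw_ideal.
  have [y yE] := eps_ker (gd x).
  by rewrite -yE D_E opprK; exact: valP.
pose k x : I := exist (fun x => x \in pw_ideal) _ (k_in x).
have k_lin : linear k.
  move=> c x y; by apply: val_inj; rewrite /= !linearP /=.
pose kL : {linear pr_term P n.+1 -> I} :=
  HB.pack k (GRing.isLinear.Build B _ _ _ k k_lin).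
have [g' g'E] := @pr_proj _ _ P n.+1 F I eps kL eps_surj.
have Dg' x : D (g' x) = g (pr_diff P n x).
  apply: ker_eps_snd => //; first exact: eps_D.
  by rewrite D_E g'E /= opprK.
(* The homotopy defect lies in the image of [D]; preimages at the two basis vectors define the next
   homotopy. *)
have [a aE] := eps_ker (hD (1, 0)); have [b bE] := eps_ker (hD (0, 1)).
have h'E x : D (lin2 a b x) = x - g (f x) - h (D x).
  apply: (lin2_ext (f := D \o lin2 a b) (g := (idfun \- (g \o f)) \- (h \o D))).
    by rewrite [LHS](_ : _ = D a) ?aE //= [lin2 a b _]/lin2 scale1r scale0r addr0.
  by rewrite [LHS](_ : _ = D b) ?bE //= [lin2 a b _]/lin2 scale1r scale0r add0r.
exists g', (lin2 u v), (lin2 a b); split=> x.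
- apply: D_eps; rewrite Dg'.
  have -> : pr_diff P n (pr_diff P n.+1 x) = 0 by apply/pr_exact; exists x.
  by rewrite linear0.
- by apply/pr_exact; rewrite f'E D_D linear0.
(* [D] of the new defect is zero: the old homotopy identity at [D x] cancels every term, its own
   correction vanishing by [D_D]. *)
- apply: D_eps; rewrite !linearB /= Dg' f'E h'E D_D linear0 subr0.
  by rewrite opprB addrA subrK subrr.
Qed.

End Comparison.

(** Where the other resolution vanishes, [eps x = eps (h (D x))]. At x = (1, 0) the left side is p
    and the right side lies in the square of I, because the entries w, -p of [D (1, 0)] do.. lie in
    I. *)
Lemma pw_module_infinite_dim d : ~ proj_dim_le (I : lmodType B) d.
Proof.
move=> [P P0]; have [g [f [h [_ _ hD]]]] := comparison P d.+1.
have f0 x : f x = 0 by exact: (P0 d.+1 (ltnSn d)).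
have D10 : D (1, 0) = w *: (1, 0) + (- p) *: (0, 1) :> F.
  rewrite D_E; congr (_, _); rewrite /= !scale_regE.
    by rewrite mul1r mul0r mulr1 mulr0.
  by rewrite mul1r mul0r addr0 mulr0 mulr1 add0r.
have E : eps (h (D (1, 0))) = w *: eps (h (1, 0)) + (- p) *: eps (h (0, 1)).
  rewrite D10 [h _]linearP [eps _]linearP; congr (_ + _).
  by rewrite [h (_ *: _)]linearZ [LHS]linearZ.
have epsB (u v : F) : eps (u - v) = eps u - eps v by exact: linearB.
have /eqP := hD (1, 0); rewrite f0 linear0 subr0 epsB subr_eq0.
rewrite E => /eqP /(congr1 val) E2.
have p1 : val (eps (1, 0)) = p by rewrite val_eps /= mul1r mul0r addr0.
apply: (p_min (valP (eps (h (1, 0)))) (valP (eps (h (0, 1))))).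
by rewrite -mulNr -[LHS]p1; exact: E2.
Qed.

Lemma infinite_global_dimension : ~ finite_global_dimension B.
Proof. by move=> [d H]; apply: (pw_module_infinite_dim (H (I : lmodType B))). Qed.

End PeriodicResolution.

(** * The algebra of invariants and its global dimension *)

Section InvariantAlgebra.
Variables (C : numClosedFieldType) (s : bool).
Variables (gT : finGroupType) (a b : gT).
Hypotheses (gen_ab : <<[set a; b]>>%g = [set: gT]%SET) (a8 : (a ^+ 8 = 1)%g)
  (b2 : (b ^+ 2 = 1)%g) (ba : (b * a = a ^+ 3 * b)%g) (card_gT : #|gT| = 16%N).
Local Notation P := (plane C).
Local Notation e := (pe C).
Local Notation r := (prel C s).
Local Notation A := (quad_algebra r).
Variables (z zeta : C).
Hypotheses (z2 : z ^+ 2 = -1) (zeta2 : zeta ^+ 2 = z).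
Variable M : module_algebra (kashina_comul C a b) A.
Hypothesis ME : forall h f, M h f = kmod s gen_ab a8 b2 ba card_gT z2 zeta2 h f.
Local Notation pinv := (pinv s zeta).
Local Notation B := (invariant_algebra M).
Local Notation "f ** g" := (pmul s f g) (at level 40, left associativity).

Let zeta4 : zeta ^+ 4 = -1. Proof. exact: zeta4_of_z zeta2. Qed.
Let invP f : f \in invariants M <-> pinv (phi f).
Proof. exact: (invariantsP ME). Qed.

(** A triangular change of generators: the multiple of the square of [pp] in [g2] is removed with
    [g1]. *)
Lemma invariants_gen (g1 g2 g3 : A) (c1 c2 c3 : C) :
  c1 != 0 -> c3 != 0 -> phi g1 = pp C ->
  phi g2 = c1 *: ps C + c2 *: (pp C ** pp C) -> phi g3 = c3 *: pw C s ->
  forall f, f \in invariants M <-> gen_subalg [:: g1; g2; g3] f.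
Proof.
move=> c10 c30 g1E g2E g3E f; split=> [/invP finv T Tsub gT'|]; last first.
  apply; first exact: invariants_subalg.
  move=> g gs; apply/invP; move: gs; rewrite !inE.
  case/or3P => /eqP ->; rewrite ?g1E ?g2E ?g3E.
  - exact: pinv_pp.
  - apply: pinvP; first exact: pinv_ps.
    by apply: pinvZ; apply: pinv_mul; exact: pinv_pp.
  - by apply: pinvZ; exact: pinv_pw.
have [T1 Tlin Tmul] := Tsub.
have T0 : 0 \in T by have := Tlin (-1) _ _ T1 T1; rewrite scaleN1r addNr.
have TZ c u : u \in T -> c *: u \in T by move=> Tu; rewrite -[_ *: _]addr0; exact: Tlin.
have [T_1 T_2 T_3] : [/\ g1 \in T, g2 \in T & g3 \in T].
  by split; apply: gT'; rewrite !inE eqxx ?orbT.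
suff H g : pinv g -> phi_inv s g \in T by rewrite -(phiK f); exact: H.
apply: (pinv_gen zeta4 (S := fun g => phi_inv s g \in T)).
- by rewrite -(phi1 C s) phiK.
- by rewrite -g1E phiK.
- have -> : phi_inv s (pw C s) = c3^-1 *: g3.
    by apply: phi_inj; rewrite phi_invK linearZ /= g3E scalerA mulVf // scale1r.
  exact: TZ.
- have -> : phi_inv s (ps C) = c1^-1 *: (- c2 *: (g1 * g1) + g2).
    apply: phi_inj; rewrite phi_invK linearZ /= linearP /= phiM g1E g2E.
    rewrite (pinv_dot zeta4 _ (pinv_pp s zeta4)) scaleNr addrC addrK scalerA mulVf //.
    by rewrite scale1r.
  by apply: TZ; apply: Tlin => //; exact: Tmul.
- move=> c x y xT yT.
  have -> : phi_inv s (c *: x + y) = c *: phi_inv s x + phi_inv s y.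
    by apply: phi_inj; rewrite linearP /= !phi_invK.
  exact: Tlin.
- move=> x y xinv yinv xT yT.
  have -> : phi_inv s (x ** y) = phi_inv s x * phi_inv s y.
    by apply: phi_inj; rewrite phiM !phi_invK (pinv_dot zeta4).
  exact: Tmul.
Qed.

Definition bphi (x : B) : P := phi (val x).

Lemma bphi_pinv x : pinv (bphi x).
Proof. exact/invP/(valP x). Qed.
Lemma bphi_inj : injective bphi.
Proof. by move=> x y /phi_inj /val_inj. Qed.
Lemma bphiM x y : bphi (x * y) = bphi x ** bphi y.
Proof. by rewrite -(pinv_dot zeta4 _ (bphi_pinv x)) -phiM. Qed.
Lemma bphiD x y : bphi (x + y) = bphi x + bphi y.
Proof. by rewrite -linearD. Qed.
Lemma bphiN x : bphi (- x) = - bphi x.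
Proof. by rewrite -linearN. Qed.
Lemma bphi0 : bphi 0 = 0.
Proof. exact: (linear0 (@phi C s)). Qed.
Lemma bphi_surj g : pinv g -> exists x, bphi x = g.
Proof.
move=> ginv; have ginv' : phi_inv s g \in invariants M by apply/invP; rewrite phi_invK.
by exists (exist (fun f => f \in invariants M) _ ginv'); rewrite /bphi /= phi_invK.
Qed.

Lemma invariants_infinite_gldim : ~ finite_global_dimension B.
Proof.
have [p pE] := bphi_surj (pinv_pp s zeta4).
have [q qE] := bphi_surj (pinv_pq s zeta4).
have [w wE] := bphi_surj (pinv_pw s zeta4).
apply: (@infinite_global_dimension _ p q w).
- by apply: bphi_inj; rewrite !bphiM pE qE wE pw_sqr.
- by apply: bphi_inj; rewrite !bphiM pE qE pq_pp.
- by apply: bphi_inj; rewrite !bphiM pE wE pw_pp.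
- by apply: bphi_inj; rewrite !bphiM qE wE pq_pw.
- move=> x /(congr1 bphi); rewrite bphiM bphi0 pE => /pp_inj x0.
  by apply: bphi_inj; rewrite x0 bphi0.
- move=> x y /(congr1 bphi); rewrite bphiD !bphiM bphi0 pE wE.
  move=> /(pinv_syzygy zeta4 (bphi_pinv x) (bphi_pinv y)) [t [u [tinv uinv xE yE]]].
  have [[t' tE] [u' uE]] := (bphi_surj tinv, bphi_surj uinv).
  exists t', u'; split; apply: bphi_inj.
    by rewrite bphiD !bphiM tE uE wE qE xE.
  by rewrite bphiN bphiD !bphiM tE uE wE pE yE.
(* Compare coefficients of u^2 v^2: p has 1, multiples of w have 0, and py has the constant
   coefficient of y, which is 0 for y in the ideal. *)
move=> x y _ /asboolP[t [u ->]] /(congr1 (fun v => pcoef (2, 2)%N (bphi v))).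
rewrite bphiD bphiN !bphiM bphiD !bphiM pE wE /pp pcoefe eqxx pcoefD pcoefN.
rewrite pcoef_wmul0 -/(pp C) pcoef_pmulp pcoefD pcoef_mulp0 // pcoef_mulw0.
by rewrite addr0 subr0 => /eqP; rewrite oner_eq0.
Qed.

End InvariantAlgebra.

(** * The generators of the invariants *)

(** Powers are regrouped into squares because X^2 and Y^2 have trivial character, where [phi] is
    multiplicative for the untwisted product. *)
Lemma expr4_squares (T : pzRingType) (x : T) : x ^+ 4 = x * x * (x * x).
Proof. by rewrite (exprD x 2 2) expr2. Qed.

Lemma expr6_squares (T : pzRingType) (x : T) : x ^+ 6 = x * x * (x * x) * (x * x).
Proof. by rewrite (exprD x 4 2) expr4_squares expr2. Qed.

Section Generators.
Variables (C : numClosedFieldType).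
Local Notation e := (pe C).

Section Degree2.
Variable s : bool.
Local Notation r := (prel C s).
Local Notation X := (qX r).
Local Notation Y := (qY r).

Definition phom0 (f : quad_algebra r) := phom s (false, false) (phi f).

Lemma phiM0 f g : phom0 f -> phi (f * g) = pmul s (phi f) (phi g).
Proof. by move=> f0; rewrite phiM dot_hom0l. Qed.

Lemma phom0M f g : phom0 f -> phom0 g -> phom0 (f * g).
Proof. by move=> f0 g0; rewrite /phom0 phiM0 //; exact: (phomM f0 g0). Qed.

Lemma phom0D f g : phom0 f -> phom0 g -> phom0 (f + g).
Proof. by move=> f0 g0; rewrite /phom0 linearD; exact: phomD. Qed.

Lemma phom0Z c f : phom0 f -> phom0 (c *: f).
Proof. by move=> f0; rewrite /phom0 linearZ; exact: phomZ. Qed.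

Lemma phom0N f : phom0 f -> phom0 (- f).
Proof. by rewrite -scaleN1r; exact: phom0Z. Qed.

Let homX : phom s (true, false) (phi X). Proof. by rewrite phiX; exact: pgen_hom. Qed.
Let homY : phom s (true, true) (phi Y). Proof. by rewrite phiY; exact: pgen_hom. Qed.

Lemma phi_XX : phi (X * X) = pmul s (pgen C ord0) (pgen C ord0) /\ phom0 (X * X).
Proof.
have E : phi (X * X) = pmul s (phi X) (phi X).
  by rewrite phiM (dot_hom homX homX) [gcoef _ _ _]/= scale1r.
by rewrite /phom0 E -(phiX C s); split=> //; exact: (phomM homX homX).
Qed.

Lemma phi_YY : phi (Y * Y) = pmul s (pgen C ord_max) (pgen C ord_max) /\ phom0 (Y * Y).
Proof.
have E : phi (Y * Y) = pmul s (phi Y) (phi Y).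
  by rewrite phiM (dot_hom homY homY) [gcoef _ _ _]/= scale1r.
by rewrite /phom0 E -(phiY C s); split=> //; exact: (phomM homY homY).
Qed.

(** XY itself has a nontrivial character and equals ['i] times the untwisted product. Its square is
    twisted by 1, so the two factors ['i] give -1. *)
Lemma phi_XYXY : let f := pmul s (pgen C ord0) (pgen C ord_max) in
  phi ((X * Y) ^+ 2) = - pmul s f f /\ phom0 ((X * Y) ^+ 2).
Proof.
have ii : 'i * 'i = -1 :> C by rewrite -expr2 sqrCi.
have E : phi (X * Y) = 'i *: pmul s (phi X) (phi Y).
  by rewrite phiM (dot_hom homX homY).
have h : phom s (false, true) (phi (X * Y)).
  by rewrite E; apply: phomZ; exact: (phomM homX homY).
have E2 : phi ((X * Y) ^+ 2) = pmul s (phi (X * Y)) (phi (X * Y)).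
  by rewrite expr2 phiM (dot_hom h h) [gcoef _ _ _]/= scale1r.
split; last by rewrite /phom0 E2; exact: (phomM h h).
by rewrite E2 E pmulZl pmulZr scalerA ii scaleN1r phiX phiY.
Qed.

Lemma phi_YXYX : let f := pmul s (pgen C ord_max) (pgen C ord0) in
  phi ((Y * X) ^+ 2) = - pmul s f f /\ phom0 ((Y * X) ^+ 2).
Proof.
have ii : - 'i * - 'i = -1 :> C by rewrite mulrNN -expr2 sqrCi.
have E : phi (Y * X) = - 'i *: pmul s (phi Y) (phi X).
  by rewrite phiM (dot_hom homY homX).
have h : phom s (false, true) (phi (Y * X)).
  by rewrite E; apply: phomZ; exact: (phomM homY homX).
have E2 : phi ((Y * X) ^+ 2) = pmul s (phi (Y * X)) (phi (Y * X)).
  by rewrite expr2 phiM (dot_hom h h) [gcoef _ _ _]/= scale1r.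
split; last by rewrite /phom0 E2; exact: (phomM h h).
by rewrite E2 E pmulZl pmulZr scalerA ii scaleN1r phiX phiY.
Qed.

End Degree2.

Lemma skew_generators (X := qX (prel C false)) (Y := qY (prel C false)) :
  [/\ phi ((X ^+ 2 - Y ^+ 2) ^+ 2) = pp C,
      phi (X ^+ 2 * Y ^+ 2 * (X ^+ 2 + Y ^+ 2) ^+ 2) =
        64^-1 *: ps C + (- 32^-1) *: pmul false (pp C) (pp C)
    & phi (X ^+ 6 - Y ^+ 6 + 5%:R * (X ^+ 2 * Y ^+ 2 * (X ^+ 2 - Y ^+ 2))) =
        2^-1 *: pw C false].
Proof.
have [xE x0] := phi_XX false; have [yE y0] := phi_YY false.
rewrite -/X in xE x0; rewrite -/Y in yE y0.
rewrite !expr6_squares mulr_natl -scaler_nat !expr2.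
have xy0 := phom0M x0 y0.
have d0 : phom0 (X * X - Y * Y) by apply: phom0D => //; exact: phom0N.
have s0 : phom0 (X * X + Y * Y) by exact: phom0D.
have xE' : phi (X * X) = 4^-1 *: (e 2 0 + 2 *: e 1 1 + e 0 2).
  rewrite xE /pgen !pmulE.
  by apply: pcoefP => k l; rewrite !pcoefE; field.
have yE' : phi (Y * Y) = 4^-1 *: (e 2 0 - 2 *: e 1 1 + e 0 2).
  rewrite yE /pgen !pmulE.
  by apply: pcoefP => k l; rewrite !pcoefE; field.
have dE : phi (X * X - Y * Y) = e 1 1.
  by rewrite linearB /= xE' yE'; apply: pcoefP => k l; rewrite !pcoefE; field.
have sE : phi (X * X + Y * Y) = 2^-1 *: (e 2 0 + e 0 2).
  by rewrite linearD /= xE' yE'; apply: pcoefP => k l; rewrite !pcoefE; field.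
have xyE : phi (X * X * (Y * Y)) = 16^-1 *: (e 4 0 - 2 *: e 2 2 + e 0 4).
  rewrite phiM0 // xE' yE' !pmulE.
  by apply: pcoefP => k l; rewrite !pcoefE; field.
split.
- by rewrite phiM0 // dE pmulee mul0n scale1r.
- rewrite phiM0 // xyE phiM0 // sE /ps /pp.
  rewrite !pmulE.
  by apply: pcoefP => k l; rewrite !pcoefE; field.
(* The coefficient 5 cancels u^3 v^3: the sixth powers contribute 40/64 and the correction
   -10/16. *)
have x20 := phom0M x0 x0; have y20 := phom0M y0 y0.
rewrite linearD linearB linearZ /= (phiM0 _ x20) (phiM0 _ x0).
rewrite (phiM0 _ y20) (phiM0 _ y0) (phiM0 _ xy0) xyE dE xE' yE' /pw.
rewrite !pmulE.
by apply: pcoefP => k l; rewrite !pcoefE; field.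
Qed.

End Generators.

Section SquareGenerators.
Variables (C : numClosedFieldType).
Local Notation e := (pe C).

Lemma square_generators (X := qX (prel C true)) (Y := qY (prel C true)) :
  [/\ phi (2%:R * X ^+ 4 + (X * Y) ^+ 2 + (Y * X) ^+ 2) = pp C,
      phi (14%:R * X ^+ 8 + (X * Y) ^+ 4 + (Y * X) ^+ 4) =
        16^-1 *: ps C + (14 / 16) *: pmul true (pp C) (pp C)
    & phi (X ^+ 2 * ((X * Y) ^+ 2 - (Y * X) ^+ 2)) = 8^-1 *: pw C true].
Proof.
have [xE x0] := phi_XX C true.
have [aE a0] := phi_XYXY C true; have [bE b0] := phi_YXYX C true.
rewrite -/X in xE x0; rewrite -/X -/Y in aE a0 bE b0.
have xE' : phi (X * X) = 4^-1 *: (e 2 0 + e 0 2).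
  rewrite xE /pgen !pmulE.
  by apply: pcoefP => k l; rewrite !pcoefE; field.
have f1 : pmul true (pgen C ord0) (pgen C ord_max) =
    4^-1 *: (e 2 0 - 2 *: e 1 1 - e 0 2).
  rewrite /pgen !pmulE.
  by apply: pcoefP => k l; rewrite !pcoefE /=; field.
have f2 : pmul true (pgen C ord_max) (pgen C ord0) =
    4^-1 *: (e 2 0 + 2 *: e 1 1 - e 0 2).
  rewrite /pgen !pmulE.
  by apply: pcoefP => k l; rewrite !pcoefE /=; field.
have aE' : phi ((X * Y) ^+ 2) =
    (- 16^-1) *: (e 4 0 - 4 *: e 3 1 - 6 *: e 2 2 + 4 *: e 1 3 + e 0 4).
  rewrite aE f1 !pmulE.
  by apply: pcoefP => k l; rewrite !pcoefE; field.
have bE' : phi ((Y * X) ^+ 2) =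
    (- 16^-1) *: (e 4 0 + 4 *: e 3 1 - 6 *: e 2 2 - 4 *: e 1 3 + e 0 4).
  rewrite bE f2 !pmulE.
  by apply: pcoefP => k l; rewrite !pcoefE; field.
have x40 := phom0M x0 x0.
have x4E : phi (X * X * (X * X)) = 16^-1 *: (e 4 0 + 2 *: e 2 2 + e 0 4).
  rewrite phiM0 // xE' !pmulE.
  by apply: pcoefP => k l; rewrite !pcoefE; field.
have X4 : X ^+ 4 = X * X * (X * X) by exact: expr4_squares.
split.
(* The coefficient 2 cancels u^4 and v^4. *)
- rewrite X4 mulr_natl -scaler_nat !linearD linearZ /= x4E aE' bE' /pp.
  by apply: pcoefP => k l; rewrite !pcoefE; field.
(* The coefficient 14 cancels u^6 v^2 and u^2 v^6, which occur with 4/256 in X^8 and -56/256 in the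
   sum of the fourth powers. *)
- have X8 : X ^+ 8 = X * X * (X * X) * (X * X * (X * X)).
    by rewrite (exprD X 4 4) X4.
  have pow4 (t : quad_algebra (prel C true)) : t ^+ 4 = t ^+ 2 * t ^+ 2.
    by rewrite -exprD.
  rewrite X8 !pow4 mulr_natl -scaler_nat !linearD linearZ /=.
  rewrite (phiM0 _ x40) (phiM0 _ a0) (phiM0 _ b0) x4E aE' bE' /pp /ps.
  rewrite !pmulE.
  by apply: pcoefP => k l; rewrite !pcoefE; field.
rewrite expr2 phiM0 // linearB /= xE' aE' bE' /pw.
rewrite !pmulE.
by apply: pcoefP => k l; rewrite !pcoefE /=; field.
Qed.

End SquareGenerators.

Lemma sd16_presentation (a b : 'SD_16) : sd16_generators a b ->
  [/\ <<[set a; b]>>%g = [set: 'SD_16]%SET, (a ^+ 8 = 1)%g, (b ^+ 2 = 1)%g,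
      (b * a = a ^+ 3 * b)%g & #|'SD_16| = 16%N].
Proof.
by move=> [gen_ab a8 b2 ba]; split=> //; rewrite -cardsT (card_semidihedral (n := 4)).
Qed.

Section Kashina13.
Variables (C : numClosedFieldType) (R : realType) (s : bool) (a b : 'SD_16) (z : C).
Hypotheses (hab : sd16_generators a b) (z2 : z ^+ 2 = -1).
Local Notation r := (prel C s).

Lemma kashina_action_exists :
  exists M : module_algebra (kashina_comul C a b) (quad_algebra r), kashina_values M z.
Proof.
have [gen_ab a8 b2 ba card_gT] := sd16_presentation hab.
by exists (kmod s gen_ab a8 b2 ba card_gT z2 (sqrtCK z)); exact: kmod_values.
Qed.

Variable M : module_algebra (kashina_comul C a b) (quad_algebra r).
Hypothesis Mz : kashina_values M z.

Lemma kashina_action_properties : [/\ inner_faithful M,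
  connected_graded (invariant_grade M) & ~ AS_regular R (invariant_grade M)].
Proof.
have [gen_ab a8 b2 ba card_gT] := sd16_presentation hab.
have [zeta [zeta2 ME]] := kashina_values_kmod gen_ab a8 b2 ba card_gT z2 Mz.
split.
(* The action is faithful, so an annihilating ideal has only the element 0. *)
- by move=> I _ IM h Ih; apply: (act_faithful ME) => f; exact: IM.
- exact: (invariants_connected ME).
by move=> [gldim _ _]; exact: (invariants_infinite_gldim ME).
Qed.

Lemma kashina_invariants (g1 g2 g3 : quad_algebra r) (c1 c2 c3 : C) :
  c1 != 0 -> c3 != 0 -> phi g1 = pp C ->
  phi g2 = c1 *: ps C + c2 *: pmul s (pp C) (pp C) -> phi g3 = c3 *: pw C s ->
  forall f, f \in invariants M <-> gen_subalg [:: g1; g2; g3] f.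
Proof.
have [gen_ab a8 b2 ba card_gT] := sd16_presentation hab.
have [zeta [zeta2 ME]] := kashina_values_kmod gen_ab a8 b2 ba card_gT z2 Mz.
exact: (invariants_gen ME).
Qed.

End Kashina13.

Theorem theorem5p2 (R : realType) (a b : 'SD_16) (hab : sd16_generators a b)
    (z : R[i]) (hz : z = 'i \/ z = - 'i) :
  [/\ forall r : quadric R[i], r = skew_rel R[i] \/ r = square_rel R[i] ->
        (exists M : module_algebra (kashina_comul R[i] a b) (quad_algebra r),
           kashina_values M z) /\
        (forall M : module_algebra (kashina_comul R[i] a b) (quad_algebra r),
           kashina_values M z ->
           [/\ inner_faithful M,
               connected_graded (invariant_grade M)
             & ~ AS_regular R (invariant_grade M)]),
      forall M : module_algebra (kashina_comul R[i] a b)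
                                (quad_algebra (skew_rel R[i])),
        kashina_values M z ->
        let X := qX (skew_rel R[i]) in let Y := qY (skew_rel R[i]) in
        forall f, f \in invariants M <->
          gen_subalg [:: (X ^+ 2 - Y ^+ 2) ^+ 2;
                         X ^+ 2 * Y ^+ 2 * (X ^+ 2 + Y ^+ 2) ^+ 2;
                         X ^+ 6 - Y ^+ 6
                           + 5%:R * (X ^+ 2 * Y ^+ 2 * (X ^+ 2 - Y ^+ 2))] f
    & forall M : module_algebra (kashina_comul R[i] a b)
                                (quad_algebra (square_rel R[i])),
        kashina_values M z ->
        let X := qX (square_rel R[i]) in let Y := qY (square_rel R[i]) in
        forall f, f \in invariants M <->
          gen_subalg [:: 2%:R * X ^+ 4 + (X * Y) ^+ 2 + (Y * X) ^+ 2;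
                         14%:R * X ^+ 8 + (X * Y) ^+ 4 + (Y * X) ^+ 4;
                         X ^+ 2 * ((X * Y) ^+ 2 - (Y * X) ^+ 2)] f].
Proof.
have z2 : z ^+ 2 = -1 by case: hz => ->; rewrite ?sqrrN sqrCi.
(* The leading constants are the inverses of 64 and 2, then of 16 and 8; the successor makes the
   arguments below one less. *)
have inv_neq0 n : (n.+1%:R^-1 : R[i]) != 0 by rewrite invr_eq0 pnatr_eq0.
split.
- move=> _ [->|->]; split=> [|M Mz].
  + exact: (@kashina_action_exists _ false a b z hab z2).
  + exact: (@kashina_action_properties _ R false a b z hab z2 M Mz).
  + exact: (@kashina_action_exists _ true a b z hab z2).
  + exact: (@kashina_action_properties _ R true a b z hab z2 M Mz).
- move=> M Mz X Y; have [g1E g2E g3E] := skew_generators R[i].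
  exact: (kashina_invariants (s := false) hab z2 Mz
    (inv_neq0 63%N) (inv_neq0 1%N) g1E g2E g3E).
- move=> M Mz X Y; have [g1E g2E g3E] := square_generators R[i].
  exact: (kashina_invariants (s := true) hab z2 Mz
    (inv_neq0 15%N) (inv_neq0 7%N) g1E g2E g3E).
Qed.
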